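(* Let $h:[0,+\infty)\to\mathbb R$ be continuous and put $\psi(t)=h(e^t)$. Suppose that $\psi$ is twice differentiable on $[0,\infty)$ and that $\psi''$ increases to $+\infty$ (that is, $\psi''$ is an increasing function and $\lim_{t\to\infty}\psi''(t)=+\infty$). Then the Fock type space $\mathcal F_h$ has no Riesz basis of normalized reproducing kernels, i.e. there is no set $\Lambda\subset\mathbb C$ such that $\{\Bbbk_\lambda\}_{\lambda\in\Lambda}$ is a Riesz basis in $\mathcal F_h$.
   Context: A continuous function (weight) $h$ on $[0,+\infty)$ is extended to $\mathbb C$ by $h(z)=h(|z|)$. The Fock type space is the Hilbert space of entire functions $$\mathcal F_h=\Bigl\{f \text{ entire}:\ \|f\|^2=\int_{\mathbb C}|f(z)|^2e^{-h(z)}\,dm(z)<\infty\Bigr\},$$ where $dm$ is area Lebesgue measure. Point evaluations are bounded on $\mathcal F_h$; ${\bf k}_\lambda\in\mathcal F_h$ denotes the reproducing kernel at $\lambda\in\mathbb C$, i.e. $f(\lambda)=\langle f,{\bf k}_\lambda\rangle$ for all $f\in\mathcal F_h$, and $\Bbbk_\lambda={\bf k}_\lambda/\|{\bf k}_\lambda\|$ is the normalized reproducing kernel. For $\Lambda\subset\mathbb C$ (a sequence of distinct points), $\{\Bbbk_\lambda\}_{\lambda\in\Lambda}$ is a Riesz basis in $\mathcal F_h$ if it is complete (its linear span is dense) and for some $c,C>0$ one has $c\sum|a_\lambda|^2\le\|\sum a_\lambda\Bbbk_\lambda\|^2\le C\sum|a_\lambda|^2$ for all finite sequences $\{a_\lambda\}$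 of complex numbers. *)

(* Defs.v *)
From HB Require Import structures.
From mathcomp Require Import all_boot all_order all_algebra.
From mathcomp Require Import finmap complex.
From mathcomp Require Import all_classical all_reals all_analysis.

Set Implicit Arguments.
Unset Strict Implicit.
Unset Printing Implicit Defensive.

Import Order.TTheory GRing.Theory Num.Theory.
Import numFieldNormedType.Exports.

Local Open Scope classical_set_scope.
Local Open Scope complex_scope.
Local Open Scope ring_scope.

(* [ComplexField.Normc.normc] is the modulus with values in [R];
   [`|z|] would live in [R[i]]. *)
Notation modulus := ComplexField.Normc.normc.

(* The derivative is taken relative to [D]: at an endpoint of an interval it
   is the one-sided derivative. *)
Definition has_derivative_on {R : realType} (D : set R) (f f' : R -> R) : Prop :=
  forall x, D x ->
    (f y - f x) / (y - x) @[y --> within D x^'] --> f' x.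

Section FockSpace.
Context {R : realType}.
Local Notation C := R[i].

(* [R[i]^o] is the complex line as a normed space over [R[i]], so that
   [derivable] is differentiability in the complex sense. *)
Definition entire (f : C -> C) : Prop :=
  forall z : C, derivable (f : C^o -> C^o) z 1.

(* Integrals over the complex plane are integrals over the pairs
   [p = (x, y)] with [z = x + iy]. *)
Local Notation area :=
  (@lebesgue_measure R \x @lebesgue_measure R)%E.

Definition plane_point (p : R * R) : C := p.1 +i* p.2.

Variable h : R -> R.

Definition weight (z : C) : R := expR (- h (modulus z)).

Definition fock_sqnorm (f : C -> C) : \bar R :=
  (\int[area]_p (modulus (f (plane_point p)) ^+ 2 * weight (plane_point p))%:E)%E.

Definition fock_space : set (C -> C) :=
  [set f | entire f /\ (fock_sqnorm f < +oo)%E].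

Definition fock_norm (f : C -> C) : R := Num.sqrt (fine (fock_sqnorm f)).

Definition fock_inner (f g : C -> C) : C :=
  let F (p : R * R) :=
    f (plane_point p) * (g (plane_point p))^*%C * (weight (plane_point p))%:C in
  Rintegral area setT (fun p => complex.Re (F p))
  +i* Rintegral area setT (fun p => complex.Im (F p)).

Definition is_reproducing_kernel (l : C) (k : C -> C) : Prop :=
  fock_space k /\ forall f, fock_space f -> f l = fock_inner f k.

(* The default value 0 is only taken when there is no reproducing kernel
   at [l]. *)
Definition kernel_at (l : C) : C -> C :=
  xget (fun=> 0) [set k | is_reproducing_kernel l k].

Definition normalized_kernel (l : C) : C -> C :=
  fun z => ((fock_norm (kernel_at l))^-1)%:C * kernel_at l z.

Definition lincomb (v : C -> C -> C) (A : {fset C}) (a : C -> C) : C -> C :=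
  fun z => \sum_(l <- A) a l * v l z.

Definition complete_family (L : set C) (v : C -> C -> C) : Prop :=
  forall f, fock_space f -> forall e : R, 0 < e ->
    exists (A : {fset C}) (a : C -> C),
      [set` A] `<=` L /\ fock_norm (fun z => f z - lincomb v A a z) < e.

Definition riesz_basis (L : set C) (v : C -> C -> C) : Prop :=
  complete_family L v /\
  exists c1 c2 : R, [/\ 0 < c1, 0 < c2 &
    forall (A : {fset C}) (a : C -> C), [set` A] `<=` L ->
      c1 * (\sum_(l <- A) modulus (a l) ^+ 2) <= fock_norm (lincomb v A a) ^+ 2
      /\ fock_norm (lincomb v A a) ^+ 2 <= c2 * (\sum_(l <- A) modulus (a l) ^+ 2)].

End FockSpace.

(* Main.v *)
(** Let [s_n] be the norm of [z^n].  Taylor coefficients identify the Fock space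
    with the sequences [x] in l^2 through [f(z) = sum_n x_n z^n / s_n], and the
    normalized kernel at [l] with [conj(l^n / s_n) / sqrt(K(l))], where
    [K(l) = sum_n |l|^(2n) / s_n^2].  Suppose that these kernels form a Riesz
    basis for [l] in [Lambda].

    The dual function [g_l] vanishes on [Lambda] except at [l], and
    [(z - l) g_l = gamma_l G] with [G] independent of [l].  Rotating [Lambda] by a
    unimodular number [u] close to [1] and using the Bessel inequality for [g_l]
    gives, uniformly in [l],
    [sum_l' (|gamma_l| / |gamma_l'|)^2 |u - 1|^2 |l'|^2 / |u l' - l|^2 <= C].
    Averaging over [l] in a finite set and pairing [(l, l')] with [(l', l)] removes
    the unknown ratios, because [x + 1/x >= 2].

    Put [rho = psi''(t0)^(-1/2)].  As [psi''] tends to infinity, for every [L] there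
    are arbitrarily large [t0] with [psi'' <= 4 psi''(t0)] on
    [[t0, t0 + L rho]].  In the corresponding annulus the coefficients of the
    kernel at [z] have variance [O(rho^-2)], so a rotation by an angle of order
    [rho] keeps [g_l] large, and hat-shaped sequences of width [1/rho] produce
    functions that [z - w] multiplies by [O(rho |w|)], so every disc of radius
    [A rho |w|] meets [Lambda].  Choosing points of [Lambda] near an [m x m] grid of
    mesh [A rho |w|], the averaged sum is at least of order [log m], which is
    impossible for large [m]. *)

Require Import Defs.
From HB Require Import structures.
From mathcomp Require Import all_boot all_order all_algebra.
From mathcomp Require Import finmap complex.
From mathcomp Require Import all_classical all_reals all_analysis.
From mathcomp Require Import measurable_realfun.
From mathcomp Require Import ring lra zify.

Set Implicit Arguments.
Unset Strict Implicit.
Unset Printing Implicit Defensive.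

Import Order.TTheory GRing.Theory Num.Theory.
Import numFieldNormedType.Exports.

Local Open Scope classical_set_scope.
Local Open Scope complex_scope.
Local Open Scope ring_scope.

(** * Complex modulus and limits *)

Section Modulus.
Context {R : realType}.
Local Notation C := R[i].
Implicit Types x y z : C.

(** On [Lambda] itself a dual function only takes the trivial values. Rotation is an isometry, since
    the weight is radial, and it moves the evaluations to [u l'], where all the [g_l] are tied
    together by the common factor [G]. The terms then compare with [rho^2] over squared distances,
    and inverse squared distances summed over a planar grid diverge, but only logarithmically. So
    the unknown [gamma_l] have to go at the cost of a constant factor, and grids of any size are
    required at a fixed ratio of mesh to [rho]. The limit of [psi''] supplies the room: [rho] tends
    to zero, so any number of meshes fits into an annulus thin compared with its radius.

    [psi''] may still rise abruptly, so comparability is available only at selected [t0]. If every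
    step of length [L / sqrt (psi'' t)] more than quadrupled [psi''], the steps would halve each
    time and [psi''] would be unbounded before a finite point.

    No asymptotics of [s_n] are computed. Integrating the derivative of
    [(x^2 - S^2) x^(2n+2) e^(-h)] compares consecutive moments at any chosen radius [S], and only
    the ratios [s_(n+1) / s_n] enter. *)

Lemma modulus_ge0 z : 0 <= modulus z.
Proof. by case: z => a b; rewrite /modulus sqrtr_ge0. Qed.

Lemma modulus_eq0 z : modulus z = 0 -> z = 0.
Proof. exact: ComplexField.Normc.eq0_normc. Qed.

Lemma modulus0 : modulus (0 : C) = 0.
Proof. exact: ComplexField.Normc.normc0. Qed.

Lemma modulus_gt0 z : (0 < modulus z) = (z != 0).
Proof.
rewrite lt_def modulus_ge0 andbT; congr (~~ _).
by apply/eqP/eqP => [/modulus_eq0//|->]; rewrite modulus0.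
Qed.

Lemma modulus1 : modulus (1 : C) = 1.
Proof. exact: ComplexField.Normc.normc1. Qed.

Lemma modulusM x y : modulus (x * y) = modulus x * modulus y.
Proof. exact: ComplexField.Normc.normcM. Qed.

Lemma modulusV x : modulus x^-1 = (modulus x)^-1.
Proof. exact: ComplexField.Normc.normcV. Qed.

Lemma modulusN x : modulus (- x) = modulus x.
Proof. exact: normcN. Qed.

Lemma modulusD x y : modulus (x + y) <= modulus x + modulus y.
Proof. exact: le_normcD. Qed.

Lemma modulusB x y : modulus (x - y) <= modulus x + modulus y.
Proof. by rewrite -(modulusN y); exact: modulusD. Qed.

Lemma modulusBC x y : modulus (x - y) = modulus (y - x).
Proof. by rewrite -modulusN opprB. Qed.

Lemma modulus_tri x y z : modulus (x - z) <= modulus (x - y) + modulus (y - z).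
Proof.
by apply: le_trans (modulusD _ _); rewrite addrA subrK.
Qed.

Lemma modulus_dist x y : `|modulus x - modulus y| <= modulus (x - y).
Proof.
rewrite ler_norml; apply/andP; split.
- rewrite lerNl opprB lerBlDl -{1}(subrK x y) (modulusBC x) addrC; exact: modulusD.
- by rewrite lerBlDl -{1}(subrK y x) addrC; exact: modulusD.
Qed.

Lemma modulusX x n : modulus (x ^+ n) = modulus x ^+ n.
Proof.
elim: n => [|n IHn]; first by rewrite !expr0 modulus1.
by rewrite !exprS modulusM IHn.
Qed.

Lemma modulus_real (a : R) : modulus a%:C = `|a|.
Proof. by rewrite /modulus /= expr0n /= addr0 sqrtr_sqr. Qed.

Lemma modulus_sqr z : modulus z ^+ 2 = complex.Re z ^+ 2 + complex.Im z ^+ 2.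
Proof. by case: z => a b; rewrite /modulus /= sqr_sqrtr // addr_ge0 ?sqr_ge0. Qed.

Lemma modulus_conj z : modulus (conjc z) = modulus z.
Proof. by case: z => a b; rewrite /modulus /= sqrrN. Qed.

Lemma mulc_conj z : z * conjc z = (modulus z ^+ 2)%:C.
Proof.
rewrite modulus_sqr; case: z => a b; apply/eqP; rewrite eq_complex /=.
by apply/andP; split; apply/eqP; ring.
Qed.

Lemma modulus_ge_Re z : `|complex.Re z| <= modulus z.
Proof.
rewrite -ler_sqr ?nnegrE ?modulus_ge0 ?normr_ge0 // modulus_sqr real_normK ?num_real //.
by rewrite lerDl sqr_ge0.
Qed.

Lemma modulus_ge_Im z : `|complex.Im z| <= modulus z.
Proof.
rewrite -ler_sqr ?nnegrE ?modulus_ge0 ?normr_ge0 // modulus_sqr real_normK ?num_real //.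
by rewrite lerDr sqr_ge0.
Qed.

Lemma modulus_le_ReIm z : modulus z <= `|complex.Re z| + `|complex.Im z|.
Proof.
rewrite -ler_sqr ?nnegrE ?modulus_ge0 ?addr_ge0 // modulus_sqr sqrrD.
rewrite !real_normK ?num_real // addrAC lerDl mulrn_wge0 // mulr_ge0 //.
Qed.

Lemma modulus_sum I (r : seq I) (P : pred I) (F : I -> C) :
  modulus (\sum_(i <- r | P i) F i) <= \sum_(i <- r | P i) modulus (F i).
Proof.
elim/big_ind2: _ => [|x1 y1 x2 y2 h1 h2|//]; first by rewrite modulus0.
by apply: le_trans (modulusD _ _) _; rewrite lerD.
Qed.

Lemma realC_sum I (r : seq I) (P : pred I) (F : I -> R) :
  (\sum_(i <- r | P i) F i)%:C = \sum_(i <- r | P i) (F i)%:C.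
Proof. exact: (rmorph_sum (real_complex R)). Qed.

Lemma conjc_sum I (r : seq I) (P : pred I) (F : I -> C) :
  conjc (\sum_(i <- r | P i) F i) = \sum_(i <- r | P i) conjc (F i).
Proof. exact: (rmorph_sum (@conjc R)). Qed.

Lemma sqr_modulusD_le x y : modulus (x + y) ^+ 2 <= 2 * modulus x ^+ 2 + 2 * modulus y ^+ 2.
Proof.
have := modulusD x y; have := modulus_ge0 (x + y); have := modulus_ge0 x.
have := modulus_ge0 y; have := sqr_ge0 (modulus x - modulus y); nra.
Qed.

Lemma real_CauchySchwarz (a b : nat -> R) n :
  (\sum_(i < n) a i * b i) ^+ 2 <= (\sum_(i < n) a i ^+ 2) * (\sum_(i < n) b i ^+ 2).
Proof.
elim: n => [|n IHn]; first by rewrite !big_ord0 expr0n mulr0.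
rewrite !big_ord_recr /=.
set X := \sum_(i < n) a i * b i; set A := \sum_(i < n) a i ^+ 2.
set B := \sum_(i < n) b i ^+ 2.
have A0 : 0 <= A by apply: sumr_ge0 => i _; exact: sqr_ge0.
have B0 : 0 <= B by apply: sumr_ge0 => i _; exact: sqr_ge0.
suff : 2 * X * (a n * b n) <= A * b n ^+ 2 + a n ^+ 2 * B.
  by have : X ^+ 2 <= A * B by []; nra.
have XX : X ^+ 2 <= A * B by [].
set p := A * b n ^+ 2; set q := a n ^+ 2 * B.
have p0 : 0 <= p by rewrite mulr_ge0 ?sqr_ge0.
have q0 : 0 <= q by rewrite mulr_ge0 ?sqr_ge0.
apply: le_trans (ler_norm _) _.
rewrite -ler_sqr ?nnegrE ?normr_ge0 ?addr_ge0 // real_normK ?num_real //.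
have : (2 * X * (a n * b n)) ^+ 2 <= 4 * (p * q).
  have -> : (2 * X * (a n * b n)) ^+ 2 = 4 * (X ^+ 2 * (a n * b n) ^+ 2) by ring.
  have -> : 4 * (p * q) = 4 * ((A * B) * (a n * b n) ^+ 2) by rewrite /p /q; ring.
  by rewrite ler_pM2l // ler_wpM2r // sqr_ge0.
have := sqr_ge0 (p - q); nra.
Qed.

Lemma sum_CauchySchwarz (a b : nat -> C) n :
  modulus (\sum_(i < n) a i * b i) ^+ 2 <=
  (\sum_(i < n) modulus (a i) ^+ 2) * (\sum_(i < n) modulus (b i) ^+ 2).
Proof.
apply: le_trans (real_CauchySchwarz (fun i => modulus (a i)) (fun i => modulus (b i)) n).
rewrite ler_sqr ?nnegrE ?modulus_ge0 //; last first.
  by apply: sumr_ge0 => i _; rewrite mulr_ge0 ?modulus_ge0.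
by apply: le_trans (modulus_sum _ _ _) _; apply: ler_sum => i _; rewrite modulusM.
Qed.

End Modulus.

Section ComplexLimits.
Context {R : realType}.
Local Notation C := R[i].
Implicit Types (u v : nat -> C) (l : C).

(** Stated through the real-valued modulus: the norm of [R[i]] takes values in [R[i]], whereas the
    squeeze and monotone arguments below live in [R]. *)
Definition cconv u l := modulus (u n - l) @[n --> \oo] --> (0 : R).

Lemma cconvP u l :
  cconv u l <-> forall e : R, 0 < e -> \forall n \near \oo, modulus (u n - l) < e.
Proof.
split=> [/cvgrPdist_lt h e e0|h].
  by have := h e e0; apply: filterS => n; rewrite sub0r normrN ger0_norm ?modulus_ge0.
apply/cvgrPdist_lt => e e0; have := h e e0; apply: filterS => n.
by rewrite sub0r normrN ger0_norm ?modulus_ge0.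
Qed.

Lemma cconv_squeeze u l (b : nat -> R) :
  (\forall n \near \oo, modulus (u n - l) <= b n) -> b n @[n --> \oo] --> (0 : R) ->
  cconv u l.
Proof.
move=> h b0; apply: (squeeze_cvgr _ (cvg_cst 0) b0).
by apply: filterS h => n ->; rewrite modulus_ge0.
Qed.

Lemma cconv_cst l : cconv (fun=> l) l.
Proof. by rewrite /cconv subrr modulus0; exact: cvg_cst. Qed.

Lemma cconvD u v l m : cconv u l -> cconv v m -> cconv (fun n => u n + v n) (l + m).
Proof.
move=> ul vm; apply: (@cconv_squeeze _ _ (fun n => modulus (u n - l) + modulus (v n - m))).
  by apply: nearW => n; rewrite opprD addrACA modulusD.
by rewrite -[X in _ --> X](addr0 0); apply: cvgD.
Qed.

Lemma cconvZ u l c : cconv u l -> cconv (fun n => c * u n) (c * l).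
Proof.
move=> ul; apply: (@cconv_squeeze _ _ (fun n => modulus c * modulus (u n - l))).
  by apply: nearW => n; rewrite -mulrBr modulusM.
by rewrite -[X in _ --> X](mulr0 (modulus c)); apply: cvgM => //; exact: cvg_cst.
Qed.

Lemma cconvB u v l m : cconv u l -> cconv v m -> cconv (fun n => u n - v n) (l - m).
Proof.
move=> ul vm; rewrite -mulN1r.
have -> : (fun n => u n - v n) = (fun n => u n + (-1) * v n).
  by apply/funext => n; rewrite mulN1r.
by apply: cconvD => //; exact: cconvZ.
Qed.

Lemma cconv_sum (I : Type) (r : seq I) (u : I -> nat -> C) (l : I -> C) :
  (forall i, cconv (u i) (l i)) ->
  cconv (fun n => \sum_(i <- r) u i n) (\sum_(i <- r) l i).
Proof.
move=> h; elim: r => [|i r IHr].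
  by rewrite big_nil; under eq_fun do rewrite big_nil; exact: cconv_cst.
by rewrite big_cons; under eq_fun do rewrite big_cons; exact: cconvD.
Qed.

Lemma cconv_conj u l : cconv u l -> cconv (fun n => conjc (u n)) (conjc l).
Proof.
move=> ul; rewrite /cconv.
by under eq_fun do rewrite -raddfB modulus_conj.
Qed.

Lemma cconv_modulus u l : cconv u l -> modulus (u n) @[n --> \oo] --> modulus l.
Proof.
move=> /cconvP h; apply/cvgrPdist_lt => e e0; have := h e e0; apply: filterS => n.
by rewrite distrC; apply: le_lt_trans; exact: modulus_dist.
Qed.

Lemma cconv_modulus_le u l B :
  cconv u l -> (\forall n \near \oo, modulus (u n) <= B) -> modulus l <= B.
Proof.
move=> /cconv_modulus h hB; rewrite -(cvg_lim _ h) //.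
by apply: limr_le => //; exact: cvgP h.
Qed.

Lemma cconv_unique u l m : cconv u l -> cconv u m -> l = m.
Proof.
move=> ul um; apply/eqP; rewrite -subr_eq0; apply/eqP/modulus_eq0.
have h := cconv_modulus (cconvB ul um).
have h0 : (fun n => modulus (u n - u n)) = (fun=> 0 : R).
  by apply/funext => n; rewrite subrr modulus0.
rewrite h0 in h.
by apply/esym; apply: (cvg_unique _ (cvg_cst 0) h).
Qed.

Lemma cconv_ext u v l : (\forall n \near \oo, u n = v n) -> cconv u l -> cconv v l.
Proof.
by move=> h; apply: cvg_trans; apply: near_eq_cvg; apply: filterS h => n ->.
Qed.

Lemma cconvS u l : cconv (fun n => u n.+1) l <-> cconv u l.
Proof.
rewrite /cconv; pose f n := modulus (u n - l).
by split=> h; [rewrite -(cvg_shiftS f)|rewrite (cvg_shiftS f)].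
Qed.

Lemma cconv_ReIm u (a b : R) :
  complex.Re (u n) @[n --> \oo] --> a -> complex.Im (u n) @[n --> \oo] --> b ->
  cconv u (a +i* b).
Proof.
move=> ha hb.
apply: (@cconv_squeeze _ _ (fun n => `|complex.Re (u n) - a| + `|complex.Im (u n) - b|)).
  by apply: nearW => n; apply: le_trans (modulus_le_ReIm _) _; case: (u n).
rewrite -[X in _ --> X](addr0 0); apply: cvgD.
  have := cvg_norm (cvgB ha (cvg_cst a)); rewrite subrr normr0; exact.
have := cvg_norm (cvgB hb (cvg_cst b)); rewrite subrr normr0; exact.
Qed.

(** Real and imaginary parts are contractions for the modulus, so both component sequences are
    Cauchy in [R]. *)
Lemma cconv_cauchy u :
  (forall e : R, 0 < e -> exists N, forall n m, (N <= n)%N -> (N <= m)%N ->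
     modulus (u n - u m) <= e) ->
  exists l, cconv u l.
Proof.
move=> h.
have key (p : C -> R) : (forall x y, `|p x - p y| <= modulus (x - y)) ->
    cvgn (fun n => p (u n)).
  move=> hp; apply: cauchy_cvg; apply/cauchy_ballP => e e0.
  have [N hN] := h (e / 2) (divr_gt0 e0 (ltr0n _ 2)).
  exists ([set p (u n) | n in [set n | (N <= n)%N]],
          [set p (u n) | n in [set n | (N <= n)%N]]).
    by split; exists N => // n /= Nn; exists n.
  move=> [_ _] /= [[n Nn <-] [m Nm <-]]; rewrite -ball_normE /=.
  apply: le_lt_trans (hp _ _) _.
  by apply: (@le_lt_trans _ _ (e / 2)); [exact: hN|lra].
have hRe := key (@complex.Re R); have hIm := key (@complex.Im R).
exists (limn (fun n => complex.Re (u n)) +i* limn (fun n => complex.Im (u n))).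
apply: cconv_ReIm; [apply: hRe|apply: hIm] => -[a b] [c d].
  exact: (modulus_ge_Re ((a +i* b) - (c +i* d))).
exact: (modulus_ge_Im ((a +i* b) - (c +i* d))).
Qed.

Lemma cconv_abs_series (u : nat -> C) B :
  (forall n, \sum_(i < n) modulus (u i) <= B) ->
  exists l, cconv (fun n => \sum_(i < n) u i) l.
Proof.
move=> hB; apply: cconv_cauchy => e e0.
have : cvgn (fun n => \sum_(i < n) modulus (u i)).
  apply: nondecreasing_is_cvgn; last by exists B => _ [n _ <-].
  move=> m n mn; rewrite -(subnK mn) addnC big_split_ord /= lerDl.
  by apply: sumr_ge0 => i _; exact: modulus_ge0.
move=> /cauchy_cvgP /cauchy_ballP /(_ e e0) [[A1 A2]] /= [[N1 _ h1] [N2 _ h2]] hA.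
pose N := maxn N1 N2; exists N => n m Nn Nm.
wlog nm : n m Nn Nm / (n <= m)%N => [hw|].
  by case: (leqP n m) => [|/ltnW] nm; [|rewrite modulusBC]; exact: hw.
have /= := hA (\sum_(i < n) modulus (u i), \sum_(i < m) modulus (u i)).
rewrite -ball_normE /= => hnm.
apply: ltW; apply: le_lt_trans (hnm _); last first.
  split; [apply: h1|apply: h2] => /=.
  - by rewrite (leq_trans _ Nn)// leq_maxl.
  - by rewrite (leq_trans _ Nm)// leq_maxr.
rewrite -(subnK nm) addnC !big_split_ord /= modulusBC distrC.
rewrite !(addrC (\sum_(i < n) _)) !addrK.
by rewrite ger0_norm ?modulus_sum // sumr_ge0 // => i _; exact: modulus_ge0.
Qed.

End ComplexLimits.

(** * Integration over the plane *)

Section ChangeOfVariables.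
Context {R : realType}.
Local Notation mu := (@lebesgue_measure R).
Local Open Scope ereal_scope.

(** Lebesgue measure is determined by its values on half-open intervals, so it equals [|c|] times
    its own image under [x -> c x + a]. The formula is then integration against an image measure. *)
Lemma ge0_integral_affine (c a : R) (G : R -> \bar R) : (c != 0)%R ->
  measurable_fun [set: R] G -> (forall x, 0 <= G x) ->
  \int[mu]_x G (c * x + a)%R = (`|c|^-1)%:E * \int[mu]_x G x.
Proof.
move=> c0 mG G0.
pose phi : measurableTypeR R -> measurableTypeR R := fun x => (c * x + a)%R.
have mphi : measurable_fun [set: measurableTypeR R] phi.
  by apply: measurable_funD => //; exact: measurable_funM.
pose phiM := isMeasurableFun.Build _ _ _ _ _ mphi.
pose phi_pack : {mfun measurableTypeR R >-> measurableTypeR R} := HB.pack phi phiM.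
have cn : (0 <= `|c|)%R by [].
pose k : {nonneg R} := NngNum cn.
have c0' : (0 < `|c|)%R by rewrite normr_gt0.
have muE A : measurable A -> mu A = mscale k (pushforward mu phi_pack) A.
  move=> mA; apply: lebesgue_measure_unique => // _ [[p q]] _ <-.
  change (mu `]p, q]%classic = `|c|%:E * mu (phi @^-1` `]p, q]%classic)).
  rewrite lebesgue_measure_itv /= lte_fin.
  have [c1|c1] := ltP 0%R c.
    have -> : phi @^-1` `]p, q]%classic = `](p - a) / c, (q - a) / c]%classic%R.
      apply/seteqP; split=> x /=; rewrite !in_itv /= ltr_pdivrMr // ler_pdivlMr //;
        rewrite ltrBlDr lerBrDr mulrC //.
    rewrite lebesgue_measure_itv /= lte_fin ltr_pM2r ?invr_gt0 // ltrD2r.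
    case: ifP => pq; last by rewrite mule0.
    rewrite -!EFinB -EFinM; congr EFin; rewrite gtr0_norm //.
    by field; rewrite gt_eqF.
  have {}c1 : (c < 0)%R by rewrite lt_neqAle c0.
  (* For negative [c] the preimage is closed on the left instead of on the right, which does not
     change its length. *)
  have -> : phi @^-1` `]p, q]%classic = `[(q - a) / c, (p - a) / c[%classic%R.
    apply/seteqP; split=> x /=; rewrite !in_itv /= ltr_ndivlMr // ler_ndivrMr //;
      by rewrite ltrBlDr lerBrDr mulrC // andbC.
  rewrite lebesgue_measure_itv /= lte_fin ltr_nM2r ?invr_lt0 // ltrD2r.
  case: ifP => pq; last by rewrite mule0.
  rewrite -!EFinB -EFinM; congr EFin; rewrite ltr0_norm //.
  by field; rewrite lt_eqF.
have e1 : \int[mu]_x G x = k%:num%:E * \int[mu]_x G (c * x + a)%R.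
  rewrite (eq_measure_integral (mscale k (pushforward mu phi_pack))); last first.
    by move=> A mA _; exact: muE.
  rewrite ge0_integral_mscale //; congr (_ * _).
  by rewrite (@ge0_integral_pushforward _ _ _ _ _ _ mphi) // preimage_setT.
by rewrite e1 muleA -EFinM mulVf ?gt_eqF // mul1e.
Qed.

End ChangeOfVariables.

Section PlaneIntegrals.
Context {R : realType}.
Local Notation mu := (@lebesgue_measure R).
Local Notation area := (@lebesgue_measure R \x @lebesgue_measure R)%E.
Local Open Scope ereal_scope.
Implicit Type F : R * R -> \bar R.

Lemma ge0_integral_shear1 (t : R) F : measurable_fun [set: R * R] F ->
  (forall p, 0 <= F p) ->
  \int[area]_p F (p.1 + t * p.2, p.2)%R = \int[area]_p F p.
Proof.
move=> mF F0.
have mF' : measurable_fun [set: R * R] (fun p : R * R => F (p.1 + t * p.2, p.2)%R).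
  apply: (measurableT_comp mF); apply: measurable_fun_pair => //.
  by apply: measurable_funD => //; exact: measurable_funM.
rewrite !fubini_tonelli2 //; apply: eq_integral => y _.
rewrite /fubini_G /=.
have mFy : measurable_fun [set: R] (fun x => F (x, y)).
  by apply: measurableT_comp => //; exact: measurable_pair2.
have := ge0_integral_affine (c := 1%R) (t * y) (oner_neq0 _) mFy (fun x => F0 (x, y)).
rewrite normr1 invr1 mul1e => <-.
by apply: eq_integral => x _; rewrite mul1r.
Qed.

Lemma ge0_integral_shear2 (t : R) F : measurable_fun [set: R * R] F ->
  (forall p, 0 <= F p) ->
  \int[area]_p F (p.1, p.2 + t * p.1)%R = \int[area]_p F p.
Proof.
move=> mF F0.
have mF' : measurable_fun [set: R * R] (fun p : R * R => F (p.1, p.2 + t * p.1)%R).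
  apply: (measurableT_comp mF); apply: measurable_fun_pair => //.
  by apply: measurable_funD => //; exact: measurable_funM.
rewrite !fubini_tonelli1 //; apply: eq_integral => x _.
rewrite /fubini_F /=.
have mFx : measurable_fun [set: R] (fun y => F (x, y)).
  by apply: measurableT_comp => //; exact: measurable_pair1.
have := ge0_integral_affine (c := 1%R) (t * x) (oner_neq0 _) mFx (fun y => F0 (x, y)).
rewrite normr1 invr1 mul1e => <-.
by apply: eq_integral => y _; rewrite mul1r.
Qed.

(* A rotation by an angle that is not a multiple of [pi] is a product of three
   shears. *)
Lemma ge0_integral_rotation (c s : R) F : measurable_fun [set: R * R] F ->
  (forall p, 0 <= F p) -> (c ^+ 2 + s ^+ 2 = 1)%R -> (s != 0)%R ->
  \int[area]_p F (c * p.1 - s * p.2, s * p.1 + c * p.2)%R = \int[area]_p F p.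
Proof.
(* [t] is minus the tangent of half the angle; the shears have parameters [t], [s], [t], the middle
   one acting on the second coordinate. *)
move=> mF F0 cs s0; pose t := (- ((1 - c) / s))%R.
pose F1 p := F (p.1 + t * p.2, p.2)%R.
pose F2 p := F1 (p.1, p.2 + s * p.1)%R.
have mF1 : measurable_fun [set: R * R] F1.
  apply: (measurableT_comp mF); apply: measurable_fun_pair => //.
  by apply: measurable_funD => //; exact: measurable_funM.
have mF2 : measurable_fun [set: R * R] F2.
  apply: (measurableT_comp mF1); apply: measurable_fun_pair => //.
  by apply: measurable_funD => //; exact: measurable_funM.
transitivity (\int[area]_p F2 (p.1 + t * p.2, p.2)%R); last first.
  rewrite (ge0_integral_shear1 t mF2 (fun p => F0 _)); transitivity (\int[area]_p F1 p).
    exact: (ge0_integral_shear2 s mF1 (fun p => F0 _)).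
  exact: ge0_integral_shear1.
have ts : (t * s = c - 1)%R by rewrite /t; field.
apply: eq_integral => -[x y] _.
rewrite /F2 /F1 /=; congr (F (_, _)).
  have -> : (x + t * y + t * (y + s * (x + t * y)) =
      x * (1 + t * s) + y * (t * (2 + t * s)))%R by ring.
  have -> : (t * (2 + t * s) = - s)%R.
    apply: (mulIf s0); rewrite mulrAC ts mulNr.
    have -> : (s * s = 1 - c ^+ 2)%R by rewrite -expr2; lra.
    by ring.
  by rewrite ts; ring.
by rewrite mulrDr mulrA (mulrC s t) ts; ring.
Qed.

(** Polar coordinates in disguise: [y = x v] turns the radius into [|x| sqrt (1 + v^2)], and
    rescaling [x] by [sqrt (1 + v^2)] separates the variables. The slope [v] plays the role of the
    angle. *)
Lemma ge0_integral_polar (f : R -> R) : measurable_fun [set: R] f ->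
  (forall x, 0 <= f x)%R ->
  \int[area]_p (f (Num.sqrt (p.1 ^+ 2 + p.2 ^+ 2)))%:E =
  (\int[mu]_v ((1 + v ^+ 2)^-1)%:E) * \int[mu]_x (`|x| * f `|x|)%:E.
Proof.
move=> mf f0.
pose P (p : R * R) := (f (Num.sqrt (p.1 ^+ 2 + p.2 ^+ 2)))%:E.
have mP : measurable_fun [set: R * R] P.
  apply/measurable_EFinP; apply: (measurableT_comp mf).
  apply: (measurableT_comp (continuous_measurable_fun (@sqrt_continuous R))).
  by apply: measurable_funD; exact: measurable_funX.
pose Q (p : R * R) := (`|p.1| * f (`|p.1| * Num.sqrt (1 + p.2 ^+ 2)))%:E.
have mQ : measurable_fun [set: R * R] Q.
  apply/measurable_EFinP; apply: measurable_funM.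
    by apply: measurableT_comp.
  apply: (measurableT_comp mf); apply: measurable_funM.
    by apply: measurableT_comp.
  apply: (measurableT_comp (continuous_measurable_fun (@sqrt_continuous R))).
  by apply: measurable_funD => //; exact: measurable_funX.
have P0 p : 0 <= P p by rewrite lee_fin.
have Q0 p : 0 <= Q p by rewrite lee_fin mulr_ge0.
rewrite -/P fubini_tonelli1 //.
have -> : \int[mu]_x fubini_F mu P x = \int[mu]_x fubini_F mu Q x.
  apply: ge0_ae_eq_integral => //.
  - exact: measurable_fun_fubini_tonelli_F.
  - exact: measurable_fun_fubini_tonelli_F.
  - by move=> x _; exact: integral_ge0.
  - by move=> x _; exact: integral_ge0.
  (* The substitution [y = x v] degenerates on the line [x = 0], which is negligible. *)
  exists [set 0%R]; split; [exact: measurable_set1|exact: lebesgue_measure_set1|].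
  move=> x /= /not_implyP[_ hx]; apply: contrapT => /eqP x0; apply: hx.
  rewrite /fubini_F /=.
  have mPx : measurable_fun [set: R] (fun y => P (x, y)).
    by apply: measurableT_comp => //; exact: measurable_pair1.
  have mQx : measurable_fun [set: R] (fun y => Q (x, y)).
    by apply: measurableT_comp => //; exact: measurable_pair1.
  have h := ge0_integral_affine 0%R x0 mPx (fun y => P0 (x, y)).
  have x0' : (0 < `|x|)%R by rewrite normr_gt0.
  have -> : \int[mu]_y P (x, y) = `|x|%:E * ((`|x|^-1)%:E * \int[mu]_y P (x, y)).
    by rewrite muleA -EFinM mulfV ?gt_eqF // mul1e.
  rewrite -h -ge0_integralZl //; last first.
    by apply: (measurableT_comp mPx); apply: measurable_funD => //; exact: measurable_funM.
  apply: eq_integral => y _; rewrite /P /Q /= -EFinM addr0; congr (_ * f _)%:E.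
  have -> : (x ^+ 2 + (x * y) ^+ 2 = x ^+ 2 * (1 + y ^+ 2))%R by ring.
  by rewrite sqrtrM ?sqr_ge0 // sqrtr_sqr.
rewrite -fubini_tonelli1 // fubini_tonelli2 //.
have mH : measurable_fun [set: R] (fun x : R => (`|x| * f `|x|)%:E).
  apply/measurable_EFinP; apply: measurable_funM => //.
  by apply: (measurableT_comp mf).
rewrite -ge0_integralZr //; last 3 first.
- apply/measurable_EFinP; apply: continuous_measurable_fun; exact: continuous_oneDsqrV.
- by move=> v _; rewrite lee_fin invr_ge0 addr_ge0 ?sqr_ge0.
- by apply: integral_ge0 => x _; rewrite lee_fin mulr_ge0.
apply: eq_integral => v _; rewrite /fubini_G /=.
pose c := Num.sqrt (1 + v ^+ 2).
have v0 : (0 < 1 + v ^+ 2)%R by rewrite ltr_pwDl // sqr_ge0.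
have c0 : (0 < c)%R by rewrite sqrtr_gt0.
have cn : (c != 0)%R by rewrite gt_eqF.
have := ge0_integral_affine 0%R cn mH (fun x => ltac:(by rewrite lee_fin mulr_ge0)).
have -> : ((1 + v ^+ 2)^-1 = c^-1 * c^-1)%R.
  by rewrite -invfM -expr2 sqr_sqrtr // ltW.
rewrite gtr0_norm // EFinM -muleA => <-.
rewrite -ge0_integralZl //; last 3 first.
- by apply: (measurableT_comp mH); apply: measurable_funD => //; exact: measurable_funM.
- by move=> x _; rewrite lee_fin mulr_ge0.
- by rewrite lee_fin invr_ge0 ltW.
apply: eq_integral => x _; rewrite /Q /= -EFinM addr0; congr EFin.
by rewrite normrM gtr0_norm // mulrA mulrA mulVf // mul1r [(c * `|x|)%R]mulrC.
Qed.

Lemma integral_oneDsqrV : \int[mu]_v ((1 + v ^+ 2)^-1)%:E = pi%:E :> \bar R.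
Proof.
rewrite ge0_symfun_integralT; last 3 first.
- by move=> x; rewrite invr_ge0 addr_ge0 ?sqr_ge0.
- exact: continuous_oneDsqrV.
- by move=> x /=; rewrite sqrrN.
rewrite -set_itvcy integral0y_oneDsqr -EFinM; congr EFin; by field.
Qed.

End PlaneIntegrals.

(** * Roots of unity and the discrete Parseval identity *)

Section RootsOfUnity.
Context {R : realType}.
Local Notation C := R[i].

(** Taking a root of [-1] of order [2^(k+1)] settles primitivity: the order divides [2^(k+2)], and a
    proper divisor would give [1 = -1]. Being non-real is required by the factorization of rotations
    into shears. *)
Lemma dyadic_root k : exists u : C,
  [/\ (2 ^ k.+2)%N.-primitive_root u, modulus u = 1 & complex.Im u != 0].
Proof.
pose u : C := (2 ^ k.+1)%N.-root (-1).
have n0 : (0 < 2 ^ k.+1)%N by rewrite expn_gt0.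
have uE : u ^+ (2 ^ k.+1) = -1 by exact: rootCK.
exists u; split.
- have u1 : u ^+ (2 ^ k.+2) = 1 by rewrite expnS mulnC exprM uE sqrrN expr1n.
  have [m mp] := prim_order_exists (n := 2 ^ k.+2) ltac:(by rewrite expn_gt0) u1.
  move=> /(dvdn_pfactor _ _ (isT : prime 2))[j jk mE].
  move: jk; rewrite leq_eqVlt ltnS => /orP[/eqP jE|jk]; first by rewrite -jE -mE.
  have : u ^+ (2 ^ k.+1) = 1.
    by rewrite -(subnKC jk) expnD exprM -mE (prim_expr_order mp) expr1n.
  by rewrite uE => /eqP; rewrite eq_sym -subr_eq0 opprK -(natrD _ 1 1) pnatr_eq0.
- have : modulus (u ^+ (2 ^ k.+1)) = 1 by rewrite uE modulusN modulus1.
  rewrite modulusX.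
  by move=> /eqP; rewrite pexpr_eq1 ?modulus_ge0 // => /eqP.
- apply/eqP => im0.
  have uR : u = (complex.Re u)%:C by move: im0; case: (u) => a b /= ->.
  move: uE; rewrite uR -rmorphXn /= => /(congr1 (@complex.Re R)) /=.
  rewrite expnS exprM => h.
  have : 0 <= (complex.Re u ^+ 2) ^+ (2 ^ k) by rewrite exprn_ge0 // sqr_ge0.
  rewrite h; lra.
Qed.

(** Orthogonality of the characters [j -> u^(j n)] for distinct exponents [n < m]. It replaces
    integration over the angle, so that the norm can be computed by averaging finitely many rotated
    copies. *)
Lemma root_of_unity_parseval m (u : C) (b : nat -> C) N : m.-primitive_root u ->
  modulus u = 1 -> (N <= m)%N ->
  \sum_(j < m) modulus (\sum_(n < N) b n * u ^+ j ^+ n) ^+ 2 =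
  m%:R * \sum_(n < N) modulus (b n) ^+ 2.
Proof.
move=> um u1 Nm.
have uu : u * conjc u = 1 by rewrite mulc_conj u1 expr1n.
apply: (fmorph_inj (real_complex R)); rewrite rmorphM /= rmorph_nat !realC_sum mulr_sumr.
under eq_bigr => j _.
  rewrite -mulc_conj conjc_sum mulr_suml.
  under eq_bigr => n _.
    rewrite mulr_sumr.
    under eq_bigr => k _.
      have -> : b n * u ^+ j ^+ n * conjc (b k * u ^+ j ^+ k) =
          b n * conjc (b k) * (u ^+ n * conjc u ^+ k) ^+ j.
        rewrite rmorphM /= !rmorphXn /= exprMn -!exprM (mulnC j n) (mulnC j k).
        by ring.
      over.
    over.
  over.
rewrite exchange_big /=; apply: eq_bigr => n _; rewrite exchange_big /= (bigD1 n) //=.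
rewrite [X in _ + X]big1 ?addr0 => [|k kn].
  rewrite -mulr_sumr mulc_conj (eq_bigr (fun=> 1)) => [|j _].
    by rewrite sumr_const card_ord mulrC.
  by rewrite -exprMn uu !expr1n.
rewrite -mulr_sumr; set v := u ^+ n * conjc u ^+ k.
have v1 : v - 1 != 0.
  rewrite subr_eq0; apply/eqP => vE.
  have : u ^+ n = u ^+ k.
    have : v * u ^+ k = u ^+ k by rewrite vE mul1r.
    by rewrite /v -mulrA -exprMn [conjc u * u]mulrC uu expr1n mulr1.
  move/eqP; rewrite (eq_prim_root_expr um) !modn_small; last 2 first.
  - exact: leq_trans (ltn_ord _) Nm.
  - exact: leq_trans (ltn_ord _) Nm.
  by move=> /eqP /val_inj nk; rewrite nk eqxx in kn.
have vm : v ^+ m = 1.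
  rewrite /v exprMn -!exprM (mulnC n) (mulnC k) !exprM (prim_expr_order um) expr1n mul1r.
  by rewrite -rmorphXn /= (prim_expr_order um) conjc1 expr1n.
have : (v - 1) * \sum_(j < m) v ^+ j = 0 by rewrite -subrX1 vm subrr.
by move/eqP; rewrite mulf_eq0 (negbTE v1) /= => /eqP ->; rewrite mulr0.
Qed.

End RootsOfUnity.

(** * Measurability of complex functions on the plane *)

Section PlaneMeasurable.
Context {R : realType}.
Local Notation C := R[i].
Implicit Types (f g : C -> C).

Definition plane_measurable f :=
  measurable_fun [set: R * R] (fun p => complex.Re (f (plane_point p))) /\
  measurable_fun [set: R * R] (fun p => complex.Im (f (plane_point p))).

Lemma plane_measurable_cst c : plane_measurable (fun=> c).
Proof. by split; exact: measurable_cst. Qed.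

Lemma plane_measurable_id : plane_measurable id.
Proof. by split => /=; [exact: measurable_fst|exact: measurable_snd]. Qed.

Lemma plane_measurableD f g : plane_measurable f -> plane_measurable g ->
  plane_measurable (fun z => f z + g z).
Proof.
move=> [f1 f2] [g1 g2]; split.
- apply: eq_measurable_fun (measurable_funD f1 g1) => p _ /=.
  by case: (f _) => ? ?; case: (g _).
- apply: eq_measurable_fun (measurable_funD f2 g2) => p _ /=.
  by case: (f _) => ? ?; case: (g _).
Qed.

Lemma plane_measurableM f g : plane_measurable f -> plane_measurable g ->
  plane_measurable (fun z => f z * g z).
Proof.
move=> [f1 f2] [g1 g2]; split.
- apply: eq_measurable_fun (measurable_funB (measurable_funM f1 g1) (measurable_funM f2 g2)).
  by move=> p _ /=; case: (f _) => ? ?; case: (g _).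
- apply: eq_measurable_fun (measurable_funD (measurable_funM f1 g2) (measurable_funM f2 g1)).
  by move=> p _ /=; case: (f _) => ? ?; case: (g _).
Qed.

Lemma plane_measurable_poly (a : nat -> C) N :
  plane_measurable (fun z => \sum_(n < N) a n * z ^+ n).
Proof.
elim: N => [|N IHN].
  by under eq_fun do rewrite big_ord0; exact: plane_measurable_cst.
under eq_fun do rewrite big_ord_recr /=; apply: plane_measurableD => //.
apply: plane_measurableM; first exact: plane_measurable_cst.
elim: N {IHN} => [|N IHN]; first by under eq_fun do rewrite expr0; exact: plane_measurable_cst.
by under eq_fun do rewrite exprS; apply: plane_measurableM => //; exact: plane_measurable_id.
Qed.

Lemma plane_measurable_lim (s : nat -> C -> C) f :
  (forall n, plane_measurable (s n)) -> (forall z, cconv (s^~ z) (f z)) ->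
  plane_measurable f.
Proof.
have key (q : C -> R) : (forall x y, `|q x - q y| <= modulus (x - y)) ->
    (forall n, measurable_fun [set: R * R] (fun p => q (s n (plane_point p)))) ->
    (forall z, cconv (s^~ z) (f z)) ->
    measurable_fun [set: R * R] (fun p => q (f (plane_point p))).
  move=> hq ms sf.
  apply: (measurable_fun_cvg ms) => p _.
  apply/cvgrPdist_lt => e e0; have /cconvP /(_ e e0) := sf (plane_point p).
  by apply: filterS => n; rewrite distrC; apply: le_lt_trans; exact: hq.
move=> ms sf; split; apply: key => //.
- by move=> [a b] [c d]; exact: (modulus_ge_Re ((a +i* b) - (c +i* d))).
- by move=> n; case: (ms n).
- by move=> [a b] [c d]; exact: (modulus_ge_Im ((a +i* b) - (c +i* d))).
- by move=> n; case: (ms n).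
Qed.

Lemma measurable_sqr_modulus f : plane_measurable f ->
  measurable_fun [set: R * R] (fun p => modulus (f (plane_point p)) ^+ 2).
Proof.
move=> [f1 f2]; under eq_fun do rewrite modulus_sqr.
by apply: measurable_funD; exact: measurable_funX.
Qed.

End PlaneMeasurable.

Section WeightedNorm.
Context {R : realType}.
Local Notation C := R[i].
Local Notation area := (@lebesgue_measure R \x @lebesgue_measure R)%E.
Variable h : R -> R.
Hypothesis h_cont : {within `[0, +oo[, continuous h}.

Lemma modulus_plane_point (p : R * R) :
  modulus (plane_point p) = Num.sqrt (p.1 ^+ 2 + p.2 ^+ 2).
Proof. by []. Qed.

(** [h] is controlled only on the half-line; composing with the absolute value yields a function
    that is continuous on all of [R], to which the integration lemmas apply. *)
Lemma continuous_abs_weight : continuous (fun r : R => expR (- h `|r|)).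
Proof.
have hc : continuous (fun r : R => h `|r|).
  have /continuous_within_itvcyP[hp h0] := h_cont.
  move=> r; have [->|r0] := eqVneq r 0; last first.
    have cn : {for r, continuous (fun r : R => `|r|)} by exact: (@norm_continuous R R^o).
    apply: (continuous_comp cn); have hr : `|r| \in `]0, +oo[ by rewrite in_itv /= andbT normr_gt0.
    by have := hp _ hr.
  apply/cvgrPdist_lt => e e0; rewrite normr0.
  have /cvgrPdist_lt /(_ e e0) [d /= d0 hd] := h0.
  exists d => // x xd; have {xd} : `|0 - x| < d := xd.
  rewrite sub0r normrN => xd.
  have [->|x0] := eqVneq x 0; first by rewrite normr0 subrr normr0.
  apply: hd; last by rewrite normr_gt0.
  by change (`|0 - `|x| | < d); rewrite sub0r normrN normr_id.
move=> r; apply: (@continuous_comp _ _ _ (fun r : R => - h `|r|) expR).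
  by apply: continuousN; exact: hc.
exact: continuous_expR.
Qed.

Lemma measurable_weight :
  measurable_fun [set: R * R] (fun p => weight h (plane_point p)).
Proof.
have -> : (fun p : R * R => weight h (plane_point p)) =
   (fun p : R * R => expR (- h `|Num.sqrt (p.1 ^+ 2 + p.2 ^+ 2)|)).
  by apply/funext => p; rewrite /weight modulus_plane_point ger0_norm // sqrtr_ge0.
apply: (measurableT_comp (continuous_measurable_fun continuous_abs_weight)).
apply: (measurableT_comp (continuous_measurable_fun (@sqrt_continuous R))).
by apply: measurable_funD; exact: measurable_funX.
Qed.

Lemma weight_ge0 (z : C) : 0 <= weight h z.
Proof. exact: expR_ge0. Qed.

Lemma measurable_sqnorm_integrand f : plane_measurable f ->
  measurable_fun [set: R * R]
    (fun p => (modulus (f (plane_point p)) ^+ 2 * weight h (plane_point p))%:E).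
Proof.
move=> mf; apply/measurable_EFinP; apply: measurable_funM; last exact: measurable_weight.
exact: measurable_sqr_modulus.
Qed.

Lemma fock_sqnorm_rotate f (u : C) : plane_measurable f -> modulus u = 1 ->
  complex.Im u != 0 -> fock_sqnorm h (fun z => f (u * z)) = fock_sqnorm h f.
Proof.
move=> mf u1 im0; rewrite /fock_sqnorm.
have F0 p : (0 <= (modulus (f (plane_point p)) ^+ 2 * weight h (plane_point p))%:E)%E.
  by rewrite lee_fin mulr_ge0 ?sqr_ge0 ?weight_ge0.
have cs : complex.Re u ^+ 2 + complex.Im u ^+ 2 = 1 by rewrite -modulus_sqr u1 expr1n.
rewrite -[RHS](ge0_integral_rotation (measurable_sqnorm_integrand mf) F0 cs im0).
apply: eq_integral => -[x y] _.
have -> : u * plane_point (x, y) = plane_point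
    (complex.Re u * x - complex.Im u * y, complex.Im u * x + complex.Re u * y).
  by case: (u) => a b; apply/eqP; rewrite eq_complex /=; apply/andP; split; apply/eqP; ring.
congr (_ * _)%:E; rewrite /weight; congr (expR (- h _)).
rewrite -[LHS]mul1r -u1 -modulusM; congr modulus.
by case: (u) => a b; apply/eqP; rewrite eq_complex /=; apply/andP; split; apply/eqP; ring.
Qed.

End WeightedNorm.

(** * The norm in terms of Taylor coefficients *)

Section NormFormula.
Context {R : realType}.
Local Notation C := R[i].
Local Notation area := (@lebesgue_measure R \x @lebesgue_measure R)%E.
Variable h : R -> R.
Hypothesis h_cont : {within `[0, +oo[, continuous h}.
Implicit Types (f : C -> C) (a : nat -> C).

(** Measurability of every rotated copy, as the averaging over rotations demands; it passes to
    limits of polynomials because they are stable under [z -> c z]. *)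
Definition dilation_measurable f := forall c : C, plane_measurable (fun z => f (c * z)).

Lemma poly_dilation_measurable a N :
  dilation_measurable (fun z => \sum_(n < N) a n * z ^+ n).
Proof.
move=> c.
have -> : (fun z : C => \sum_(n < N) a n * (c * z) ^+ n) =
    (fun z => \sum_(n < N) (a n * c ^+ n) * z ^+ n).
  by apply/funext => z; apply: eq_bigr => n _; rewrite exprMn mulrA.
exact: (plane_measurable_poly (fun n => a n * c ^+ n)).
Qed.

Lemma fock_sqnorm_rotateX f (u : C) j : dilation_measurable f -> modulus u = 1 ->
  complex.Im u != 0 -> fock_sqnorm h (fun z => f (u ^+ j * z)) = fock_sqnorm h f.
Proof.
move=> mf u1 im0; elim: j => [|j IHj].
  by congr (fock_sqnorm h); apply/funext => z; rewrite expr0 mul1r.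
rewrite -IHj -(fock_sqnorm_rotate h_cont (f := fun z => f (u ^+ j * z)) _ u1 im0) //.
by congr (fock_sqnorm h); apply/funext => z; rewrite exprSr mulrA.
Qed.

(** The rotated copies all have the same norm, so [|f|^2] may be replaced in the integral by its
    average over the orbit, which Parseval evaluates pointwise. *)
Lemma fock_sqnorm_average f (u : C) m : (0 < m)%N -> dilation_measurable f ->
  modulus u = 1 -> complex.Im u != 0 ->
  (\int[area]_p ((m%:R^-1 * \sum_(j < m) modulus (f (u ^+ j * plane_point p)) ^+ 2) *
     weight h (plane_point p))%:E)%E = fock_sqnorm h f.
Proof.
move=> m0 mf u1 im0.
have mR : m%:R != 0 :> R by rewrite pnatr_eq0 -lt0n.
transitivity (\int[area]_p ((m%:R^-1)%:E * \sum_(j < m)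
   (modulus (f (u ^+ j * plane_point p)) ^+ 2 * weight h (plane_point p))%:E))%E.
  by apply: eq_integral => p _; rewrite sumEFin -EFinM -mulrA mulr_suml.
have mg j : measurable_fun [set: R * R] (fun p => (modulus (f (u ^+ j * plane_point p)) ^+ 2 *
    weight h (plane_point p))%:E).
  exact: (measurable_sqnorm_integrand h_cont (f := fun z => f (u ^+ j * z))).
have g0 j p : (0 <= (modulus (f (u ^+ j * plane_point p)) ^+ 2 *
    weight h (plane_point p))%:E)%E.
  by rewrite lee_fin mulr_ge0 ?sqr_ge0 // weight_ge0.
have mS : measurable_fun [set: R * R] (fun p => \sum_(j < m)
    (modulus (f (u ^+ j * plane_point p)) ^+ 2 * weight h (plane_point p))%:E)%E.
  exact: (emeasurable_sum (index_enum 'I_m) (fun j : 'I_m => mg j)).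
transitivity ((m%:R^-1)%:E * \int[area]_p (\sum_(j < m)
   (modulus (f (u ^+ j * plane_point p)) ^+ 2 * weight h (plane_point p))%:E))%E.
  by apply: ge0_integralZl => // p _; apply: sume_ge0.
transitivity ((m%:R^-1)%:E * \sum_(j < m) fock_sqnorm h (fun z => f (u ^+ j * z)%R))%E.
  congr mule; rewrite ge0_integral_sum //.
  by move=> j; exact: mg.
rewrite (eq_bigr (fun=> fock_sqnorm h f)) => [|j _]; last first.
  exact: (fock_sqnorm_rotateX j mf u1 im0).
have Q0 : (0 <= fock_sqnorm h f)%E.
  by apply: integral_ge0 => p _; rewrite lee_fin mulr_ge0 ?sqr_ge0 // weight_ge0.
have sumQ n : (\sum_(j < n) fock_sqnorm h f = n%:R%:E * fock_sqnorm h f)%E.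
  elim: n => [|n IHn]; first by rewrite big_ord0 mul0e.
  by rewrite big_ord_recr /= IHn -natr1 EFinD ge0_muleDl ?lee_fin // mul1e.
by rewrite sumQ muleA -EFinM mulVf // mul1e.
Qed.

Variable w : nat -> R.
Hypothesis wE : forall n, fock_sqnorm h (fun z => z ^+ n) = (w n)%:E.

Lemma integral_diag_sum a N :
  (\int[area]_p ((\sum_(n < N) modulus (a n * plane_point p ^+ n) ^+ 2) *
     weight h (plane_point p))%:E)%E = (\sum_(n < N) modulus (a n) ^+ 2 * w n)%:E.
Proof.
transitivity (\int[area]_p (\sum_(n < N) ((modulus (a n) ^+ 2)%:E *
   (modulus (plane_point p ^+ n) ^+ 2 * weight h (plane_point p))%:E)))%E.
  apply: eq_integral => p _.
  rewrite (eq_bigr (fun n : 'I_N => (modulus (a n) ^+ 2 *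
    (modulus (plane_point p ^+ n) ^+ 2 * weight h (plane_point p)))%:E)); last first.
    by move=> n _; rewrite -EFinM.
  rewrite sumEFin mulr_suml; congr EFin; apply: eq_bigr => n _.
  by rewrite modulusM exprMn mulrA.
have mg n : measurable_fun [set: R * R] (fun p => (modulus (plane_point p ^+ n : C) ^+ 2 *
    weight h (plane_point p))%:E).
  apply: (measurable_sqnorm_integrand h_cont (f := fun z => z ^+ n)).
  elim: n => [|n IHn]; first by under eq_fun do rewrite expr0; exact: plane_measurable_cst.
  by under eq_fun do rewrite exprS; apply: plane_measurableM => //; exact: plane_measurable_id.
have g0 n p : (0 <= (modulus (plane_point p ^+ n : C) ^+ 2 *
    weight h (plane_point p))%:E)%E.
  by rewrite lee_fin mulr_ge0 ?sqr_ge0 // weight_ge0.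
rewrite ge0_integral_sum //; last 2 first.
- by move=> n; apply: measurable_funeM; exact: mg.
- by move=> n p _; rewrite mule_ge0 // lee_fin sqr_ge0.
rewrite -sumEFin; apply: eq_bigr => n _.
rewrite ge0_integralZl //; [|exact: mg|by rewrite lee_fin sqr_ge0].
by rewrite -/(fock_sqnorm h (fun z => z ^+ n)) wE -EFinM.
Qed.

(** Orthogonality of the monomials: averaging over at least [N] rotations leaves only the diagonal
    terms. *)
Lemma fock_sqnorm_poly a N : fock_sqnorm h (fun z => \sum_(n < N) a n * z ^+ n) =
  (\sum_(n < N) modulus (a n) ^+ 2 * w n)%:E.
Proof.
have [u [up u1 im0]] := @dyadic_root R N.
have Nm : (N <= 2 ^ N.+2)%N.
  by apply: leq_trans (ltnW (ltn_expl N (isT : (1 < 2)%N))) _; rewrite leq_exp2l // ltnW.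
have m0 : (0 < 2 ^ N.+2)%N by rewrite expn_gt0.
rewrite -(fock_sqnorm_average m0 (@poly_dilation_measurable a N) u1 im0).
rewrite -integral_diag_sum; apply: eq_integral => p _; congr (_ * _)%:E.
under eq_bigr => j _.
  under eq_bigr => n _ do rewrite exprMn mulrCA mulrC.
  over.
rewrite (root_of_unity_parseval (fun n => a n * plane_point p ^+ n) up u1 Nm).
by rewrite mulKf // pnatr_eq0 -lt0n.
Qed.

Lemma lim_dilation_measurable f a :
  (forall z, cconv (fun N => \sum_(n < N) a n * z ^+ n) (f z)) -> dilation_measurable f.
Proof.
move=> hf c; apply: (plane_measurable_lim
  (s := fun N z => \sum_(n < N) a n * (c * z) ^+ n)) => // N.
exact: poly_dilation_measurable.
Qed.

(** Fatou's lemma for the partial sums, whose norms are known exactly. *)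
Lemma fock_sqnorm_le f a B :
  (forall z, cconv (fun N => \sum_(n < N) a n * z ^+ n) (f z)) ->
  (forall N, \sum_(n < N) modulus (a n) ^+ 2 * w n <= B) ->
  (fock_sqnorm h f <= B%:E)%E.
Proof.
move=> hf hB.
pose F N p := (modulus (\sum_(n < N) a n * plane_point p ^+ n) ^+ 2 *
  weight h (plane_point p))%:E.
have mF N : measurable_fun [set: R * R] (F N).
  apply: (measurable_sqnorm_integrand h_cont (f := fun z => \sum_(n < N) a n * z ^+ n)).
  exact: plane_measurable_poly.
have F0 N p : (0 <= F N p)%E by rewrite lee_fin mulr_ge0 ?sqr_ge0 // weight_ge0.
have hlim p : F^~ p @ \oo -->
    (modulus (f (plane_point p)) ^+ 2 * weight h (plane_point p))%:E.
  apply: cvg_EFin; first exact: nearW.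
  apply: cvgM; last exact: cvg_cst.
  by apply: cvgM; exact: cconv_modulus.
have -> : fock_sqnorm h f = (\int[area]_p limn_einf (F^~ p))%E.
  by apply: eq_integral => p _; rewrite (cvg_limn_einf_sup (hlim p)).1.
apply: le_trans (fatou _ _ _ _) _ => //.
rewrite limn_einf_lim; apply: lime_le; first exact: is_cvg_einfs.
apply: nearW => N; apply: (@le_trans _ _ (\int[area]_p F N p)%E).
  by apply: ereal_inf_lbound; exists N => //=.
rewrite -/(fock_sqnorm h (fun z => \sum_(n < N) a n * z ^+ n)) fock_sqnorm_poly.
by rewrite lee_fin.
Qed.

(** Uniformity over the circle matters: one truncation index has to serve all rotated points [u^j z]
    at once. *)
Lemma abs_tail a (t e : R) (B : R) : 0 <= t -> 0 < e ->
  (forall N, \sum_(n < N) modulus (a n) * t ^+ n <= B) ->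
  exists M0, forall M, (M0 <= M)%N -> forall z v, modulus z = t ->
    cconv (fun N => \sum_(n < N) a n * z ^+ n) v ->
    modulus (v - \sum_(n < M) a n * z ^+ n) <= e.
Proof.
move=> t0 e0 hB.
pose S N := \sum_(n < N) modulus (a n) * t ^+ n.
have Snd : nondecreasing_seq S.
  move=> m n mn; rewrite /S -!(big_mkord predT (fun i => modulus (a i) * t ^+ i)).
  rewrite (@big_cat_nat _ _ _ m 0 n) //= lerDl.
  by apply: sumr_ge0 => i _; rewrite mulr_ge0 ?modulus_ge0 ?exprn_ge0.
have Scvg : cvgn S by apply: nondecreasing_is_cvgn => //; exists B => _ [N _ <-]; exact: hB.
have /cvgrPdist_le /(_ e e0) [M0 _ hM0] := Scvg.
exists M0 => M MM z v zt hv.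
have hc := cconvB hv (cconv_cst (\sum_(n < M) a n * z ^+ n)).
apply: cconv_modulus_le hc _; exists M => // N /= MN.
rewrite -!(big_mkord predT (fun i => a i * z ^+ i)) (@big_cat_nat _ _ _ M 0 N) //=.
rewrite addrAC subrr add0r; apply: le_trans (modulus_sum _ _ _) _.
have -> : \sum_(M <= i < N) modulus (a i * z ^+ i) = S N - S M.
  rewrite /S -!(big_mkord predT (fun i => modulus (a i) * t ^+ i)).
  rewrite (@big_cat_nat _ _ _ M 0 N) //= addrAC subrr add0r.
  by apply: eq_bigr => i _; rewrite modulusM modulusX zt.
have := hM0 M MM; have := nondecreasing_cvgn_le Snd Scvg N.
have := ler_norm (limn S - S M); lra.
Qed.

(** Parseval over finitely many roots is exact only below their order. On each circle [f] is
    therefore replaced by a truncation with a small uniform tail, and Fatou's lemma is applied as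
    the order of the roots grows. The norm of [f] is allowed to be infinite. *)
Lemma fock_sqnorm_ge f a N :
  (forall t, 0 <= t -> exists B, forall n, \sum_(i < n) modulus (a i) * t ^+ i <= B) ->
  (forall z, cconv (fun N => \sum_(n < N) a n * z ^+ n) (f z)) ->
  ((\sum_(n < N) modulus (a n) ^+ 2 * w n)%:E <= fock_sqnorm h f)%E.
Proof.
move=> habs hf.
have [u hu] := choice (@dyadic_root R).
pose m k := (2 ^ k.+2)%N.
have m0 k : (0 < m k)%N by rewrite expn_gt0.
have mR k : 0 < (m k)%:R :> R by rewrite ltr0n.
pose A k z := (m k)%:R^-1 * \sum_(j < m k) modulus (f (u k ^+ j * z)) ^+ 2.
pose P z := \sum_(n < N) modulus (a n * z ^+ n) ^+ 2.
have mf := lim_dilation_measurable hf.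
have A_lower z (e : R) : 0 < e -> exists k0, forall k, (k0 <= k)%N -> P z - e <= A k z.
  move=> e0; have [B hB] := habs _ (modulus_ge0 z).
  have B0 : 0 <= B by have := hB 0%N; rewrite big_ord0.
  (* Replacing [f] by its truncation, of modulus at most [B], costs at most [2 B d <= e] in the
     square. *)
  pose d := e / (2 * B + 1).
  have Bd : 0 < 2 * B + 1 by rewrite ltr_wpDl // mulr_ge0.
  have d0 : 0 < d by rewrite divr_gt0.
  have [M0 hM0] := abs_tail (modulus_ge0 z) d0 hB.
  pose M := maxn M0 N; exists M => k Mk.
  have [up u1 im0] := hu k.
  have Mm : (M <= m k)%N.
    apply: leq_trans Mk _; apply: leq_trans (ltnW (ltn_expl k (isT : (1 < 2)%N))) _.
    by rewrite leq_exp2l // ltnW.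
  pose Sm j := \sum_(n < M) (a n * z ^+ n) * u k ^+ j ^+ n.
  have lower j : modulus (Sm j) ^+ 2 - 2 * B * d <= modulus (f (u k ^+ j * z)) ^+ 2.
    have ujz : modulus (u k ^+ j * z) = modulus z.
      by rewrite modulusM modulusX u1 expr1n mul1r.
    have := hM0 M (leq_maxl _ _) _ _ ujz (hf _).
    have -> : \sum_(n < M) a n * (u k ^+ j * z) ^+ n = Sm j.
      by apply: eq_bigr => n _; rewrite exprMn; ring.
    have SB : modulus (Sm j) <= B.
      apply: le_trans (hB M); apply: le_trans (modulus_sum _ _ _) _.
      by apply: ler_sum => n _; rewrite !modulusM !modulusX u1 !expr1n mulr1.
    have := modulus_dist (f (u k ^+ j * z)) (Sm j).
    have := modulus_ge0 (f (u k ^+ j * z)); have := modulus_ge0 (Sm j).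
    rewrite ler_norml; move: (modulus (f _)) (modulus (Sm j)) (modulus (_ - _)) SB.
    move=> x y dd yB y0 x0 /andP[h1 h2] h3.
    have h4 : 2 * y * d <= 2 * B * d by rewrite ler_pM2r // ler_pM2l.
    have [yd|yd] := leP d y; first by nra.
    by have := sqr_ge0 x; nra.
  have pars := root_of_unity_parseval (fun n => a n * z ^+ n) up u1 Mm.
  have : (m k)%:R * (\sum_(n < M) modulus (a n * z ^+ n) ^+ 2 - 2 * B * d) <=
      \sum_(j < m k) modulus (f (u k ^+ j * z)) ^+ 2.
    rewrite mulrBr -pars [X in _ - X](_ : _ = \sum_(j < m k) (2 * B * d)); last first.
      by rewrite sumr_const card_ord -[RHS]mulr_natl.
    by rewrite -sumrB; apply: ler_sum => j _; exact: lower.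
  rewrite -ler_pdivlMl //; apply: le_trans.
  have PM : P z <= \sum_(n < M) modulus (a n * z ^+ n) ^+ 2.
    rewrite /P -!(big_mkord predT (fun n => modulus (a n * z ^+ n) ^+ 2)).
    rewrite [X in _ <= X](@big_cat_nat _ _ _ N) ?leq_maxr //= lerDl.
    by apply: sumr_ge0 => n _; exact: sqr_ge0.
  have : 2 * B * d <= e.
    rewrite /d mulrA ler_pdivrMr // mulrC ler_pM2l //; lra.
  lra.
(* [A k] only has an eventual lower bound near [P]. Cutting it at [P] makes the limit exactly [P],
   while the integrals stay below the norm of [f]. *)
pose H k p := (Num.min (A k (plane_point p)) (P (plane_point p)) *
  weight h (plane_point p))%:E.
have A0 k z : 0 <= A k z.
  by rewrite mulr_ge0 ?invr_ge0 // sumr_ge0 // => j _; exact: sqr_ge0.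
have P0 z : 0 <= P z by apply: sumr_ge0 => n _; exact: sqr_ge0.
have mA k : measurable_fun [set: R * R] (fun p => A k (plane_point p)).
  apply: measurable_funM => //; apply: measurable_sum => j.
  exact: (measurable_sqr_modulus (f := fun z => f (u k ^+ j * z))).
have mP : measurable_fun [set: R * R] (fun p => P (plane_point p)).
  apply: measurable_sum => n.
  apply: (measurable_sqr_modulus (f := fun z => a n * z ^+ n)).
  apply: plane_measurableM; first exact: plane_measurable_cst.
  elim: (n : nat) => [|k IHk]; first by under eq_fun do rewrite expr0; exact: plane_measurable_cst.
  by under eq_fun do rewrite exprS; apply: plane_measurableM => //; exact: plane_measurable_id.
have mH k : measurable_fun [set: R * R] (H k).
  apply/measurable_EFinP; apply: measurable_funM; last exact: measurable_weight.
  exact: measurable_minr.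
have H0 k p : (0 <= H k p)%E.
  by rewrite lee_fin mulr_ge0 ?weight_ge0 // le_min A0 P0.
have Hlim p : H^~ p @ \oo --> (P (plane_point p) * weight h (plane_point p))%:E.
  apply: cvg_EFin; first exact: nearW.
  apply: cvgM; last exact: cvg_cst.
  apply/cvgrPdist_le => e e0; have [k0 hk0] := A_lower (plane_point p) e e0.
  exists k0 => // k /= kk; have hh := hk0 k kk.
  rewrite minEle; case: ifP => hAP; last by rewrite subrr normr0 ltW.
  by rewrite ger0_norm ?subr_ge0 //; lra.
rewrite -integral_diag_sum.
have -> : (\int[area]_p ((\sum_(n < N) modulus (a n * plane_point p ^+ n) ^+ 2) *
     weight h (plane_point p))%:E)%E = (\int[area]_p limn_einf (H^~ p))%E.
  by apply: eq_integral => p _; rewrite (cvg_limn_einf_sup (Hlim p)).1.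
apply: le_trans (fatou _ _ _ _) _ => //.
rewrite limn_einf_lim; apply: lime_le; first exact: is_cvg_einfs.
apply: nearW => k; apply: (@le_trans _ _ (\int[area]_p H k p)%E).
  by apply: ereal_inf_lbound; exists k => //=.
have [up u1 im0] := hu k.
rewrite -(fock_sqnorm_average (m0 k) mf u1 im0); apply: ge0_le_integral => //.
- exact: mH.
- by apply/measurable_EFinP; apply: measurable_funM; [exact: mA|exact: (measurable_weight h_cont)].
- by move=> p _; rewrite lee_fin ler_wpM2r ?weight_ge0 // ge_min lexx.
Qed.

End NormFormula.

(** * Weighted power series *)

Section SquareSummable.
Context {R : realType}.
Local Notation C := R[i].
Implicit Types (x y : nat -> C) (z l : C) (B : R).

(** The squared l^2 norm is at most [B], said without an infinite sum; the later estimates carry an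
    explicit [B] in place of a norm. *)
Definition sqsum_le x B := forall M, \sum_(i < M) modulus (x i) ^+ 2 <= B.

Lemma sqsum_le_ge0 x B : sqsum_le x B -> 0 <= B.
Proof. by move=> /(_ 0%N); rewrite big_ord0. Qed.

Lemma sqsum_leW x B B' : B <= B' -> sqsum_le x B -> sqsum_le x B'.
Proof. by move=> BB h M; exact: le_trans (h M) BB. Qed.

Lemma sqsum_le_ext x y B : x =1 y -> sqsum_le x B -> sqsum_le y B.
Proof. by move=> xy h M; under eq_bigr do rewrite -xy; exact: h. Qed.

Lemma sqsum_leD x y B B' : sqsum_le x B -> sqsum_le y B' ->
  sqsum_le (fun i => x i + y i) (2 * B + 2 * B').
Proof.
move=> hx hy M.
apply: (@le_trans _ _ (\sum_(i < M) (2 * modulus (x i) ^+ 2 + 2 * modulus (y i) ^+ 2))).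
  by apply: ler_sum => i _; exact: sqr_modulusD_le.
by rewrite big_split /= -!mulr_sumr lerD // ler_wpM2l // ?hx ?hy.
Qed.

Lemma sqsum_leZ c x B : sqsum_le x B ->
  sqsum_le (fun i => c * x i) (modulus c ^+ 2 * B).
Proof.
move=> h M; under eq_bigr do rewrite modulusM exprMn.
by rewrite -mulr_sumr ler_wpM2l ?sqr_ge0.
Qed.

Lemma sqsum_leB x y B B' : sqsum_le x B -> sqsum_le y B' ->
  sqsum_le (fun i => x i - y i) (2 * B + 2 * B').
Proof.
move=> hx hy; apply: sqsum_leD => // M.
by under eq_bigr do rewrite modulusN; exact: hy.
Qed.

Lemma sqsum_le_term x B i : sqsum_le x B -> modulus (x i) ^+ 2 <= B.
Proof.
move=> /(_ i.+1); rewrite big_ord_recr /=; apply: le_trans; rewrite lerDr.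
by apply: sumr_ge0 => j _; exact: sqr_ge0.
Qed.

Lemma sqsum_CauchySchwarz x y B B' M : sqsum_le x B -> sqsum_le y B' ->
  modulus (\sum_(i < M) x i * y i) ^+ 2 <= B * B'.
Proof.
move=> hx hy; have h := sum_CauchySchwarz x y M; apply: (le_trans h).
by apply: ler_pM => //; apply: sumr_ge0 => i _; exact: sqr_ge0.
Qed.

Lemma sqsum_prod_cvg x y B B' : sqsum_le x B -> sqsum_le y B' ->
  exists v, cconv (fun M => \sum_(i < M) x i * y i) v.
Proof.
move=> hx hy; apply: (@cconv_abs_series R (fun i => x i * y i) (B + B')) => M.
apply: (@le_trans _ _ (\sum_(i < M) (modulus (x i) ^+ 2 + modulus (y i) ^+ 2))).
  apply: ler_sum => i _; rewrite modulusM.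
  have := sqr_ge0 (modulus (x i) - modulus (y i)).
  by have := sqr_ge0 (modulus (x i)); have := sqr_ge0 (modulus (y i)); nra.
by rewrite big_split /= lerD // ?hx ?hy.
Qed.

End SquareSummable.

Section PowerSeriesSpace.
Context {R : realType}.
Local Notation C := R[i].
Variable s : nat -> R.
Hypothesis s_gt0 : forall n, 0 < s n.
Hypothesis s_ratio : forall B : R, exists N, forall n, (N <= n)%N -> B * s n <= s n.+1.
Implicit Types (x y : nat -> C) (z l : C) (B : R).

Definition monom n z : C := z ^+ n / (s n)%:C.

Lemma modulus_monom n z : modulus (monom n z) = modulus z ^+ n / s n.
Proof. by rewrite modulusM modulusX modulusV modulus_real gtr0_norm. Qed.

Lemma monom0_gt0 z : 0 < modulus (monom 0 z) ^+ 2.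
Proof. by rewrite modulus_monom expr0 exprn_gt0 // divr_gt0. Qed.

(** By [s_ratio] each squared term is eventually at most a quarter of the preceding one, so a tail
    is dominated by the term just before it. *)
Lemma monom_geometric z : exists N, forall n, (N <= n)%N -> forall j,
  \sum_(n.+1 <= i < j) modulus (monom i z) ^+ 2 <= modulus (monom n z) ^+ 2.
Proof.
have [N hN] := s_ratio (2 * modulus z); exists N => n Nn j.
have step i : (N <= i)%N -> modulus (monom i.+1 z) ^+ 2 <= modulus (monom i z) ^+ 2 / 4.
  move=> Ni; rewrite !modulus_monom.
  have -> : (modulus z ^+ i / s i) ^+ 2 / 4 = (modulus z ^+ i / (2 * s i)) ^+ 2.
    by field; rewrite gt_eqF.
  have h0 := exprn_ge0 i (modulus_ge0 z).
  rewrite ler_sqr ?nnegrE; last 2 first.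
  - by rewrite divr_ge0 ?exprn_ge0 ?modulus_ge0 // ltW.
  - by rewrite divr_ge0 // mulr_ge0 // ltW.
  rewrite ler_pdivrMr // mulrAC ler_pdivlMr ?mulr_gt0 // exprSr -mulrA.
  rewrite ler_wpM2l ?exprn_ge0 ?modulus_ge0 //.
  by have := hN _ Ni; lra.
(* The last term is subtracted to make the bound inductive. *)
suff h j' : \sum_(n.+1 <= i < n.+1 + j') modulus (monom i z) ^+ 2 <=
    modulus (monom n z) ^+ 2 - modulus (monom (n + j') z) ^+ 2.
  case: (leqP n.+1 j) => nj; last by rewrite big_geq ?sqr_ge0 // ltnW.
  by rewrite -(subnKC nj); apply: le_trans (h _) _; rewrite lerBlDr lerDl sqr_ge0.
elim: j' => [|j' IHj]; first by rewrite addn0 big_geq // addn0 subrr.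
rewrite addnS big_nat_recr /=; last by rewrite leq_addr.
apply: le_trans (lerD IHj (lexx _)) _; rewrite addSn addnS.
have := step (n + j')%N (leq_trans Nn (leq_addr _ _)).
have := sqr_ge0 (modulus (monom (n + j').+1 z)); lra.
Qed.

Definition ksum z : R := limn (fun M => \sum_(i < M) modulus (monom i z) ^+ 2).

Let psum_ndecr z :
  nondecreasing_seq (fun M => \sum_(i < M) modulus (monom i z) ^+ 2).
Proof.
move=> m n mn; rewrite -!(big_mkord predT (fun i => modulus (monom i z) ^+ 2)).
rewrite (@big_cat_nat _ _ _ m 0 n) //= lerDl.
by apply: sumr_ge0 => i _; exact: sqr_ge0.
Qed.

Lemma ksum_cvg z :
  (\sum_(i < M) modulus (monom i z) ^+ 2) @[M --> \oo] --> ksum z.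
Proof.
apply: nondecreasing_is_cvgn; first exact: psum_ndecr.
have [N hN] := monom_geometric z.
exists (\sum_(0 <= i < N.+1) modulus (monom i z) ^+ 2 + modulus (monom N z) ^+ 2).
move=> _ [M _ <-]; rewrite -(big_mkord predT (fun i => modulus (monom i z) ^+ 2)).
case: (leqP N.+1 M) => NM.
  by rewrite (@big_cat_nat _ _ _ N.+1 0 M) //= lerD2l hN.
apply: (@le_trans _ _ (\sum_(0 <= i < N.+1) modulus (monom i z) ^+ 2)).
  rewrite (@big_cat_nat _ _ _ M 0 N.+1) //= ?lerDl; last exact: ltnW.
  by apply: sumr_ge0 => i _; exact: sqr_ge0.
by rewrite lerDl sqr_ge0.
Qed.

Lemma ksum_ub z : sqsum_le (monom^~ z) (ksum z).
Proof.
by move=> M; apply: nondecreasing_cvgn_le; [exact: psum_ndecr|exact: ksum_cvg].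
Qed.

Lemma ksum_gt0 z : 0 < ksum z.
Proof.
apply: lt_le_trans (ksum_ub z 1%N); rewrite big_ord1; exact: monom0_gt0.
Qed.

Lemma monom_cvg0 z : modulus (monom n z) @[n --> \oo] --> (0 : R).
Proof.
have h : modulus (monom n z) ^+ 2 @[n --> \oo] --> (0 : R).
  have h1 := @ksum_cvg z.
  rewrite -(cvg_shiftS (fun M => \sum_(i < M) modulus (monom i z) ^+ 2)) in h1.

  have -> : (fun n => modulus (monom n z) ^+ 2) =
      (fun n => \sum_(i < n.+1) modulus (monom i z) ^+ 2 -
                \sum_(i < n) modulus (monom i z) ^+ 2).
    by apply/funext => n; rewrite big_ord_recr /= addrAC subrr add0r.
  by have h2 := cvgB h1 (@ksum_cvg z); rewrite subrr in h2; exact: h2.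
have h2 := continuous_cvg _ (@sqrt_continuous R 0) h; rewrite sqrtr0 in h2.
have <- : (fun n => Num.sqrt (modulus (monom n z) ^+ 2)) = (fun n => modulus (monom n z)).
  by apply/funext => n; rewrite sqrtr_sqr ger0_norm ?modulus_ge0.
exact: h2.
Qed.

Definition has_sum_at x z (v : C) := cconv (fun M => \sum_(i < M) x i * monom i z) v.
(** The value 0 is a default for divergent series; [sum_atP] excludes it for square-summable
    coefficients. *)
Definition sum_at x z : C := xget 0 [set v | has_sum_at x z v].

Lemma sum_atP x B z : sqsum_le x B -> has_sum_at x z (sum_at x z).
Proof.
move=> xB; have [v hv] := sqsum_prod_cvg xB (ksum_ub z).
exact: (@xgetPex _ 0 [set v | has_sum_at x z v] (ex_intro _ v hv)).
Qed.

Lemma has_sum_at_sum_at x z v : has_sum_at x z v -> sum_at x z = v.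
Proof.
move=> h; apply: (cconv_unique _ h).
exact: (@xgetPex _ 0 [set v | has_sum_at x z v] (ex_intro _ v h)).
Qed.

Lemma has_sum_atD x y z v w : has_sum_at x z v -> has_sum_at y z w ->
  has_sum_at (fun i => x i + y i) z (v + w).
Proof.
move=> hv hw; apply: cconv_ext (cconvD hv hw); apply: nearW => M.
by rewrite -big_split /=; apply: eq_bigr => i _; rewrite mulrDl.
Qed.

Lemma has_sum_atZ c x z v : has_sum_at x z v -> has_sum_at (fun i => c * x i) z (c * v).
Proof.
move=> hv; apply: cconv_ext (cconvZ c hv); apply: nearW => M.
by rewrite mulr_sumr; apply: eq_bigr => i _; rewrite mulrA.
Qed.

(** Rotating the variable multiplies the coefficients by [u^i], a diagonal isometry of l^2 when [u]
    is unimodular. *)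
Lemma has_sum_at_rotate u x z v :
  has_sum_at x (u * z) v -> has_sum_at (fun i => x i * u ^+ i) z v.
Proof.
apply: cconv_ext; apply: nearW => M; apply: eq_bigr => i _.
by rewrite /monom exprMn !mulrA.
Qed.

Lemma sqsum_le_rotate u x B : modulus u = 1 -> sqsum_le x B ->
  sqsum_le (fun i => x i * u ^+ i) B.
Proof.
move=> u1 h M; under eq_bigr do rewrite modulusM modulusX u1 expr1n mulr1.
exact: h.
Qed.

Lemma has_sum_at_finite x n z : (forall i, (n <= i)%N -> x i = 0) ->
  has_sum_at x z (\sum_(i < n) x i * monom i z).
Proof.
move=> x0; apply: cconv_ext (cconv_cst _); exists n => // M /= nM.
rewrite -!(big_mkord predT (fun i => x i * monom i z)).
rewrite (@big_cat_nat _ _ _ n 0 M) //= [X in _ + X]big1_seq ?addr0 // => i.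
by rewrite mem_index_iota => /andP[_ /andP[ni _]]; rewrite x0 ?mul0r.
Qed.

(* Division by [z - l] acts on the weighted coefficients as the backward
   recursion [y n = (s n / s n.+1) * (x n.+1 + l * y n.+1)], which is
   eventually a contraction. *)
Lemma division x B l : sqsum_le x B -> l != 0 -> has_sum_at x l 0 ->
  exists y B', sqsum_le y B' /\
    forall z v, has_sum_at y z v -> has_sum_at x z ((z - l) * v).
Proof.
move=> xB l0 xl.
have ml : 0 < modulus l by rewrite modulus_gt0.
have B0 := sqsum_le_ge0 xB.
have snz n : (s n)%:C != 0 :> C by rewrite fmorph_eq0 gt_eqF.
pose a n : C := x n / (s n)%:C.
(* The Taylor coefficients of the formal quotient by [z - l], solved upwards from degree 0; [y]
   below is their weighted form. *)
pose fix q n : C := if n is m.+1 then (q m - a m.+1) / l else - a 0%N / l.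
have qS n : a n.+1 = q n - l * q n.+1.
  by rewrite /= mulrC divfK // opprB addrC subrK.
have q0 : a 0%N = - l * q 0%N by rewrite /= mulrC mulrN divfK // opprK.
clearbody q.
have xa n z : x n * monom n z = a n * z ^+ n by rewrite /monom /a mulrA mulrAC.
have psum z M : \sum_(i < M.+1) x i * monom i z =
    (z - l) * (\sum_(i < M) q i * z ^+ i) - l * q M * z ^+ M.
  elim: M => [|M IHM].
    by rewrite big_ord1 big_ord0 mulr0 sub0r xa q0 expr0 !mulr1 mulNr.
  rewrite [LHS]big_ord_recr IHM [in RHS]big_ord_recr xa.
  have -> : a (@ord_max M.+1) = a M.+1 by [].
  by rewrite qS exprS /=; ring.
have ptail M : \sum_(i < M.+1) x i * monom i l = - l ^+ M.+1 * q M.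
  by rewrite psum subrr mul0r sub0r exprS; ring.
pose y n : C := (s n)%:C * q n.
have [N1 hN1] := monom_geometric l.
(* The upward recursion alone gives no bound. Vanishing at [l] turns the partial sum, which is
   [- l^(n+1) q_n], into minus a tail, and Cauchy-Schwarz with [monom_geometric] controls the
   tail. *)
have ybd n : (N1 <= n)%N -> modulus (y n) ^+ 2 <= B / modulus l ^+ 2.
  move=> N1n.
  have h1 : modulus (\sum_(i < n.+1) x i * monom i l) ^+ 2 <=
      B * modulus (monom n l) ^+ 2.
    have BK : 0 <= B * modulus (monom n l) ^+ 2 by rewrite mulr_ge0 // sqr_ge0.
    rewrite -(sqr_sqrtr BK) ler_sqr ?nnegrE ?modulus_ge0 ?sqrtr_ge0 //.
    have hc := cconvB (cconv_cst (\sum_(i < n.+1) x i * monom i l)) xl.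
    rewrite subr0 in hc.
    apply: cconv_modulus_le hc _; exists n.+1 => // M /= nM.
    rewrite -ler_sqr ?nnegrE ?modulus_ge0 ?sqrtr_ge0 // sqr_sqrtr //.
    rewrite modulusBC -!(big_mkord predT (fun i => x i * monom i l)).
    rewrite (@big_cat_nat _ _ _ n.+1 0 M) //= addrAC subrr add0r.
    rewrite -{1}[n.+1]add0n big_addn big_mkord.
    have hCS := sum_CauchySchwarz (fun i => x (i + n.+1)%N)
      (fun i => monom (i + n.+1)%N l) (M - n.+1).
    apply: le_trans hCS _.
    apply: ler_pM.
    - by apply: sumr_ge0 => i _; exact: sqr_ge0.
    - by apply: sumr_ge0 => i _; exact: sqr_ge0.
    - rewrite -(big_mkord predT (fun i => modulus (x (i + n.+1)%N) ^+ 2)).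
      rewrite -(big_addn 0 M n.+1 predT (fun i => modulus (x i) ^+ 2)) add0n.
      apply: le_trans (xB M).
      rewrite -(big_mkord predT (fun i => modulus (x i) ^+ 2)).
      rewrite [X in _ <= X](@big_cat_nat _ _ _ n.+1) //= lerDr.
      by apply: sumr_ge0 => i _; exact: sqr_ge0.
    rewrite -(big_mkord predT (fun i => modulus (monom (i + n.+1)%N l) ^+ 2)).
    rewrite -(big_addn 0 M n.+1 predT (fun i => modulus (monom i l) ^+ 2)) add0n.
    exact: hN1.
  rewrite ler_pdivlMr ?exprn_gt0 //.
  move: h1; rewrite ptail modulusM modulusN modulusX modulus_monom /y modulusM.
  rewrite modulus_real gtr0_norm // => h1.
  have sl : 0 < s n ^+ 2 / modulus l ^+ n ^+ 2 by rewrite divr_gt0 ?exprn_gt0.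
  rewrite -(ler_pM2r sl) in h1.
  have e1 : (modulus l ^+ n.+1 * modulus (q n)) ^+ 2 * (s n ^+ 2 / modulus l ^+ n ^+ 2)
     = (s n * modulus (q n)) ^+ 2 * modulus l ^+ 2.
    have t0 : modulus l ^+ n != 0 by rewrite expf_neq0 // gt_eqF.
    by rewrite (exprS (modulus l) n); move: (modulus l ^+ n) t0 => t t0; field.
  have e2 : B * (modulus l ^+ n / s n) ^+ 2 * (s n ^+ 2 / modulus l ^+ n ^+ 2) = B.
    by field; rewrite expf_neq0 ?gt_eqF.
  by rewrite e1 e2 in h1.
have [N2 hN2] := s_ratio (2 * modulus l).
(* Once [s n / s n.+1 <= 1 / (2 |l|)], doubling the square still leaves the factor 1/2 on
   [y n.+1]. *)
have yrec n : (N2 <= n)%N ->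
    modulus (y n) ^+ 2 <= modulus (x n.+1) ^+ 2 / (2 * modulus l ^+ 2)
      + modulus (y n.+1) ^+ 2 / 2.
  move=> N2n.
  have -> : y n = (s n / s n.+1)%:C * (x n.+1 + l * y n.+1).
    have -> : (s n / s n.+1)%:C = (s n)%:C / (s n.+1)%:C :> C.
      by rewrite rmorphM /= fmorphV.
    rewrite /y; have -> : q n = a n.+1 + l * q n.+1 by rewrite qS subrK.
    by rewrite /a; field; rewrite ?snz.
  have -> : modulus (x n.+1) ^+ 2 / (2 * modulus l ^+ 2) + modulus (y n.+1) ^+ 2 / 2
    = (2 * modulus l)^-1 ^+ 2 * (2 * modulus (x n.+1) ^+ 2 +
         2 * modulus (l * y n.+1) ^+ 2).
    by rewrite modulusM; field; rewrite gt_eqF.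
  rewrite modulusM exprMn modulus_real gtr0_norm ?divr_gt0 //.
  apply: ler_pM; rewrite ?sqr_ge0 //; last exact: sqr_modulusD_le.
  rewrite ler_sqr ?nnegrE; last 2 first.
  - by rewrite divr_ge0 // ltW.
  - by rewrite invr_ge0 mulr_ge0 // ltW.
  rewrite ler_pdivrMr // ler_pdivlMl ?mulr_gt0 //; exact: hN2.
pose N := maxn N1 N2.
(* Summing [yrec] bounds [Y] by half of itself plus controlled terms. The term beyond the upper end
   is handled by [ybd]. *)
have ysum m : \sum_(N <= i < N + m) modulus (y i) ^+ 2 <= 2 * (B / modulus l ^+ 2).
  set Y := \sum_(_ <= _ < _) _.
  have h1 : Y <= \sum_(N <= i < N + m) (modulus (x i.+1) ^+ 2 / (2 * modulus l ^+ 2)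
      + modulus (y i.+1) ^+ 2 / 2).
    rewrite /Y !big_nat; apply: ler_sum => i /andP[Ni _]; apply: yrec.
    by rewrite (leq_trans _ Ni) // leq_maxr.
  rewrite big_split /= -!mulr_suml in h1.
  have h2 : \sum_(N <= i < N + m) modulus (x i.+1) ^+ 2 <= B.
    apply: le_trans (xB (N + m).+1).
    rewrite -(big_mkord predT (fun i => modulus (x i) ^+ 2)).
    have -> : \sum_(N <= i < N + m) modulus (x i.+1) ^+ 2 =
        \sum_(N.+1 <= i < (N + m).+1) modulus (x i) ^+ 2 by rewrite big_add1.
    rewrite [X in _ <= X](@big_cat_nat _ _ _ N.+1) //=; last by rewrite ltnS leq_addr.
    by rewrite lerDr; apply: sumr_ge0 => i _; exact: sqr_ge0.
  have h3 : \sum_(N <= i < N + m) modulus (y i.+1) ^+ 2 <= Y + modulus (y (N + m)%N) ^+ 2.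
    have -> : \sum_(N <= i < N + m) modulus (y i.+1) ^+ 2 =
        \sum_(N.+1 <= i < (N + m).+1) modulus (y i) ^+ 2 by rewrite big_add1.
    rewrite /Y -big_nat_recr ?leq_addr //=.
    rewrite [X in _ <= X](big_ltn); last by rewrite ltnS leq_addr.
    by rewrite lerDr sqr_ge0.
  have h4 : modulus (y (N + m)%N) ^+ 2 <= B / modulus l ^+ 2.
    by apply: ybd; rewrite (leq_trans (leq_maxl N1 N2)) // leq_addr.
  have h5 : (\sum_(N <= i < N + m) modulus (x i.+1) ^+ 2) / (2 * modulus l ^+ 2)
     <= B / modulus l ^+ 2 / 2.
    have -> : B / modulus l ^+ 2 / 2 = B / (2 * modulus l ^+ 2).
      by field; rewrite gt_eqF.
    by rewrite ler_wpM2r // invr_ge0 mulr_ge0 // sqr_ge0.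
  lra.
exists y, (\sum_(0 <= i < N) modulus (y i) ^+ 2 + 2 * (B / modulus l ^+ 2)).
have yB : sqsum_le y (\sum_(0 <= i < N) modulus (y i) ^+ 2 + 2 * (B / modulus l ^+ 2)).
  move=> M; rewrite -(big_mkord predT (fun i => modulus (y i) ^+ 2)).
  apply: (@le_trans _ _ (\sum_(0 <= i < N + M) modulus (y i) ^+ 2)).
    rewrite [X in _ <= X](@big_cat_nat _ _ _ M) ?leq_addl //= lerDl.
    by apply: sumr_ge0 => i _; exact: sqr_ge0.
  by rewrite (@big_cat_nat _ _ _ N) ?leq_addr //= lerD2l.
split=> // z v yv; apply/cconvS.
have yv' : cconv (fun M => \sum_(i < M) q i * z ^+ i) v.
  apply: cconv_ext yv; apply: nearW => M; apply: eq_bigr => i _.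
  rewrite /y /monom; field; exact: snz.
(* The boundary term left by the finite division: [y] is bounded and the normalized monomials tend
   to 0. *)
have ht : cconv (fun M => l * q M * z ^+ M) 0.
  set Y := (_ + _) in yB.
  apply: (@cconv_squeeze _ _ _ (fun M => modulus l * Num.sqrt Y * modulus (monom M z))).
    apply: nearW => M; rewrite subr0.
    have -> : l * q M * z ^+ M = l * y M * monom M z.
      rewrite /y /monom; field; exact: snz.
    rewrite (modulusM (l * y M)) (modulusM l).
    apply: ler_wpM2r; first exact: modulus_ge0.
    apply: ler_wpM2l; first exact: modulus_ge0.
    rewrite -(ger0_norm (modulus_ge0 (y M))) -sqrtr_sqr ler_wsqrtr //.
    exact: sqsum_le_term.
  rewrite -[X in _ --> X](mulr0 (modulus l * Num.sqrt Y)).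
  by apply: cvgM; [exact: cvg_cst|exact: monom_cvg0].
have := cconvB (cconvZ (z - l) yv') ht; rewrite subr0.
by apply: cconv_ext; apply: nearW => M; rewrite psum.
Qed.

End PowerSeriesSpace.

(** * Riesz sequences of kernels *)

Section RieszSequences.
Context {R : realType}.
Local Notation C := R[i].
Variable s : nat -> R.
Hypothesis s_gt0 : forall n, 0 < s n.
Hypothesis s_ratio : forall B : R, exists N, forall n, (N <= n)%N -> B * s n <= s n.+1.
Implicit Types (x y : nat -> C) (z l : C) (A : {fset C}).

Local Notation monom := (monom s).
Local Notation ksum := (ksum s).
Local Notation has_sum_at := (has_sum_at s).
Local Notation fval := (sum_at s).

Definition nkernel l i : C := conjc (monom i l) / (Num.sqrt (ksum l))%:C.
Definition kcomb A (a : C -> C) i : C := \sum_(l <- A) a l * nkernel l i.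

Variables (L : set C) (c1 c2 : R).
Hypotheses (c1_gt0 : 0 < c1) (c2_gt0 : 0 < c2).
(** The Riesz basis property transported to l^2. Norms of combinations occur only through their
    upper bounds, and density is required for the unit vectors alone, from which [finite_approx]
    recovers it for finite sequences. *)
Hypothesis lower_bound : forall A a B, [set` A] `<=` L ->
  sqsum_le (kcomb A a) B -> c1 * (\sum_(l <- A) modulus (a l) ^+ 2) <= B.
Hypothesis upper_bound : forall A a, [set` A] `<=` L ->
  sqsum_le (kcomb A a) (c2 * (\sum_(l <- A) modulus (a l) ^+ 2)).
Hypothesis dense : forall n (e : R), 0 < e -> exists A a,
  [set` A] `<=` L /\ sqsum_le (fun i => (i == n)%:R - kcomb A a i) e.

Let ksum_gt0 l : 0 < ksum l. Proof. exact: ksum_gt0. Qed.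
Let sqrtK_gt0 l : 0 < Num.sqrt (ksum l). Proof. by rewrite sqrtr_gt0. Qed.
Let sqrtK_neq0 l : (Num.sqrt (ksum l))%:C != 0 :> C.
Proof. by rewrite fmorph_eq0 gt_eqF. Qed.

Lemma conj_real_div (w : C) (r : R) : conjc (conjc w / r%:C) = w / r%:C.
Proof.
have -> : (r%:C)^-1 = (r^-1)%:C :> C by rewrite fmorphV.
by case: w => a b; apply/eqP; rewrite eq_complex /=; apply/andP; split; apply/eqP; ring.
Qed.

Lemma kcomb_conj A a i :
  conjc (kcomb A a i) = \sum_(l <- A) conjc (a l) / (Num.sqrt (ksum l))%:C * monom i l.
Proof.
rewrite conjc_sum; apply: eq_bigr => l _.
by rewrite rmorphM /= /nkernel conj_real_div mulrA mulrAC.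
Qed.

Lemma pairing_partial x A a M : \sum_(i < M) x i * conjc (kcomb A a i) =
  \sum_(l <- A) conjc (a l) / (Num.sqrt (ksum l))%:C * \sum_(i < M) x i * monom i l.
Proof.
under eq_bigr do rewrite kcomb_conj mulr_sumr.
rewrite exchange_big /=; apply: eq_bigr => l _; rewrite mulr_sumr.
by apply: eq_bigr => i _; rewrite mulrCA.
Qed.

Lemma pairing_cvg x v A a : (forall l, has_sum_at x l (v l)) ->
  cconv (fun M => \sum_(i < M) x i * conjc (kcomb A a i))
    (\sum_(l <- A) conjc (a l) / (Num.sqrt (ksum l))%:C * v l).
Proof.
move=> xv; apply: cconv_ext (cconv_sum A (fun l => cconvZ _ (xv l))).
by apply: nearW => M; rewrite pairing_partial.
Qed.

Lemma sqsum_le_conj x B : sqsum_le x B -> sqsum_le (fun i => conjc (x i)) B.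
Proof. by move=> h M; under eq_bigr do rewrite modulus_conj; exact: h. Qed.

(** Duality: pairing [x] with the combination whose coefficients are the normalized values of [x]
    gives the sum [Q] of the statement, and the upper Riesz bound yields [Q^2 <= B c2 Q]. *)
Lemma bessel x B A v : [set` A] `<=` L -> sqsum_le x B ->
  (forall l, has_sum_at x l (v l)) ->
  \sum_(l <- A) modulus (v l) ^+ 2 / ksum l <= c2 * B.
Proof.
move=> AL xB xv; have B0 := sqsum_le_ge0 xB.
pose a l : C := v l / (Num.sqrt (ksum l))%:C.
have aE l : modulus (a l) ^+ 2 = modulus (v l) ^+ 2 / ksum l.
  rewrite /a modulusM modulusV modulus_real gtr0_norm // exprMn exprVn.
  by rewrite sqr_sqrtr // ltW.
under eq_bigr do rewrite -aE.
set Q := \sum_(l <- A) _.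
have Q0 : 0 <= Q by apply: sumr_ge0 => l _; exact: sqr_ge0.
have h := pairing_cvg A a xv.
have QE : \sum_(l <- A) conjc (a l) / (Num.sqrt (ksum l))%:C * v l = Q%:C.
  rewrite realC_sum; apply: eq_bigr => l _.
  by rewrite -mulc_conj mulrAC -mulrA mulrC.
rewrite QE in h.
have BQ : 0 <= B * (c2 * Q) by rewrite mulr_ge0 // mulr_ge0 // ltW.
have : modulus Q%:C <= Num.sqrt (B * (c2 * Q)).
  apply: cconv_modulus_le h _; apply: nearW => M.
  rewrite -ler_sqr ?nnegrE ?modulus_ge0 ?sqrtr_ge0 // sqr_sqrtr //.
  exact: sqsum_CauchySchwarz xB (sqsum_le_conj (upper_bound a AL)).
rewrite modulus_real ger0_norm // -ler_sqr ?nnegrE ?sqrtr_ge0 // sqr_sqrtr // => h2.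
have [Qp|/le_gtF Qn] := ltP 0 Q.
  by rewrite -(ler_pM2r Qp); move: h2; rewrite expr2; lra.
apply: le_trans (_ : 0 <= _); first by rewrite leNgt Qn.
by rewrite mulr_ge0 // ltW.
Qed.

(** Vanishing on [L] means orthogonality to every kernel, hence to the unit vectors, which the
    kernels approximate. *)
Lemma zero_on_L x B : sqsum_le x B -> (forall l, L l -> has_sum_at x l 0) ->
  forall n, x n = 0.
Proof.
move=> xB xL n; have B0 := sqsum_le_ge0 xB.
pose v l := fval x l.
have xv l : has_sum_at x l (v l) by exact: sum_atP xB.
have vL l : L l -> v l = 0 by move=> Ll; exact: cconv_unique (xv l) (xL l Ll).
apply/eqP; rewrite -[_ == 0]negbK -modulus_gt0; apply/negP => xn.
(* Small enough that [B e < |x_n|^2], against the bound [|x_n|^2 <= B e] obtained from the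
   approximation. *)
pose e := modulus (x n) ^+ 2 / (2 * (B + 1)).
have e0 : 0 < e by rewrite divr_gt0 ?exprn_gt0 //; lra.
have [A [a [AL hA]]] := dense n e0.
have h := pairing_cvg A a xv.
have z0 : \sum_(l <- A) conjc (a l) / (Num.sqrt (ksum l))%:C * v l = 0.
  rewrite big_seq big1 // => l lA; rewrite vL ?mulr0 //; exact: AL.
rewrite z0 in h.
have hx : cconv (fun M => \sum_(i < M) x i * conjc ((i == n :> nat)%:R)) (x n).
  apply: cconv_ext (cconv_cst _); exists n.+1 => // M /= nM.
  rewrite (bigD1 (Ordinal nM)) //= eqxx conjc_nat mulr1 big1 ?addr0 // => i.
  by rewrite -val_eqE /= => /negbTE ->; rewrite conjc_nat mulr0.
have h2 := cconvB hx h; rewrite subr0 in h2.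
have : modulus (x n) <= Num.sqrt (B * e).
  apply: cconv_modulus_le h2 _; apply: nearW => M.
  have Be : 0 <= B * e by rewrite mulr_ge0 // ltW.
  rewrite -ler_sqr ?nnegrE ?modulus_ge0 ?sqrtr_ge0 // sqr_sqrtr //.
  rewrite -sumrB; under eq_bigr do rewrite -mulrBr -raddfB.
  exact: sqsum_CauchySchwarz xB (sqsum_le_conj hA).
have Be : 0 <= B * e by rewrite mulr_ge0 // ltW.
rewrite -ler_sqr ?nnegrE ?modulus_ge0 ?sqrtr_ge0 // sqr_sqrtr // leNgt => /negP; apply.
rewrite /e mulrCA gtr_pMr ?exprn_gt0 //.
rewrite ltr_pdivrMr; lra.
Qed.

(** Coefficients are extended by zero, so that combinations over different finite sets can be added
    and compared at [l0]. *)
Definition coef A (a : C -> C) l0 : C := if l0 \in A then a l0 else 0.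

Lemma coef_bound A a l0 B : [set` A] `<=` L -> sqsum_le (kcomb A a) B ->
  c1 * modulus (coef A a l0) ^+ 2 <= B.
Proof.
move=> AL h; apply: le_trans (lower_bound AL h); rewrite ler_pM2l //.
rewrite /coef; case: ifP => l0A; last first.
  by rewrite modulus0 expr0n; apply: sumr_ge0 => l _; exact: sqr_ge0.
rewrite (big_fsetD1 l0) //= lerDl; apply: sumr_ge0 => l _; exact: sqr_ge0.
Qed.

Lemma kcomb_widen A A' a : (A `<=` A')%fset ->
  kcomb A a =1 kcomb A' (coef A a).
Proof.
move=> AA i; rewrite /kcomb -(big_fset_incl _ AA) => [|l lA' lA]; last first.
  by rewrite /coef (negbTE lA) mul0r.
by apply: eq_big_seq => l lA; rewrite /coef lA.
Qed.

Lemma kcomb_linear A a A' a' (c : C) : [set` A] `<=` L -> [set` A'] `<=` L ->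
  exists A'' a'', [/\ [set` A''] `<=` L,
    forall i, kcomb A'' a'' i = kcomb A a i + c * kcomb A' a' i &
    forall l0, coef A'' a'' l0 = coef A a l0 + c * coef A' a' l0].
Proof.
move=> AL A'L; exists (A `|` A')%fset, (fun l => coef A a l + c * coef A' a' l).
split.
- by move=> l /=; rewrite in_fsetU => /orP[/AL|/A'L].
- move=> i; rewrite (kcomb_widen a (fsubsetUl A A')) (kcomb_widen a' (fsubsetUr A A')).
  rewrite /kcomb mulr_sumr -big_split /=; apply: eq_bigr => l _.
  by rewrite mulrDl mulrA.
- move=> l0; rewrite {1}/coef in_fsetU; case: ifP => //.
  by move/negbT; rewrite negb_or /coef => /andP[/negbTE-> /negbTE->]; rewrite mulr0 addr0.
Qed.

(* [approx l0 v c]: the bounded functional "coefficient of the kernel at [l0]",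
   defined on the span of the kernels, extends to [v] with value [c]. *)
Definition approx l0 v (c : C) := forall e : R, 0 < e -> exists A a,
  [/\ [set` A] `<=` L, sqsum_le (fun i => v i - kcomb A a i) e &
      modulus (coef A a l0 - c) ^+ 2 <= e].

Lemma approx_ext l0 v v' c : v =1 v' -> approx l0 v c -> approx l0 v' c.
Proof.
move=> vv h e /h[A [a [AL h1 h2]]]; exists A, a; split=> //.
by apply: sqsum_le_ext h1 => i; rewrite vv.
Qed.

Lemma approx_linear l0 v c v' c' (k : C) : approx l0 v c -> approx l0 v' c' ->
  approx l0 (fun i => v i + k * v' i) (c + k * c').
Proof.
move=> h h' e e0; pose d := e / (2 + 2 * modulus k ^+ 2).
have k0 := sqr_ge0 (modulus k).
have d0 : 0 < d by rewrite divr_gt0 // ltr_pwDl // mulr_ge0.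
have dE : 2 * d + 2 * (modulus k ^+ 2 * d) = e.
  by rewrite /d; field; rewrite gt_eqF // ltr_pwDl // mulr_ge0.
have [A [a [AL h1 h2]]] := h d d0.
have [A' [a' [A'L h1' h2']]] := h' d d0.
have [A'' [a'' [A''L e1 e2]]] := kcomb_linear a a' k AL A'L.
exists A'', a''; split=> //.
  apply: (@sqsum_le_ext _ (fun i => (v i - kcomb A a i) + k * (v' i - kcomb A' a' i))).
    by move=> i; rewrite e1; ring.
  by rewrite -dE; apply: sqsum_leD => //; exact: sqsum_leZ.
have -> : coef A'' a'' l0 - (c + k * c') =
    (coef A a l0 - c) + k * (coef A' a' l0 - c') by rewrite e2; ring.
apply: le_trans (sqr_modulusD_le _ _) _; rewrite -dE lerD // ler_wpM2l //.
by rewrite modulusM exprMn ler_wpM2l.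
Qed.

(** The lower Riesz bound makes the coefficient functional bounded. The factor 4 comes from squaring
    a sum twice: once for the approximated vector, once for its coefficient. *)
Lemma approx_bound l0 v c B : approx l0 v c -> sqsum_le v B ->
  c1 * modulus c ^+ 2 <= 4 * B.
Proof.
move=> h vB; have B0 := sqsum_le_ge0 vB.
apply/ler_addgt0Pr => e e0; pose d := e / (4 + 2 * c1).
have d0 : 0 < d by rewrite divr_gt0 // addr_gt0 // mulr_gt0.
have dE : (4 + 2 * c1) * d = e.
  by rewrite /d mulrC divfK // gt_eqF // addr_gt0 // mulr_gt0.
have [A [a [AL h1 h2]]] := h d d0.
have hT : sqsum_le (kcomb A a) (2 * B + 2 * d).
  apply: (@sqsum_le_ext _ (fun i => v i - (v i - kcomb A a i))).
    by move=> i; rewrite opprB addrC subrK.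
  exact: sqsum_leB.
have h3 := coef_bound l0 AL hT.
have h4 : modulus c ^+ 2 <= 2 * modulus (coef A a l0) ^+ 2 + 2 * d.
  have -> : c = coef A a l0 + - (coef A a l0 - c) by ring.
  apply: le_trans (sqr_modulusD_le _ _) _.
  by rewrite modulusN lerD2l; lra.
have := ler_wpM2l (ltW c1_gt0) h4; lra.
Qed.

(** Approximations of a unit vector are Cauchy, and by the lower Riesz bound so are their
    coefficients at [l0]. *)
Lemma approx_delta l0 n : exists c, approx l0 (fun i => (i == n)%:R) c.
Proof.
pose P j (p : {fset C} * (C -> C)) := [set` p.1] `<=` L /\
  sqsum_le (fun i => (i == n)%:R - kcomb p.1 p.2 i) (j.+1%:R^-1).
have [p hp] : {p : nat -> {fset C} * (C -> C) & forall j, P j (p j)}.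
  apply: (@choice _ _ P) => j; have j0 : 0 < j.+1%:R^-1 :> R by rewrite invr_gt0.
  by have [A [a [AL h]]] := dense n j0; exists (A, a).
pose u j := coef (p j).1 (p j).2 l0.
have hu j k : c1 * modulus (u j - u k) ^+ 2 <= 2 * j.+1%:R^-1 + 2 * k.+1%:R^-1.
  have [jL hj] := hp j; have [kL hk] := hp k.
  have [A [a [AL e1 e2]]] := kcomb_linear (p j).2 (p k).2 (-1) jL kL.
  have := @coef_bound A a l0 _ AL; rewrite e2 mulN1r => h; apply: h.
  rewrite [X in sqsum_le _ X]addrC.
  by apply: sqsum_le_ext (sqsum_leB hk hj) => i; rewrite e1; ring.
have small (e : R) : 0 < e -> exists N, forall j, (N <= j)%N -> j.+1%:R^-1 <= e :> R.
  move=> e0; have [N _ hN] := near_infty_natSinv_lt (PosNum e0).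
  by exists N => j jN; exact: ltW (hN j jN).
have [c uc] : exists c, cconv u c.
  apply: cconv_cauchy => e e0.
  have [N hN] := small (c1 * e ^+ 2 / 4) ltac:(by rewrite divr_gt0 // mulr_gt0 // exprn_gt0).
  exists N => j k jN kN.
  rewrite -ler_sqr ?nnegrE ?modulus_ge0 ?(ltW e0) // -(ler_pM2l c1_gt0).
  apply: le_trans (hu j k) _; have := hN j jN; have := hN k kN.
  by move: (j.+1%:R^-1) (k.+1%:R^-1) => p1 p2; lra.
exists c => e e0.
have [N hN] := small e e0.
have es : 0 < Num.sqrt e by rewrite sqrtr_gt0.
have /cconvP /(_ _ es) [N' _ hN'] := uc.
pose j := maxn N N'; have [jL hj] := hp j.
exists (p j).1, (p j).2; split=> //.
  by apply: sqsum_leW hj; apply: hN; exact: leq_maxl.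
rewrite -(sqr_sqrtr (ltW e0)) ler_sqr ?nnegrE ?modulus_ge0 ?sqrtr_ge0 //.
by apply: ltW; apply: hN'; exact: leq_maxr.
Qed.

Lemma approx_nkernel l0 l : L l -> approx l0 (nkernel l) (l0 == l)%:R.
Proof.
move=> Ll e e0; exists [fset l]%fset, (fun=> 1); split.
- by move=> z /=; rewrite in_fset1 => /eqP ->.
- move=> M; rewrite big1 ?ltW // => i _.
  by rewrite /kcomb big_seq_fset1 mul1r subrr modulus0 expr0n.
- by rewrite /coef in_fset1; case: eqP => _; rewrite subrr modulus0 expr0n ltW.
Qed.

(** The Riesz representation of the coefficient functional, built coordinatewise: [G n] is its value
    on the unit vector [n], and the dual function has coefficients [conjc (G n)]. *)
Lemma dual_ex l0 : exists g, sqsum_le g (4 / c1) /\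
  forall l, L l -> has_sum_at g l ((l0 == l)%:R * (Num.sqrt (ksum l))%:C).
Proof.
have [G hG] := choice (approx_delta l0).
have fin v M : approx l0 (fun i => if (i < M)%N then v i else 0) (\sum_(i < M) v i * G i).
  elim: M => [|M IHM].
    rewrite big_ord0 => e e0; exists fset0, (fun=> 0); split.
    - by move=> z /=; rewrite in_fset0.
    - by move=> M; rewrite big1 ?ltW // => i _; rewrite /kcomb big_seq_fset0 subrr modulus0 expr0n.
    - by rewrite /coef in_fset0 subrr modulus0 expr0n ltW.
  rewrite big_ord_recr /=; apply: approx_ext (approx_linear (v M) IHM (hG M)) => i /=.
  by rewrite [in RHS]ltnS; case: (ltngtP i M) => [_|_|->]; rewrite ?mulr0 ?mulr1 ?addr0 ?add0r.
have GB : sqsum_le G (4 / c1).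
  move=> M; set S := \sum_(i < M) _.
  have S0 : 0 <= S by apply: sumr_ge0 => i _; exact: sqr_ge0.
  (* Testing the functional on its own truncated conjugate gives [c1 S^2 <= 4 S]. *)
  have h := fin (fun i => conjc (G i)) M.
  have e1 : \sum_(i < M) conjc (G i) * G i = S%:C.
    by rewrite realC_sum; apply: eq_bigr => i _; rewrite mulrC mulc_conj.
  rewrite e1 in h.
  have vS : sqsum_le (fun i => if (i < M)%N then conjc (G i) else 0) S.
    move=> M'; case: (leqP M M') => MM.
      rewrite -(big_mkord predT (fun i => modulus (if (i < M)%N then conjc (G i) else 0) ^+ 2)).
      rewrite (@big_cat_nat _ _ _ M) //= big_mkord [X in _ + X]big1_seq ?addr0.
        by apply: ler_sum => i _; rewrite ltn_ord modulus_conj.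
      move=> i; rewrite mem_index_iota => /andP[_ /andP[Mi _]].
      by rewrite ltnNge Mi modulus0 expr0n.
    rewrite /S -(big_mkord predT (fun i => modulus (G i) ^+ 2)).
    rewrite [X in _ <= X](@big_cat_nat _ _ _ M') ?(ltnW MM) //=.
    apply: (@le_trans _ _ (\sum_(0 <= i < M') modulus (G i) ^+ 2)).
      rewrite big_mkord; apply: ler_sum => i _.
      by rewrite (ltn_trans (ltn_ord i) MM) modulus_conj.
    by rewrite lerDl; apply: sumr_ge0 => i _; exact: sqr_ge0.
  have := approx_bound h vS; rewrite modulus_real ger0_norm // => h2.
  have [Sp|] := ltP 0 S; last by move=> /le_trans; apply; rewrite divr_ge0 // ltW.
  by rewrite ler_pdivlMr // -(ler_pM2r Sp); lra.
exists (fun i => conjc (G i)); split; first exact: sqsum_le_conj.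
move=> l Ll.
set del : C := (l0 == l)%:R.
(* The truncated kernel differs from the kernel, where the functional equals [del], by a tail of the
   series [ksum l]; boundedness of the functional transfers this to the values. *)
have hM M : c1 * modulus (\sum_(i < M) nkernel l i * G i - del) ^+ 2 <=
    4 * ((ksum l - \sum_(i < M) modulus (monom i l) ^+ 2) / ksum l).
  have := approx_linear (-1) (fin (nkernel l) M) (approx_nkernel l0 Ll).
  rewrite mulN1r => h; apply: approx_bound h _ => M'.
  rewrite ler_pdivlMr // mulr_suml lerBrDl.
  apply: le_trans (ksum_ub s_gt0 s_ratio l (maxn M M')).
  rewrite -!(big_mkord predT (fun i => modulus (monom i l) ^+ 2)).
  rewrite [X in _ <= X](@big_cat_nat _ _ _ M) ?leq_maxl //= big_mkord lerD2l.
  rewrite -(big_mkord predT (fun i => modulus ((if (i < M)%N then nkernel l i else 0)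
     + -1 * nkernel l i) ^+ 2 * ksum l)).
  have nk i : modulus (nkernel l i) ^+ 2 * ksum l = modulus (monom i l) ^+ 2.
    rewrite modulusM modulus_conj modulusV modulus_real gtr0_norm // exprMn exprVn.
    by rewrite sqr_sqrtr ?divfK ?gt_eqF // ltW.
  case: (leqP M M') => MM.
    rewrite (@big_cat_nat _ _ _ M 0 M') //= [X in X + _]big1_seq ?add0r.
      rewrite big_nat [X in _ <= X]big_nat; apply: ler_sum => i /andP[Mi _].
      by rewrite ltnNge Mi /= add0r mulN1r modulusN nk.
    move=> i; rewrite mem_index_iota => /andP[_ /andP[_ iM]].
    by rewrite iM mulN1r subrr modulus0 expr0n mul0r.
  rewrite big1_seq; first by apply: sumr_ge0 => i _; exact: sqr_ge0.
  move=> i; rewrite mem_index_iota => /andP[_ /andP[_ iM]].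
  by rewrite (ltn_trans iM MM) mulN1r subrr modulus0 expr0n mul0r.
have hc : cconv (fun M => \sum_(i < M) nkernel l i * G i) del.
  apply: (@cconv_squeeze _ _ _ (fun M => Num.sqrt (4 / (c1 * ksum l) *
      (ksum l - \sum_(i < M) modulus (monom i l) ^+ 2)))).
    apply: nearW => M.
    rewrite -(ger0_norm (modulus_ge0 _)) -sqrtr_sqr ler_wsqrtr //.
    rewrite -(ler_pM2l c1_gt0); apply: le_trans (hM M) _.
    rewrite le_eqVlt; apply/orP; left; apply/eqP; field.
    by rewrite !gt_eqF.
  have h0 : (4 / (c1 * ksum l) * (ksum l - \sum_(i < M) modulus (monom i l) ^+ 2))
      @[M --> \oo] --> (0 : R).
    have h2 : (4 / (c1 * ksum l) * (ksum l - \sum_(i < M) modulus (monom i l) ^+ 2))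
        @[M --> \oo] --> 4 / (c1 * ksum l) * (ksum l - ksum l).
      apply: cvgM; first exact: cvg_cst.
      by apply: cvgB; [exact: cvg_cst|exact: (@ksum_cvg _ _ s_gt0 s_ratio l)].
    by rewrite subrr mulr0 in h2; exact: h2.
  have := continuous_cvg _ (@sqrt_continuous R 0) h0; rewrite sqrtr0; exact.
have := cconvZ (Num.sqrt (ksum l))%:C (cconv_conj hc).
rewrite [conjc del]conjc_nat mulrC; apply: cconv_ext; apply: nearW => M.
rewrite conjc_sum mulr_sumr; apply: eq_bigr => i _.
rewrite rmorphM /= /nkernel conj_real_div; field; exact: sqrtK_neq0.
Qed.


Lemma finite_approx n x (e : R) : (forall i, (n <= i)%N -> x i = 0) -> 0 < e ->
  exists A a, [set` A] `<=` L /\ sqsum_le (fun i => x i - kcomb A a i) e.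
Proof.
(* The coefficient functional at 0 only serves as a vehicle: [approx] already handles sums of
   approximations, and its approximation part is kept. *)
move=> x0; have [G hG] := choice (approx_delta 0).
move=> e0; suff h M : approx 0 (fun i => if (i < M)%N then x i else 0) (\sum_(i < M) x i * G i).
  have [A [a [AL h1 _]]] := h n e e0; exists A, a; split=> //.
  by apply: sqsum_le_ext h1 => i; case: leqP => // /x0 ->.
elim: M => [|M IHM].
  rewrite big_ord0 => d d0; exists fset0, (fun=> 0); split.
  - by move=> z /=; rewrite in_fset0.
  - by move=> M; rewrite big1 ?ltW // => i _; rewrite /kcomb big_seq_fset0 subrr modulus0 expr0n.
  - by rewrite /coef in_fset0 subrr modulus0 expr0n ltW.
rewrite big_ord_recr /=; apply: approx_ext (approx_linear (x M) IHM (hG M)) => i /=.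
by rewrite [in RHS]ltnS; case: (ltngtP i M) => [_|_|->]; rewrite ?mulr0 ?mulr1 ?addr0 ?add0r.
Qed.

Lemma finite_sqsum n x : (forall i, (n <= i)%N -> x i = 0) ->
  sqsum_le x (\sum_(i < n) modulus (x i) ^+ 2).
Proof.
move=> x0 M; rewrite -!(big_mkord predT (fun i => modulus (x i) ^+ 2)).
case: (leqP n M) => nM.
  rewrite (@big_cat_nat _ _ _ n 0 M) //= [X in _ + X]big1_seq ?addr0 // => i.
  by rewrite mem_index_iota => /andP[_ /andP[ni _]]; rewrite x0 // modulus0 expr0n.
rewrite [X in _ <= X](@big_cat_nat _ _ _ M) ?(ltnW nM) //= lerDl.
by apply: sumr_ge0 => i _; exact: sqr_ge0.
Qed.

(* If [x] represents [f], then [shift_mul w x] represents [(z - w) * f]. *)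
Definition shift_mul (w : C) x i : C :=
  (if i is j.+1 then x j * (s j.+1 / s j)%:C else 0) - w * x i.

Lemma shift_mul_eval w n x z : (forall i, (n <= i)%N -> x i = 0) ->
  \sum_(i < n.+1) shift_mul w x i * monom i z = (z - w) * \sum_(i < n) x i * monom i z.
Proof.
move=> x0.
rewrite (eq_bigr (fun i : 'I_n.+1 => (if i : nat is j.+1 then x j * (s j.+1 / s j)%:C else 0)
    * monom i z - w * (x i * monom i z))); last first.
  by move=> i _; rewrite /shift_mul mulrBl mulrA.
rewrite sumrB mulrBl -mulr_sumr big_ord_recl mul0r add0r; congr (_ - _).
  rewrite mulr_sumr; apply: eq_bigr => i _; rewrite /= /bump /= ?add1n /monom.
  have sn k : (s k)%:C != 0 :> C by rewrite fmorph_eq0 gt_eqF.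
  have -> : (s i.+1 / s i)%:C = (s i.+1)%:C / (s i)%:C :> C.
    by rewrite rmorphM /= fmorphV.
  by rewrite exprS; field; rewrite !sn.
by rewrite big_ord_recr /= x0 // mul0r addr0.
Qed.

(** If [L] avoids the disc, the Bessel sum of [(z - w) f] is at least [d^2] times that of [f], and
    by the lower bound and density the latter is at least a constant times the norm of [f]. So
    [z - w] cannot shrink any [f] too much. *)
Lemma no_gap w n x (d : R) : 0 < d -> (forall i, (n <= i)%N -> x i = 0) ->
  (forall l, L l -> d <= modulus (l - w)) ->
  c1 * d ^+ 2 * \sum_(i < n) modulus (x i) ^+ 2 <=
  4 * c2 * \sum_(i < n.+1) modulus (shift_mul w x i) ^+ 2.
Proof.
move=> d0 x0 hd; set X := \sum_(i < n) _; set Y := \sum_(i < n.+1) _.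
have X0 : 0 <= X by apply: sumr_ge0 => i _; exact: sqr_ge0.
have Y0 : 0 <= Y by apply: sumr_ge0 => i _; exact: sqr_ge0.
pose fx l := \sum_(i < n) x i * monom i l.
have y0 i : (n.+1 <= i)%N -> shift_mul w x i = 0.
  by case: i => // i ni; rewrite /shift_mul !x0 // ?mul0r ?mulr0 ?subrr // ltnW.
have xX : sqsum_le x X by exact: finite_sqsum.
have yY : sqsum_le (shift_mul w x) Y by exact: finite_sqsum.
have hy l : has_sum_at (shift_mul w x) l ((l - w) * fx l).
  by rewrite -shift_mul_eval //; exact: has_sum_at_finite.
pose P := c2 * Y / d ^+ 2.
have P0 : 0 <= P by rewrite divr_ge0 ?sqr_ge0 // mulr_ge0 // ltW.
have fxP A : [set` A] `<=` L -> \sum_(l <- A) modulus (fx l) ^+ 2 / ksum l <= P.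
  move=> AL; rewrite ler_pdivlMr ?exprn_gt0 // mulr_suml.
  apply: le_trans (bessel AL yY hy); rewrite big_seq [X in _ <= X]big_seq.
  apply: ler_sum => l lA; rewrite mulrAC ler_wpM2r ?invr_ge0 ?(ltW (ksum_gt0 l)) //.
  rewrite modulusM exprMn mulrC ler_wpM2r ?sqr_ge0 //.
  rewrite ler_sqr ?nnegrE ?modulus_ge0 ?(ltW d0) //; apply: hd; exact: AL.
(* [X] is split as the pairing of [x] with [x - kcomb A a], which is small, and with [kcomb A a],
   which Cauchy-Schwarz over [A] bounds by the coefficients [Q] and the values [P]. Then [e] tends
   to 0. *)
have key (e : R) : 0 < e -> c1 * X ^+ 2 <= 2 * c1 * X * e + 4 * (X + e) * P.
  move=> e0; have [A [a [AL hA]]] := finite_approx x0 e0.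
  have hT : sqsum_le (kcomb A a) (2 * X + 2 * e).
    apply: (@sqsum_le_ext _ (fun i => x i - (x i - kcomb A a i))).
      by move=> i; rewrite opprB addrC subrK.
    exact: sqsum_leB.
  have hQ := lower_bound AL hT; set Q := \sum_(l <- A) _ in hQ.
  have Q0 : 0 <= Q by apply: sumr_ge0 => l _; exact: sqr_ge0.
  have e1 : X%:C = \sum_(i < n) x i * conjc (x i - kcomb A a i) +
       \sum_(i < n) x i * conjc (kcomb A a i).
    rewrite -big_split /= realC_sum; apply: eq_bigr => i _.
    by rewrite -mulrDr -raddfD subrK mulc_conj.
  have h1 : modulus (\sum_(i < n) x i * conjc (x i - kcomb A a i)) ^+ 2 <= X * e.
    exact: sqsum_CauchySchwarz xX (sqsum_le_conj hA).
  have h2 : modulus (\sum_(i < n) x i * conjc (kcomb A a i)) ^+ 2 <= Q * P.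
    rewrite pairing_partial.
    have -> : \sum_(l <- A) conjc (a l) / (Num.sqrt (ksum l))%:C * (\sum_(i < n) x i * monom i l)
       = \sum_(j < size A) conjc (a (nth 0 A j)) *
           (fx (nth 0 A j) / (Num.sqrt (ksum (nth 0 A j)))%:C).
      rewrite (big_nth 0) big_mkord; apply: eq_bigr => j _.
      by rewrite mulrAC mulrA.
    apply: le_trans (sum_CauchySchwarz (fun j => conjc (a (nth 0 A j)))
      (fun j => fx (nth 0 A j) / (Num.sqrt (ksum (nth 0 A j)))%:C) (size A)) _.
    apply: ler_pM.
    - by apply: sumr_ge0 => i _; exact: sqr_ge0.
    - by apply: sumr_ge0 => i _; exact: sqr_ge0.
    - by under eq_bigr do rewrite modulus_conj; rewrite /Q (big_nth 0) big_mkord.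
    - apply: le_trans (fxP A AL); rewrite (big_nth 0) big_mkord; apply: ler_sum => j _.
      rewrite modulusM modulusV modulus_real gtr0_norm // exprMn exprVn.
      by rewrite sqr_sqrtr // ltW.
  have h3 : X ^+ 2 <= 2 * (X * e) + 2 * (Q * P).
    rewrite -[X in X ^+ 2 <= _](ger0_norm X0) -modulus_real e1.
    by apply: le_trans (sqr_modulusD_le _ _) _; rewrite lerD // ler_wpM2l.
  have h4 : c1 * X ^+ 2 <= c1 * (2 * (X * e) + 2 * (Q * P)) by rewrite ler_pM2l.
  have h5 : (c1 * Q) * P <= (2 * X + 2 * e) * P by rewrite ler_wpM2r.
  apply: le_trans h4 _.
  have -> : c1 * (2 * (X * e) + 2 * (Q * P)) = 2 * c1 * X * e + 2 * (c1 * Q * P) by ring.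
  rewrite lerD2l; apply: le_trans (ler_wpM2l _ h5) _ => //.
  by rewrite le_eqVlt; apply/orP; left; apply/eqP; ring.
have lim : c1 * X ^+ 2 <= 4 * X * P.
  apply/ler_addgt0Pr => e e0; pose k := 2 * c1 * X + 4 * P + 1.
  have k0 : 0 < k by rewrite ltr_wpDl // addr_ge0 // mulr_ge0 // mulr_ge0 // ltW.
  have := key (e / k) (divr_gt0 e0 k0) => /le_trans; apply.
  have -> : 2 * c1 * X * (e / k) + 4 * (X + e / k) * P =
     4 * X * P + (2 * c1 * X + 4 * P) * (e / k) by ring.
  rewrite lerD2l mulrCA ger_pMr // ler_pdivrMr // mul1r /k lerDl //.
have [Xp|] := ltP 0 X; last first.
  move=> X0'; apply: (@le_trans _ _ 0); last by rewrite !mulr_ge0 // ltW.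
  by rewrite mulr_ge0_le0 // mulr_ge0 ?sqr_ge0 // ltW.
have h : c1 * X <= 4 * P by rewrite -(ler_pM2r Xp); move: lim; rewrite expr2; lra.
have := ler_wpM2r (sqr_ge0 d) h.
have -> : 4 * P * d ^+ 2 = 4 * c2 * Y by rewrite /P; field; rewrite gt_eqF.
by move=> h'; apply: le_trans h'; rewrite mulrAC.
Qed.

(** [g] vanishes at [l'], so [(z - l) g / (z - l')] is square-summable and vanishes on [L] off [l'];
    completeness makes it a multiple of [g']. The factor [b] is the ratio [gamma_l / gamma_l']. *)
Lemma dual_relation g g' B l l' : L l -> L l' -> l' != 0 ->
  sqsum_le g B -> sqsum_le g' B ->
  (forall m, L m -> has_sum_at g m ((l == m)%:R * (Num.sqrt (ksum m))%:C)) ->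
  (forall m, L m -> has_sum_at g' m ((l' == m)%:R * (Num.sqrt (ksum m))%:C)) ->
  exists b, forall z, (z - l) * fval g z = b * ((z - l') * fval g' z).
Proof.
move=> Ll Ll' l'0 gB g'B hg hg'.
have [ll|ll] := eqVneq l l'.
  exists 1 => z; rewrite mul1r ll; congr (_ * _); congr (fval _ z).
  have h : sqsum_le (fun i => g i - g' i) (2 * B + 2 * B) by exact: sqsum_leB.
  apply/funext => i; apply/eqP; rewrite -subr_eq0; apply/eqP.
  apply: (zero_on_L h) => m Lm; have := has_sum_atD (hg m Lm) (has_sum_atZ (-1) (hg' m Lm)).
  rewrite ll mulN1r subrr; apply: cconv_ext; apply: nearW => M.
  by apply: eq_bigr => j _; rewrite mulN1r.
have g0 : has_sum_at g l' 0 by have := hg l' Ll'; rewrite (negbTE ll) mul0r.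
have [y [B' [yB hy]]] := division s_gt0 s_ratio gB l'0 g0.
pose v z := fval y z.
have yv z : has_sum_at y z (v z) by exact: sum_atP yB.
have gv z : fval g z = (z - l') * v z.
  exact: has_sum_at_sum_at (hy z _ (yv z)).
(* Since [z - l = (z - l') + (l' - l)], these are the coefficients of [(z - l) v]. *)
pose x i := g i + (l' - l) * y i.
have xB := sqsum_leD gB (sqsum_leZ (l' - l) yB).
have xv z : has_sum_at x z ((z - l) * v z).
  have := has_sum_atD (hy z _ (yv z)) (has_sum_atZ (l' - l) (yv z)).
  by rewrite -mulrDl addrA subrK.
(* Matches the values at [l'], the only point of [L] where the difference is not already zero. *)
pose b := (l' - l) * v l' / (Num.sqrt (ksum l'))%:C.
have x'B := sqsum_leD xB (sqsum_leZ (- b) g'B).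
have xE i : x i = b * g' i.
  apply/eqP; rewrite -subr_eq0 -mulNr; apply/eqP.
  apply: (zero_on_L x'B) => m Lm.
  have := has_sum_atD (xv m) (has_sum_atZ (- b) (hg' m Lm)).
  suff -> : (m - l) * v m + - b * ((l' == m)%:R * (Num.sqrt (ksum m))%:C) = 0 by [].
  have [<-|lm] := eqVneq l' m.
    by rewrite mul1r /b mulNr divfK // subrr.
  rewrite mul0r mulr0 addr0.
  have [->|lm2] := eqVneq m l; first by rewrite subrr mul0r.
  have : (m - l') * v m = 0.
    rewrite -gv; apply: has_sum_at_sum_at; have := hg m Lm.
    by rewrite eq_sym (negbTE lm2) mul0r.
  move/eqP; rewrite mulf_eq0 subr_eq0 eq_sym (negbTE lm) /= => /eqP ->.
  by rewrite mulr0.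
exists b => z; rewrite gv mulrCA [X in _ = X]mulrCA; congr (_ * _).
rewrite -(has_sum_at_sum_at (xv z)).
have -> : x = (fun i => b * g' i) by apply/funext.
by apply: has_sum_at_sum_at; apply: has_sum_atZ; exact: sum_atP g'B.
Qed.

(** The weights [|monom i z|^2 / ksum z] form a probability on the indices. A second moment about
    some integer centre [N] is enough, so the mean is avoided. *)
Definition variance_le (V : R) z := exists N : nat, forall M,
  \sum_(i < M) (i%:R - N%:R) ^+ 2 * modulus (monom i z) ^+ 2 <= V * ksum z.

Lemma unimodular_pow_dist (u : C) m n : modulus u = 1 ->
  modulus (u ^+ m - u ^+ n) <= `|m%:R - n%:R| * modulus (u - 1).
Proof.
move=> u1; wlog mn : m n / (n <= m)%N => [hw|].
  by case: (leqP n m) => [|/ltnW] nm; [|rewrite modulusBC distrC]; exact: hw.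
rewrite -(subnK mn) natrD addrK normr_nat exprD -{2}[u ^+ n]mul1r -mulrBl.
rewrite modulusM modulusX u1 expr1n mulr1 subrX1 modulusM mulrC.
apply: ler_wpM2r; first exact: modulus_ge0.
apply: le_trans (modulus_sum _ _ _) _.
rewrite (eq_bigr (fun=> 1)) => [|i _]; last by rewrite modulusX u1 expr1n.
by rewrite sumr_const card_ord.
Qed.

(** [f (u l)] is compared with [u^N f(l)], which has the same modulus as [f(l)]. The difference
    involves [u^i - u^N], at most [|i - N| |u - 1|] in modulus, so Cauchy-Schwarz and the variance
    bound it by half of [sqrt (ksum l)]. *)
Lemma rotated_value g B l V (u : C) : sqsum_le g B -> modulus u = 1 ->
  has_sum_at g l (Num.sqrt (ksum l))%:C -> variance_le V l ->
  4 * B * V * modulus (u - 1) ^+ 2 <= 1 ->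
  Num.sqrt (ksum l) / 2 <= modulus (fval g (u * l)).
Proof.
move=> gB u1 gl [N hN] small; have B0 := sqsum_le_ge0 gB.
have h1 := sum_atP s_gt0 s_ratio (u * l) gB.
set v := fval g (u * l) in h1 *.
have h2 := cconvB h1 (cconvZ (u ^+ N) gl).
have : modulus (v - u ^+ N * (Num.sqrt (ksum l))%:C) <= Num.sqrt (ksum l) / 2.
  apply: cconv_modulus_le h2 _; apply: nearW => M.
  rewrite mulr_sumr -sumrB.
  have e i : g i * monom i (u * l) - u ^+ N * (g i * monom i l) =
      g i * ((u ^+ i - u ^+ N) * monom i l).
    by rewrite /monom exprMn; ring.
  under eq_bigr do rewrite e.
  have K2 : 0 <= Num.sqrt (ksum l) / 2 by rewrite divr_ge0 // sqrtr_ge0.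
  rewrite -ler_sqr ?nnegrE ?modulus_ge0 //.
  apply: le_trans (sqsum_CauchySchwarz (y := fun i => (u ^+ i - u ^+ N) * monom i l)
    (B' := V * ksum l * modulus (u - 1) ^+ 2) M gB _) _.
    move=> M'; apply: (@le_trans _ _ (\sum_(i < M') ((i%:R - N%:R) ^+ 2 *
        modulus (monom i l) ^+ 2) * modulus (u - 1) ^+ 2)).
      apply: ler_sum => i _; rewrite modulusM exprMn [X in _ <= X]mulrAC.
      apply: ler_wpM2r; first exact: sqr_ge0.
      rewrite -exprMn -(real_normK (num_real ((i%:R - N%:R) * _))) normrM.
      rewrite (ger0_norm (modulus_ge0 (u - 1))).
      rewrite ler_sqr ?nnegrE ?modulus_ge0 ?mulr_ge0 ?normr_ge0 ?modulus_ge0 //.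
      exact: unimodular_pow_dist.
    by rewrite -mulr_suml ler_wpM2r ?sqr_ge0.
  rewrite exprMn sqr_sqrtr ?(ltW (ksum_gt0 l)) //.
  have := ler_wpM2r (ltW (ksum_gt0 l)) small; lra.
have := modulus_dist v (u ^+ N * (Num.sqrt (ksum l))%:C).
rewrite modulusM modulusX u1 expr1n mul1r modulus_real (gtr0_norm (sqrtK_gt0 l)) => h3 h4.
have := ler_norm (Num.sqrt (ksum l) - modulus v); rewrite distrC.
move: h3 h4; move: `|_ - _| (modulus (_ - _ * _)) => p1 p2; lra.
Qed.

(** Pairing [(i, j)] with [(j, i)] needs equal weights, but [|u p_j - p_i|] is not symmetric. It is
    therefore replaced by a symmetric majorant [D], and the numerators by a common lower bound
    [sigma]. *)
Lemma family_bound (I : finType) (p : I -> C) (V sigma : R) (D : I -> I -> R) (u : C) :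
  injective p -> (forall i, L (p i)) -> (forall i, p i != 0) ->
  (forall i, variance_le V (p i)) ->
  modulus u = 1 -> 16 / c1 * V * modulus (u - 1) ^+ 2 <= 1 ->
  0 < sigma -> (forall i, sigma <= modulus (u - 1) * modulus (p i)) ->
  (forall i j, D i j = D j i) -> (forall i j, 0 < D i j) ->
  (forall i j, modulus (u * p j - p i) <= D i j) ->
  \sum_i \sum_j (sigma / D i j) ^+ 2 <= 16 * c2 / c1 * #|I|%:R.
Proof.
move=> pinj pL p0 pV u1 usmall s0 hs Dsym D0 hD.
have [g hg] := choice (fun i => dual_ex (p i)).
have gB i : sqsum_le (g i) (4 / c1) by case: (hg i).
have gv i l : L l -> has_sum_at (g i) l ((p i == l)%:R * (Num.sqrt (ksum l))%:C).
  by case: (hg i) => _; exact.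
pose f i z := fval (g i) z.
have fbig i : Num.sqrt (ksum (p i)) / 2 <= modulus (f i (u * p i)).
  apply: (rotated_value (gB i) u1 _ (pV i)).
    by have := gv i _ (pL i); rewrite eqxx mul1r.
  by apply: le_trans usmall; rewrite le_eqVlt; apply/orP; left; apply/eqP; field; rewrite gt_eqF.
have u0 i : 0 < modulus (u - 1) * modulus (p i) by exact: lt_le_trans (hs i).
have fne i : (u * p i - p i) * f i (u * p i) != 0.
  rewrite -modulus_gt0 modulusM -{2}(mul1r (p i)) -mulrBl modulusM mulr_gt0 //.
  by apply: lt_le_trans (fbig i); rewrite divr_gt0.
have [b hb] := choice (fun ij : I * I => dual_relation (pL ij.1) (pL ij.2)
  (p0 ij.2) (gB ij.1) (gB ij.2) (gv ij.1) (gv ij.2)).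
(* Both relations are evaluated at [u p_i], where [fne] ensures that nothing vanishes. *)
have b1 i j : b (i, j) * b (j, i) = 1.
  have h1 := hb (j, i) (u * p i); have h2 := hb (i, j) (u * p i).
  by apply: (mulIf (fne i)); rewrite mul1r -mulrA /f -h1 -h2.
pose t i j := modulus (f i (u * p j)) ^+ 2 / ksum (p j).
(* The dual relation at [u p_j], where [f j] is still at least half of its peak
   [sqrt (ksum (p j))]. *)
have tge i j : modulus (b (i, j)) ^+ 2 * (sigma / D i j) ^+ 2 <= 4 * t i j.
  have h : modulus (b (i, j)) * (sigma * (Num.sqrt (ksum (p j)) / 2)) <=
      D i j * modulus (f i (u * p j)).
    apply: (@le_trans _ _ (modulus (u * p j - p i) * modulus (f i (u * p j)))); last first.
      by rewrite ler_wpM2r ?modulus_ge0.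
    rewrite -modulusM (hb (i, j)) /= !modulusM ler_wpM2l ?modulus_ge0 //.
    apply: ler_pM; rewrite ?divr_ge0 ?sqrtr_ge0 ?(ltW s0) //.
    by rewrite -{2}(mul1r (p j)) -mulrBl modulusM.
  have lhs0 : 0 <= modulus (b (i, j)) * (sigma * (Num.sqrt (ksum (p j)) / 2)).
    by rewrite mulr_ge0 ?modulus_ge0 // mulr_ge0 ?(ltW s0) // divr_ge0 ?sqrtr_ge0.
  rewrite -ler_sqr ?nnegrE // in h; last by rewrite mulr_ge0 ?modulus_ge0 ?(ltW (D0 i j)).
  rewrite /t -(sqr_sqrtr (ltW (ksum_gt0 (p j)))).
  have Ks := sqrtK_gt0 (p j); set K := Num.sqrt _ in Ks h *.
  have k1 : 0 < 4 / (D i j ^+ 2 * K ^+ 2) by rewrite divr_gt0 // mulr_gt0 ?exprn_gt0.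
  rewrite -(ler_pM2r k1) in h.
  have Dn : D i j != 0 by rewrite gt_eqF.
  have Kn : K != 0 by rewrite gt_eqF.
  apply: le_trans (_ : _ <= (D i j * modulus (f i (u * p j))) ^+ 2 * (4 / (D i j ^+ 2 * K ^+ 2))) _.
    by apply: le_trans h; rewrite le_eqVlt; apply/orP; left; apply/eqP; field; rewrite Dn Kn.
  by rewrite le_eqVlt; apply/orP; left; apply/eqP; field; rewrite Dn Kn.
(* The rotated dual function has the same coefficient bound [4 / c1], so Bessel applies to its
   values on the chosen points. *)
have tsum i : \sum_j t i j <= c2 * (4 / c1).
  pose A := [fset p j | j in I]%fset.
  have AL : [set` A] `<=` L by move=> z /= /imfsetP[j _ ->].
  have hx l : has_sum_at (fun n => g i n * u ^+ n) l (f i (u * l)).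
    by apply: has_sum_at_rotate; exact: sum_atP (gB i).
  have := bessel AL (sqsum_le_rotate u1 (gB i)) hx.
  by rewrite big_imfset /=; [rewrite big_enum|move=> ? ? _ _; exact: pinj].
pose S := \sum_i \sum_j modulus (b (i, j)) ^+ 2 * (sigma / D i j) ^+ 2.
have S_le : S <= 16 * c2 / c1 * #|I|%:R.
  apply: (@le_trans _ _ (\sum_(i : I) 4 * (c2 * (4 / c1)))).
    apply: ler_sum => i _; apply: le_trans (_ : _ <= 4 * \sum_j t i j) _.
      by rewrite mulr_sumr; apply: ler_sum => j _; exact: tge.
    by rewrite ler_wpM2l.
  rewrite sumr_const -mulr_natr le_eqVlt; apply/orP; left; apply/eqP; field.
  by rewrite gt_eqF.
have S_sym : S = \sum_i \sum_j modulus (b (j, i)) ^+ 2 * (sigma / D i j) ^+ 2.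
  rewrite /S exchange_big /=; apply: eq_bigr => i _; apply: eq_bigr => j _.
  by rewrite Dsym.
apply: le_trans S_le; rewrite -(ler_pM2l (ltr0n _ 2)).
have -> : 2 * S = S + S by ring.
rewrite {2}S_sym /S -big_split /= mulr_sumr; apply: ler_sum => i _.
rewrite -big_split /= mulr_sumr; apply: ler_sum => j _.
rewrite -mulrDl ler_wpM2r ?sqr_ge0 //.
have : modulus (b (i, j)) * modulus (b (j, i)) = 1 by rewrite -modulusM b1 modulus1.
have := sqr_ge0 (modulus (b (i, j)) - modulus (b (j, i))); nra.
Qed.

End RieszSequences.

(** * The logarithmic divergence *)

Section GridCount.
Context {R : realType}.

Definition natdist (i k : nat) : nat := (i - k + (k - i))%N.

Lemma natdistC i k : natdist i k = natdist k i.
Proof. by rewrite /natdist addnC. Qed.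

Lemma natdist_gt0 i k : i != k -> (0 < natdist i k)%N.
Proof. by rewrite /natdist; lia. Qed.

Lemma natdistE i k : (natdist i k)%:R = `|i%:R - k%:R| :> R.
Proof.
wlog ik : i k / (k <= i)%N => [hw|].
  by case: (leqP k i) => [|/ltnW] h; [|rewrite natdistC distrC]; exact: hw.
by rewrite /natdist (eqP ik) addn0 natrB // ger0_norm // subr_ge0 ler_nat.
Qed.

(** From any [i] below [2 h], all distances less than [h] are realized on one side: to the right in
    the first half, to the left in the second. *)
Lemma sum_natdist_ge h (i : 'I_(h + h)) (g : nat -> R) : (forall a, 0 <= g a) ->
  \sum_(a < h) g a <= \sum_(k < h + h) g (natdist i k).
Proof.
move=> g0.
have [f [finj fE]] : exists f : 'I_h -> 'I_(h + h),
    injective f /\ forall a, natdist i (f a) = a.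
  have lt (a : 'I_h) : ((if (i < h)%N then i + a else i - a) < h + h)%N.
    by case: ifP => ih; have := ltn_ord a; have := ltn_ord i; lia.
  exists (fun a => Ordinal (lt a)); split=> [a b /(congr1 val) /= e|a].
    by apply: val_inj => /=; move: e; case: ifP => ih; have := ltn_ord a;
      have := ltn_ord b; lia.
  by rewrite /natdist /=; case: ifP => ih; have := ltn_ord a; lia.
rewrite (eq_bigr (fun a => g (natdist i (f a)))) => [|a _]; last by rewrite fE.
rewrite (eq_bigl (mem [set: 'I_h]%SET)) => [|a]; last by rewrite /= inE.
rewrite -(big_imset (fun k : 'I_(h + h) => g (natdist i k))) /=; last by move=> a b _ _; exact: finj.
rewrite [X in _ <= X](bigID (mem (f @: [set: 'I_h]%SET))) /= lerDl.
by apply: sumr_ge0.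
Qed.

Lemma harmonic_unbounded (B : R) : exists h, B < \sum_(a < h) a.+1%:R^-1.
Proof.
apply: contrapT => hB; apply: (@dvg_harmonic R).
apply: nondecreasing_is_cvgn.
  move=> m n mn; rewrite /series /= (@big_cat_nat _ _ _ m 0 n) //= lerDl.
  by apply: sumr_ge0 => i _; rewrite /harmonic /= invr_ge0.
exists B => _ [h _ <-]; rewrite leNgt; apply/negP => hh; apply: hB; exists h.
by rewrite -(big_mkord predT (fun a => a.+1%:R^-1)).
Qed.

(** In row [a] only the [a + 1] entries with [b <= a] are kept; each is at least
    [1 / (2 (a + 1))^2]. *)
Lemma sum_inv_sqr_ge h :
  4^-1 * \sum_(a < h) a.+1%:R^-1 <= \sum_(a < h) \sum_(b < h) (a + b).+1%:R^-1 ^+ 2 :> R.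
Proof.
rewrite mulr_sumr; apply: ler_sum => a _.
apply: (@le_trans _ _ (\sum_(b < h | (b <= a)%N) (a + b).+1%:R^-1 ^+ 2)); last first.
  rewrite [X in _ <= X](bigID (fun b : 'I_h => (b <= a)%N)) /= lerDl.
  by apply: sumr_ge0 => b _; exact: sqr_ge0.
apply: (@le_trans _ _ (\sum_(b < h | (b <= a)%N) (2 * a.+1%:R)^-1 ^+ 2)); last first.
  apply: ler_sum => b ba; rewrite ler_sqr ?nnegrE ?invr_ge0 ?mulr_ge0 //.
  by rewrite lef_pV2 ?posrE ?mulr_gt0 // -natrM ler_nat; lia.
rewrite sumr_const -[X in _ <= X]mulr_natl.
have -> : #|[pred b : 'I_h | (b <= a)%N]| = a.+1.
  have winj : injective (widen_ord (ltn_ord a)).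
    by move=> x y /(congr1 val) /= /val_inj.
  rewrite -[RHS]card_ord -(card_imset _ winj).
  apply: eq_card => b; rewrite inE; apply/idP/imsetP => [ba|[c _ ->]].
    by exists (Ordinal (ba : (b < a.+1)%N)) => //; exact: val_inj.
  by rewrite -ltnS; exact: ltn_ord c.
rewrite le_eqVlt; apply/orP; left; apply/eqP.
have : a.+1%:R != 0 :> R by rewrite pnatr_eq0.
by move: (a.+1%:R) => x x0; field.
Qed.

Lemma grid_sum_unbounded (B : R) : exists2 m, (0 < m)%N &
  B * (m%:R * m%:R) < \sum_(p : 'I_m * 'I_m) \sum_(q : 'I_m * 'I_m)
    (natdist p.1 q.1 + natdist p.2 q.2).+1%:R^-1 ^+ 2.
Proof.
(* In a grid of side [2 h] every point sees a full quadrant of side [h], worth a quarter of the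
   harmonic sum. *)
have [h hB] := harmonic_unbounded (4 * `|B|).
have h0 : (0 < h)%N.
  by case: h hB => //; rewrite big_ord0 ltNge mulr_ge0.
exists (h + h)%N; first by rewrite addn_gt0 h0.
set m := (h + h)%N.
have lb (p : 'I_m * 'I_m) : 4^-1 * \sum_(a < h) a.+1%:R^-1 <=
    \sum_(q : 'I_m * 'I_m) (natdist p.1 q.1 + natdist p.2 q.2).+1%:R^-1 ^+ 2 :> R.
  apply: le_trans (sum_inv_sqr_ge h) _.
  rewrite -(pair_bigA _ (fun k l : 'I_m => (natdist p.1 k + natdist p.2 l).+1%:R^-1 ^+ 2)) /=.
  apply: le_trans (sum_natdist_ge p.1 (g := fun a => \sum_(b < h) (a + b).+1%:R^-1 ^+ 2) _) _.
    by move=> a; apply: sumr_ge0 => b _; exact: sqr_ge0.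
  apply: ler_sum => k _.
  by apply: (sum_natdist_ge p.2 (g := fun b => (natdist p.1 k + b).+1%:R^-1 ^+ 2)) => b; exact: sqr_ge0.
apply: (@lt_le_trans _ _ (\sum_(p : 'I_m * 'I_m) 4^-1 * \sum_(a < h) a.+1%:R^-1)); last first.
  by apply: ler_sum => p _; exact: lb.
rewrite sumr_const card_prod card_ord -[X in _ < X]mulr_natr natrM.
have m0 : 0 < m%:R * m%:R :> R by rewrite mulr_gt0 // ltr0n addn_gt0 h0.
rewrite ltr_pM2r //.
have := ler_norm B; move: hB; move: (\sum_(_ < _) _) => S; lra.
Qed.

End GridCount.

(** * From estimates on thin annuli to a contradiction *)

Section Contradiction.
Context {R : realType}.
Local Notation C := R[i].

(** Rational parametrization of the circle by the tangent [t] of the half-angle, for which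
    [|u - 1|^2 = 4 t^2 / (1 + t^2)]. *)
Lemma unimodular_ex (t : R) : 0 < t -> t <= 1 ->
  exists u : C, [/\ modulus u = 1, t <= modulus (u - 1) & modulus (u - 1) <= 2 * t].
Proof.
move=> t0 t1; pose d := 1 + t ^+ 2.
have d0 : 0 < d by rewrite ltr_pwDl // sqr_ge0.
have dn : d != 0 by rewrite gt_eqF.
exists (((1 - t ^+ 2) / d) +i* (2 * t / d)).
have mod1 : modulus (((1 - t ^+ 2) / d) +i* (2 * t / d)) = 1 :> R.
  apply/eqP; rewrite -(eqrXn2 (n := 2)) // ?modulus_ge0 //; apply/eqP.
  by rewrite modulus_sqr /= expr1n /d; field.
have mod2 : modulus (((1 - t ^+ 2) / d) +i* (2 * t / d) - 1) ^+ 2 = 4 * t ^+ 2 / d.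
  by rewrite modulus_sqr /= /d; field.
split => //.
  rewrite -ler_sqr ?nnegrE ?modulus_ge0 ?(ltW t0) // mod2 ler_pdivlMr // /d.
  have := sqr_ge0 t; have : t ^+ 2 <= 1 by rewrite expr_le1 // ltW.
  by rewrite mulrDr mulr1 => h1 h2; have := ler_wpM2l h2 h1; lra.
rewrite -ler_sqr ?nnegrE ?modulus_ge0 ?mulr_ge0 ?(ltW t0) // mod2 ler_pdivrMr //.
rewrite exprMn /d; have := sqr_ge0 t; have := mulr_ge0 (sqr_ge0 t) (sqr_ge0 t); lra.
Qed.

(** An approximate eigenvector: multiplication by the variable acts on [x] as the scalar [z], with
    relative error [sqrt T]. *)
Definition localized (s : nat -> R) (T : R) (z : C) := exists n x,
  [/\ forall i, (n <= i)%N -> x i = 0, 0 < \sum_(i < n) modulus (x i) ^+ 2 &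
    \sum_(i < n.+1) modulus (shift_mul s z x i) ^+ 2 <=
      T * modulus z ^+ 2 * \sum_(i < n) modulus (x i) ^+ 2].

(** The weight enters only through the last hypothesis: annuli of arbitrarily large width, measured
    in units of [rho], with uniform variance and localization at the scale [rho]. *)
Theorem no_riesz_sequence (s : nat -> R) (L : set C) (c1 c2 V T : R) :
  (forall n, 0 < s n) ->
  (forall B : R, exists N, forall n, (N <= n)%N -> B * s n <= s n.+1) ->
  0 < c1 -> 0 < c2 -> 0 < V -> 0 < T ->
  (forall A a B, [set` A] `<=` L -> sqsum_le (kcomb s A a) B ->
     c1 * (\sum_(l <- A) modulus (a l) ^+ 2) <= B) ->
  (forall A a, [set` A] `<=` L ->
     sqsum_le (kcomb s A a) (c2 * (\sum_(l <- A) modulus (a l) ^+ 2))) ->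
  (forall n (e : R), 0 < e -> exists A a, [set` A] `<=` L /\
     sqsum_le (fun i => (i == n)%:R - kcomb s A a i) e) ->
  (forall W e : R, 0 < W -> 0 < e -> exists rho r, [/\ 0 < rho, rho < e, 0 < r &
     forall z, r <= modulus z -> modulus z <= r * (1 + W * rho) ->
       variance_le s (V / rho ^+ 2) z /\ localized s (T * rho ^+ 2) z]) ->
  False.
Proof.
move=> s0 sr c10 c20 V0 T0 lower upper dense region.
(* Large enough that [c1 A^2 > 4 c2 T], so that a disc of radius [A rho |w|] free of points of [L]
   contradicts [no_gap]. *)
pose A := 1 + 4 * c2 * T / c1.
have A1 : 1 <= A by rewrite lerDl divr_ge0 ?mulr_ge0 ?ltW.
have A0 : 0 < A by lra.
have AE : c1 * A = c1 + 4 * c2 * T by rewrite /A; field; rewrite gt_eqF.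
clearbody A.
(* The rotation will satisfy [|u - 1| <= 2 k rho]; the smallness required by [family_bound] then
   reads [64 V k^2 / c1 <= 1]. *)
pose k := (1 + 64 * V / c1)^-1.
have kd : 0 < 1 + 64 * V / c1 by rewrite ltr_pwDl // divr_ge0 ?mulr_ge0 ?ltW.
have k0 : 0 < k by rewrite invr_gt0.
have k1 : k <= 1 by rewrite invf_le1 // lerDl divr_ge0 ?mulr_ge0 ?ltW.
have kV : k * (64 * V / c1) <= 1.
  by rewrite mulrC ler_pdivrMr // mul1r lerDr.
clearbody k.
(* [sigma / D] will equal [k / (9 A)] times the inverse of the shifted grid distance; [Cst] is the
   bound of [family_bound] after removing that factor. *)
pose Cst := 16 * c2 / c1 * (9 * A / k) ^+ 2.
have [m m0 hm] := grid_sum_unbounded Cst.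
(* Room for the grid, of extent [10 m A rho], and for the displacement of its points to nearby
   points of [L]. *)
pose W := 5 * A * (2 * m%:R + 3).
have W0 : 0 < W by rewrite mulr_gt0 ?mulr_gt0 // ltr_wpDl // mulr_ge0.
(* Asking for [rho < 1 / W] keeps every modulus in the annulus below [2 r]. *)
have [rho [r [rho0 rhoW r0 hreg]]] := region W (W^-1) W0 ltac:(by rewrite invr_gt0).
have Wrho : W * rho < 1 by rewrite -ltr_pdivlMl // mulr1.
have mR0 : 0 <= m%:R :> R by [].
have Arho : 0 < A * rho by rewrite mulr_gt0.
have rhor : 0 < rho * r by rewrite mulr_gt0.
have near_pt (w : C) : r <= modulus w -> modulus w <= r * (1 + W * rho) ->
    exists l, L l /\ modulus (l - w) < A * rho * modulus w.
  move=> w1 w2; have w0 : 0 < modulus w by exact: lt_le_trans w1.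
  apply: contrapT => hno.
  have [_ [n [x [x0 X0 hY]]]] := hreg w w1 w2.
  have d0 : 0 < A * rho * modulus w by rewrite mulr_gt0.
  have := no_gap s0 sr c10 c20 lower upper dense d0 x0.
  move=> /(_ w) h; have {h}: c1 * (A * rho * modulus w) ^+ 2 * \sum_(i < n) modulus (x i) ^+ 2
      <= 4 * c2 * (T * rho ^+ 2 * modulus w ^+ 2 * \sum_(i < n) modulus (x i) ^+ 2).
    apply: le_trans (h _) _.
      by move=> l Ll; rewrite leNgt; apply/negP => hl; apply: hno; exists l.
    by rewrite ler_pM2l // mulr_gt0.
  set X := \sum_(i < n) _ in X0 *.
  have -> : c1 * (A * rho * modulus w) ^+ 2 * X =
      (c1 * A ^+ 2) * (rho ^+ 2 * modulus w ^+ 2 * X) by ring.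
  have -> : 4 * c2 * (T * rho ^+ 2 * modulus w ^+ 2 * X) =
      (4 * c2 * T) * (rho ^+ 2 * modulus w ^+ 2 * X) by ring.
  rewrite ler_pM2r ?mulr_gt0 ?exprn_gt0 //.
  apply/negP; rewrite -ltNge; apply: (@lt_le_trans _ _ (c1 * A)).
    by rewrite AE ltrDr.
  by rewrite ler_pM2l // expr2 ler_peMl // ltW.
(* The mesh [5 A rho r] exceeds twice the displacement [2 A rho r], so chosen points stay distinct.
   The real index starts at 1 to keep them outside the circle of radius [r]. *)
pose w (p : 'I_m * 'I_m) : C :=
  (r * (1 + 5 * A * rho * p.1.+1%:R)) +i* (r * (5 * A * rho * p.2%:R)).
have ordm (i : 'I_m) : i%:R + 1 <= m%:R :> R by rewrite natr1 ler_nat.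
have w_ge p : r * (1 + 5 * A * rho) <= modulus (w p).
  apply: le_trans (modulus_ge_Re _); rewrite /=.
  apply: le_trans (ler_norm _); rewrite ler_pM2l // lerD2l ler_peMr ?ler1n //.
  by rewrite mulr_ge0 ?ltW // mulr_gt0.
have w_le p : modulus (w p) <= r * (1 + 10 * m%:R * (A * rho)).
  apply: le_trans (modulus_le_ReIm _) _ => /=.
  have a0 : 0 <= p.1%:R :> R by []. have b0 : 0 <= p.2%:R :> R by [].
  rewrite !ger0_norm ?mulr_ge0 ?addr_ge0 ?mulr_ge0 ?(ltW A0) ?(ltW rho0) ?(ltW r0) //.
  rewrite -mulrDr ler_pM2l // -[p.1.+1%:R]natr1.
  have := ordm p.1; have := ordm p.2; move: (p.1%:R) (p.2%:R) (m%:R) => a b c h1 h2.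
  have : A * rho * (a + b + 1) <= A * rho * (2 * c) by rewrite ler_pM2l //; lra.
  by lra.
have WrhoE : W * rho = 10 * m%:R * (A * rho) + 15 * (A * rho) by rewrite /W; ring.
have w_in p : exists l, L l /\ modulus (l - w p) < A * rho * modulus (w p).
  apply: near_pt.
    by apply: le_trans (w_ge p); rewrite ler_peMr ?(ltW r0) //; nra.
  apply: le_trans (w_le p) _; rewrite ler_pM2l // WrhoE; lra.
have [pt hpt] := choice w_in.
have pL p : L (pt p) by case: (hpt p).
have w_2r p : modulus (w p) <= 2 * r.
  apply: le_trans (w_le p) _; rewrite mulrC ler_pM2r //; move: Wrho; rewrite WrhoE; lra.
have pw p : modulus (pt p - w p) < 2 * A * (rho * r).
  case: (hpt p) => _ /lt_le_trans; apply.
  have -> : 2 * A * (rho * r) = A * rho * (2 * r) by ring.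
  by rewrite ler_pM2l.
have wdist p q : modulus (w p - w q) <=
    5 * A * (rho * r) * ((natdist p.1 q.1)%:R + (natdist p.2 q.2)%:R).
  apply: le_trans (modulus_le_ReIm _) _ => /=; rewrite !natdistE.
  have -> : r * (1 + 5 * A * rho * p.1.+1%:R) - r * (1 + 5 * A * rho * q.1.+1%:R) =
     5 * A * (rho * r) * (p.1%:R - q.1%:R) by rewrite -!natr1; ring.
  have -> : r * (5 * A * rho * p.2%:R) - r * (5 * A * rho * q.2%:R) =
     5 * A * (rho * r) * (p.2%:R - q.2%:R) by ring.
  have c0 : 0 <= 5 * A * (rho * r) by rewrite ltW // mulr_gt0 // mulr_gt0.
  by rewrite !(normrM (5 * A * (rho * r))) !(ger0_norm c0) -mulrDr.
have wdist_ge p q : p != q -> 5 * A * (rho * r) <= modulus (w p - w q).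
  have c0 : 0 <= 5 * A * (rho * r) by rewrite ltW // mulr_gt0 // mulr_gt0.
  have eR : complex.Re (w p - w q) = 5 * A * (rho * r) * (p.1%:R - q.1%:R).
    by rewrite /= -!natr1; ring.
  have eI : complex.Im (w p - w q) = 5 * A * (rho * r) * (p.2%:R - q.2%:R).
    by rewrite /=; ring.
  move: (5 * A * (rho * r)) c0 eR eI => c c0 eR eI.
  have dist1 i j : (i != j)%N -> c <= `|c * (i%:R - j%:R)|.
    by move=> ij; rewrite normrM (ger0_norm c0) -natdistE ler_peMr // ler1n natdist_gt0.
  move=> pq; have [e1|e1] := eqVneq p.1 q.1.
    have e2 : p.2 != q.2.
      by apply: contraNneq pq => e2; rewrite [p]surjective_pairing e1 e2 -surjective_pairing.
    by apply: le_trans (modulus_ge_Im _); rewrite eI; exact: dist1.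
  by apply: le_trans (modulus_ge_Re _); rewrite eR; exact: dist1.
have ptinj : injective pt.
  move=> p q e; apply/eqP; apply: contraT => /wdist_ge h.
  have h1 := pw p; have h2 := pw q.
  have := modulus_tri (w p) (pt p) (w q); rewrite {2}e (modulusBC (w p) (pt p)).
  have : 0 < A * (rho * r) by rewrite mulr_gt0.
  lra.
have pt_ge p : r <= modulus (pt p).
  have h3 : modulus (w p) - modulus (pt p) <= modulus (pt p - w p).
    by apply: le_trans (ler_norm _) _; rewrite distrC; exact: modulus_dist.
  have := pw p; have := w_ge p.
  have : 0 < A * (rho * r) by rewrite mulr_gt0.
  have -> : r * (1 + 5 * A * rho) = r + 5 * (A * (rho * r)) by ring.
  lra.
have pt_le p : modulus (pt p) <= r * (1 + W * rho).
  have h3 : modulus (pt p) - modulus (w p) <= modulus (pt p - w p).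
    by apply: le_trans (ler_norm _) _; exact: modulus_dist.
  have := pw p; have := w_le p.
  have : 0 < A * (rho * r) by rewrite mulr_gt0.
  rewrite WrhoE.
  have -> : r * (1 + 10 * m%:R * (A * rho)) = r + 10 * m%:R * (A * (rho * r)) by ring.
  have -> : r * (1 + (10 * m%:R * (A * rho) + 15 * (A * rho))) =
    r + 10 * m%:R * (A * (rho * r)) + 15 * (A * (rho * r)) by ring.
  lra.
have W1 : 1 <= W by rewrite /W; nra.
have rho1 : rho <= 1.
  by apply: le_trans (ltW Wrho); rewrite ler_peMl // ltW.
have [u [u1 u_ge u_le]] := @unimodular_ex (k * rho)
  ltac:(by rewrite mulr_gt0) ltac:(by rewrite mulr_ile1 // ltW).
(* The rotation contributes at most [4 A rho r], the two displacements [4 A rho r], and the grid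
   [5 A rho r] per unit of distance; 9 covers both 8 and 5. *)
pose D (p q : 'I_m * 'I_m) : R :=
  9 * A * (rho * r) * (natdist p.1 q.1 + natdist p.2 q.2).+1%:R.
have D0 p q : 0 < D p q by rewrite mulr_gt0 // mulr_gt0 // mulr_gt0.
have := @family_bound R s s0 sr L c1 c2 c10 c20 lower upper dense _ pt (V / rho ^+ 2)
  (k * rho * r) D u ptinj pL.
have -> : \sum_i \sum_j (k * rho * r / D i j) ^+ 2 =
  (k / (9 * A)) ^+ 2 * \sum_(p : 'I_m * 'I_m) \sum_(q : 'I_m * 'I_m)
    (natdist p.1 q.1 + natdist p.2 q.2).+1%:R^-1 ^+ 2.
  rewrite mulr_sumr; apply: eq_bigr => p _; rewrite mulr_sumr; apply: eq_bigr => q _.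
  rewrite /D; have : (natdist p.1 q.1 + natdist p.2 q.2).+1%:R != 0 :> R.
    by rewrite pnatr_eq0.
  by move: (_%:R) => t t0; field; rewrite t0 !gt_eqF.
rewrite card_prod card_ord natrM => h.
have {h} : (k / (9 * A)) ^+ 2 * \sum_(p : 'I_m * 'I_m) \sum_(q : 'I_m * 'I_m)
    (natdist p.1 q.1 + natdist p.2 q.2).+1%:R^-1 ^+ 2 <= 16 * c2 / c1 * (m%:R * m%:R).
  apply: h => //.
  - by move=> p; rewrite -modulus_gt0; exact: lt_le_trans (pt_ge p).
  - by move=> p; have [] := hreg (pt p) (pt_ge p) (pt_le p).
  - apply: le_trans kV.
    apply: (@le_trans _ _ (16 / c1 * (V / rho ^+ 2) * (2 * (k * rho)) ^+ 2)).
      have pos : 0 < 16 / c1 * (V / rho ^+ 2).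
        by apply: mulr_gt0; apply: divr_gt0; rewrite ?exprn_gt0.
      rewrite (ler_pM2l pos).
      rewrite ler_sqr ?nnegrE ?modulus_ge0 //.
      by rewrite !mulr_ge0 ?(ltW k0) ?(ltW rho0).
    have -> : 16 / c1 * (V / rho ^+ 2) * (2 * (k * rho)) ^+ 2 = k * (k * (64 * V / c1)).
      by field; rewrite !gt_eqF.
    by rewrite ler_piMl // mulr_ge0 ?(ltW k0) // divr_ge0 ?mulr_ge0 ?ltW.
  - by rewrite mulr_gt0 // mulr_gt0.
  - by move=> p; apply: ler_pM; rewrite ?mulr_ge0 ?(ltW k0) ?(ltW rho0) ?(ltW r0).
  - by move=> p q; rewrite /D (natdistC p.1) (natdistC p.2).
  - move=> p q; rewrite -[u](subrK 1) mulrDl mul1r -addrA.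
    apply: le_trans (modulusD _ _) _; rewrite modulusM.
    have h1 : modulus (u - 1) * modulus (pt q) <= 2 * (k * rho) * (2 * r).
      apply: ler_pM; rewrite ?modulus_ge0 //.
      apply: le_trans (pt_le q) _; rewrite mulrC ler_pM2r //; lra.
    have h2 := modulus_tri (pt q) (w q) (pt p).
    have h3 := modulus_tri (w q) (w p) (pt p).
    have h4 := pw q; have h5 := pw p; have h6 := wdist q p.
    rewrite (modulusBC (w p)) in h3.
    rewrite /D -[(natdist _ _ + _).+1%:R]natr1 natrD.
    rewrite (natdistC q.1) (natdistC q.2) in h6.
    have h7 : 4 * k * (rho * r) <= 4 * A * (rho * r).
      by rewrite ler_pM2r // ler_pM2l //; lra.
    set d := (natdist p.1 q.1)%:R + (natdist p.2 q.2)%:R in h6 *.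
    have d0 : 0 <= d by rewrite addr_ge0.
    have h8 : 0 <= A * (rho * r) * d by rewrite mulr_ge0 // ltW // mulr_gt0.
    have h9 : 0 < A * (rho * r) by rewrite mulr_gt0.
    move: h1 h2 h3 h4 h5 h6 h7 h8 h9; clear.
    lra.
apply/negP; rewrite -ltNge.
have q0 : 0 < (9 * A / k) ^+ 2 by rewrite exprn_gt0 // divr_gt0 // mulr_gt0.
rewrite -(ltr_pM2l q0).
have -> : (9 * A / k) ^+ 2 * (16 * c2 / c1 * (m%:R * m%:R)) = Cst * (m%:R * m%:R).
  by rewrite /Cst; ring.
rewrite [X in _ < X]mulrA -exprMn.
have -> : 9 * A / k * (k / (9 * A)) = 1 by field; rewrite !gt_eqF.
by rewrite expr1n mul1r.
Qed.

End Contradiction.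

(** * Radial moments *)

Section RadialMoments.
Context {R : realType}.
Local Notation mu := (@lebesgue_measure R).
(** [p] is the logarithmic derivative [x h'(x)], that is [psi'] at [ln x]. It is available only for
    [x > 1], where [ln x] is positive, so the integrals near 0 require separate treatment. *)
Variables h p : R -> R.
Hypothesis h_cont : {within `[0, +oo[, continuous h}.
Hypothesis h_derive : forall x : R, 1 < x -> is_derive x 1 h (p x / x).
Hypothesis p_cont : forall x : R, 1 < x -> {for x, continuous p}.

Lemma is_derive_power (n : nat) (x : R) :
  is_derive x 1 (fun x : R => x ^+ n.+1) (n.+1%:R * x ^+ n).
Proof.
have -> : (fun x : R => x ^+ n.+1) = (id : R -> R) ^+ n.+1.
  by apply/funext => y; rewrite exprfctE.
apply: (is_derive_eq (is_deriveX n.+1 (is_derive_id x 1))).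
by rewrite /GRing.scale /= mulr1.
Qed.

(** The odd exponent includes the Jacobian of polar coordinates; absolute values make the function
    even and continuous on the line. *)
Definition radial_moment n (x : R) : R := `|x| ^+ (2 * n).+1 * expR (- h `|x|).

Lemma moment_ge0 n x : 0 <= radial_moment n x.
Proof. by rewrite mulr_ge0 ?exprn_ge0 // expR_ge0. Qed.

Lemma momentS n x : radial_moment n.+1 x = x ^+ 2 * radial_moment n x.
Proof.
rewrite /radial_moment mulrA; congr (_ * _).
by rewrite -(real_normK (num_real x)) -exprD; congr (_ ^+ _); lia.
Qed.

Lemma moment_continuous n : continuous (radial_moment n).
Proof.
move=> x; apply: cvgM; last exact: (continuous_abs_weight h_cont).
elim: (2 * n).+1 => [|m IHm]; first by under eq_fun do rewrite expr0; exact: cvg_cst.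
under eq_fun do rewrite exprS; rewrite exprS; apply: cvgM => //.
exact: (@norm_continuous R R^o).
Qed.

Lemma moment_measurable n (D : set R) : measurable_fun D (radial_moment n).
Proof.
apply: measurable_funTS.
exact: (continuous_measurable_fun (@moment_continuous n)).
Qed.

Lemma moment_integrable n a b : mu.-integrable `[a, b] (EFin \o radial_moment n).
Proof.
apply: continuous_compact_integrable; first exact: segment_compact.
by apply: continuous_subspaceT; exact: moment_continuous.
Qed.

Definition moment_int n a b : R := \int[mu]_(x in `[a, b]) radial_moment n x.

Lemma moment_int_ge0 n a b : 0 <= moment_int n a b.
Proof. by apply: Rintegral_ge0 => x _; exact: moment_ge0. Qed.

(** The factor [x^2 - S^2] kills the boundary term at [S], and its own derivative brings in the
    moment of order [n + 1]. *)
Let prim (S : R) n (x : R) : R := (x ^+ 2 - S ^+ 2) * (x ^+ (2 * n).+2 * expR (- h x)).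

Let prim' (S : R) n (x : R) : R :=
  2 * radial_moment n.+1 x + (x ^+ 2 - S ^+ 2) * radial_moment n x * ((2 * n).+2%:R - p x).

Let prim_derive (S : R) n (x : R) : 1 < x -> is_derive x 1 (prim S n) (prim' S n x).
Proof.
move=> x1; have dh := h_derive x1.
have x0 : 0 < x by lra.
have e1 : is_derive x 1 (fun x : R => x ^+ (2 * n).+2) ((2 * n).+2%:R * x ^+ (2 * n).+1).
  exact: is_derive_power.
have e2 : is_derive x 1 (fun x : R => expR (- h x)) (- (p x / x) * expR (- h x)).
  apply: is_derive_eq.
  by rewrite mulrC.
have e3 : is_derive x 1 (fun x : R => x ^+ 2 - S ^+ 2) (2 * x).
  have e0 := is_deriveB (is_derive_power 1 x) (is_derive_cst (S ^+ 2) x 1).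
  by apply: (is_derive_eq e0); rewrite expr1 subr0.
have e4 := is_deriveM e3 (is_deriveM e1 e2).
apply: (is_derive_eq e4); rewrite /GRing.scale /= /prim' momentS /radial_moment !gtr0_norm //.
rewrite mulrfctE !(exprS x (2 * n).+1); have xn : x != 0 by rewrite gt_eqF.
move: (x ^+ (2 * n).+1) (expR (- h x)) ((2 * n).+2%:R) => X E N.
by field.
Qed.

Let prim'_cont (S : R) n (x : R) : 1 < x -> {for x, continuous (prim' S n)}.
Proof.
move=> x1; apply: cvgD; first by apply: cvgM; [exact: cvg_cst|exact: moment_continuous].
apply: cvgM.
  apply: cvgM; last exact: moment_continuous.
  by apply: cvgB; [apply: exprn_continuous|exact: cvg_cst].
by apply: cvgB; [exact: cvg_cst|exact: p_cont].
Qed.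

Let prim_int S n a b : 1 < a -> a < b ->
  mu.-integrable `[a, b] (EFin \o prim' S n) /\
  \int[mu]_(x in `[a, b]) prim' S n x = prim S n b - prim S n a.
Proof.
move=> a1 ab.
have cont : {within `[a, b], continuous (prim' S n)}.
  apply: continuous_in_subspaceT => x; rewrite inE /= in_itv /= => /andP[ax _].
  by apply: prim'_cont; exact: lt_le_trans ax.
split; first by apply: continuous_compact_integrable => //; exact: segment_compact.
have cprim (x : R) : 1 < x -> {for x, continuous (prim S n)}.
  move=> x1; apply: differentiable_continuous; apply/derivable1_diffP.
  by case: (prim_derive S n x1).
rewrite /Rintegral (continuous_FTC2 (F := prim S n) ab cont) //; first split.
- move=> x; rewrite in_itv /= => /andP[ax _].
  by case: (prim_derive S n (lt_trans a1 ax)).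
- by apply: cvg_at_right_filter; exact: cprim.
- by apply: cvg_at_left_filter; apply: cprim; exact: lt_trans ab.
- move=> x; rewrite in_itv /= => /andP[ax _].
  by have hx := prim_derive S n (lt_trans a1 ax); rewrite derive1E (@derive_val _ _ _ _ _ _ _ hx).
Qed.

Let moment_int_comb n a b (c d : R) :
  mu.-integrable `[a, b] (EFin \o (fun x => c * radial_moment n.+1 x + d * radial_moment n x)) /\
  \int[mu]_(x in `[a, b]) (c * radial_moment n.+1 x + d * radial_moment n x) =
    c * moment_int n.+1 a b + d * moment_int n a b.
Proof.
have i1 m e : mu.-integrable `[a, b] (EFin \o (fun x => e * radial_moment m x)).
  apply: continuous_compact_integrable; first exact: segment_compact.
  apply: continuous_subspaceT => x.
  by apply: cvgM; [exact: cvg_cst|exact: moment_continuous].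
split.
  apply: continuous_compact_integrable; first exact: segment_compact.
  apply: continuous_subspaceT => x.
  by apply: cvgD; (apply: cvgM; [exact: cvg_cst|exact: moment_continuous]).
rewrite RintegralD //; try exact: i1.
by rewrite !RintegralZl //; exact: moment_integrable.
Qed.

(** Beyond [S] the excess of [p] over [2n+2] multiplies the nonnegative [x^2 - S^2], and the
    remaining boundary term at [B] is nonnegative. *)
Lemma moment_int_upper n S B (al : R) : 1 < S -> S < B -> 0 < al ->
  (forall x, S <= x -> (2 * n).+2%:R + al <= p x) ->
  (al - 2) * moment_int n.+1 S B <= al * S ^+ 2 * moment_int n S B.
Proof.
move=> S1 SB al0 hp.
have [i1 e1] := prim_int S n S1 SB.
have [i2 e2] := moment_int_comb n S B (2 - al) (al * S ^+ 2).
have : \int[mu]_(x in `[S, B]) prim' S n x <=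
   \int[mu]_(x in `[S, B]) ((2 - al) * radial_moment n.+1 x + al * S ^+ 2 * radial_moment n x).
  apply: le_Rintegral => // x; rewrite /= in_itv /= => /andP[Sx xB].
  rewrite /prim' momentS; have := hp x Sx; have := moment_ge0 n x.
  have : 0 <= x ^+ 2 - S ^+ 2 by rewrite subr_ge0 ler_sqr ?nnegrE; lra.
  move: (radial_moment n x) (p x) => m px d0 m0 pp.
  have : 0 <= (x ^+ 2 - S ^+ 2) * m * (px - ((2 * n).+2%:R + al)).
    by rewrite !mulr_ge0 // subr_ge0.
  by lra.
rewrite e1 e2 /prim subrr mul0r subr0 => h1.
have : 0 <= (B ^+ 2 - S ^+ 2) * (B ^+ (2 * n).+2 * expR (- h B)).
  apply: mulr_ge0; first by rewrite subr_ge0 ler_sqr ?nnegrE; lra.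
  by rewrite mulr_ge0 ?expR_ge0 // exprn_ge0; lra.
move: h1; move: (B ^+ (2 * n).+2 * expR (- h B)) => X; lra.
Qed.

(** The mirror image on the left of [S], with both signs reversed. The interval starts at 2 because
    [h] is differentiable only beyond 1. *)
Lemma moment_int_lower n S (al : R) : 2 < S -> 0 < al ->
  (forall x, 1 < x -> x <= S -> p x + al <= (2 * n).+2%:R) ->
  al * S ^+ 2 * moment_int n 2 S <= (al + 2) * moment_int n.+1 2 S.
Proof.
move=> S2 al0 hp.
have [i1 e1] := prim_int S n (ltr1n R 2) S2.
have [i2 e2] := moment_int_comb n 2 S (al + 2) (- (al * S ^+ 2)).
have : \int[mu]_(x in `[2, S]) prim' S n x <=
   \int[mu]_(x in `[2, S]) ((al + 2) * radial_moment n.+1 x + - (al * S ^+ 2) * radial_moment n x).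
  apply: le_Rintegral => // x; rewrite /= in_itv /= => /andP[x2 xS].
  have x1 : 1 < x by lra.
  rewrite /prim' momentS; have := hp x x1 xS; have := moment_ge0 n x.
  have : 0 <= S ^+ 2 - x ^+ 2 by rewrite subr_ge0 ler_sqr ?nnegrE; lra.
  move: (radial_moment n x) (p x) => m px d0 m0 pp.
  have : 0 <= (S ^+ 2 - x ^+ 2) * m * ((2 * n).+2%:R - (px + al)).
    by rewrite !mulr_ge0 // subr_ge0.
  by lra.
rewrite e1 e2 /prim subrr mul0r sub0r => h1.
have : 0 <= (S ^+ 2 - 2 ^+ 2) * (2 ^+ (2 * n).+2 * expR (- h 2)).
  apply: mulr_ge0; first by rewrite subr_ge0 ler_sqr ?nnegrE; lra.
  by rewrite mulr_ge0 ?expR_ge0 // exprn_ge0.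
move: h1; move: (2 ^+ (2 * n).+2 * expR (- h 2)) => X; lra.
Qed.

(** The right side does not depend on [B], which is what makes the moments over the half-line
    finite. It comes from integrating the derivative of [x^(2n+2) e^(-h)]. *)
Lemma moment_int_bound n S B : 1 < S -> S < B ->
  (forall x, S <= x -> (2 * n).+2%:R + 1 <= p x) ->
  moment_int n S B <= S ^+ (2 * n).+2 * expR (- h S).
Proof.
move=> S1 SB hp.
pose P (x : R) : R := x ^+ (2 * n).+2 * expR (- h x).
pose P' (x : R) : R := radial_moment n x * ((2 * n).+2%:R - p x).
have dP (x : R) : 1 < x -> is_derive x 1 P (P' x).
  move=> x1; have dh := h_derive x1.
  have e1 : is_derive x 1 (fun x : R => x ^+ (2 * n).+2) ((2 * n).+2%:R * x ^+ (2 * n).+1).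
    exact: is_derive_power.
  have e2 : is_derive x 1 (fun x : R => expR (- h x)) (- (p x / x) * expR (- h x)).
    apply: is_derive_eq.
    by rewrite mulrC.
  have e4 := is_deriveM e1 e2.
  apply: (is_derive_eq e4); rewrite /GRing.scale /= /P' /radial_moment gtr0_norm; last by lra.
  rewrite (exprS x (2 * n).+1); have xn : x != 0 by rewrite gt_eqF //; lra.
  by move: (x ^+ (2 * n).+1) (expR (- h x)) ((2 * n).+2%:R) => X E N; field.
have cP' (x : R) : 1 < x -> {for x, continuous P'}.
  move=> x1; apply: cvgM; first exact: moment_continuous.
  by apply: cvgB; [exact: cvg_cst|exact: p_cont].
have cont : {within `[S, B], continuous P'}.
  apply: continuous_in_subspaceT => x; rewrite inE /= in_itv /= => /andP[ax _].
  by apply: cP'; exact: lt_le_trans ax.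
have cP (x : R) : 1 < x -> {for x, continuous P}.
  move=> x1; apply: differentiable_continuous; apply/derivable1_diffP.
  by case: (dP x x1).
have iP' : mu.-integrable `[S, B] (EFin \o P').
  by apply: continuous_compact_integrable => //; exact: segment_compact.
have e1 : \int[mu]_(x in `[S, B]) P' x = P B - P S.
  rewrite /Rintegral (continuous_FTC2 (F := P) SB cont) //; first split.
  - move=> x; rewrite in_itv /= => /andP[ax _].
    by case: (dP _ (lt_trans S1 ax)).
  - by apply: cvg_at_right_filter; exact: cP.
  - by apply: cvg_at_left_filter; apply: cP; exact: lt_trans SB.
  - move=> x; rewrite in_itv /= => /andP[ax _].
    by have hx := dP _ (lt_trans S1 ax); rewrite derive1E (@derive_val _ _ _ _ _ _ _ hx).
have : \int[mu]_(x in `[S, B]) P' x <= \int[mu]_(x in `[S, B]) (-1 * radial_moment n x).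
  apply: le_Rintegral => //.
    apply: continuous_compact_integrable; first exact: segment_compact.
    apply: continuous_subspaceT => x.
    by apply: cvgM; [exact: cvg_cst|exact: moment_continuous].
  move=> x; rewrite /= in_itv /= => /andP[Sx xB].
  by rewrite /P'; have := hp x Sx; have := moment_ge0 n x; nra.
rewrite RintegralZl //; last exact: moment_integrable.
rewrite e1 -/(moment_int n S B) -/(P S) => h1.
have : 0 <= P B by rewrite mulr_ge0 ?expR_ge0 // exprn_ge0; lra.
lra.
Qed.

End RadialMoments.

(** * Moments over the whole half-line *)

Section GlobalMoments.
Context {R : realType}.
Local Notation mu := (@lebesgue_measure R).
Variables h p : R -> R.
Hypothesis h_cont : {within `[0, +oo[, continuous h}.
Hypothesis h_derive : forall x : R, 1 < x -> is_derive x 1 h (p x / x).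
Hypothesis p_cont : forall x : R, 1 < x -> {for x, continuous p}.
Hypothesis p_top : forall B : R, exists2 S : R, 2 < S & forall x : R, S <= x -> B <= p x.

Local Notation moment := (radial_moment h).
Local Notation moment_int := (moment_int h).

Lemma exists_natr_gt (x : R) : exists k : nat, x < k%:R.
Proof.
exists (Num.bound `|x|).
exact: le_lt_trans (ler_norm x) (archi_boundP (normr_ge0 x)).
Qed.

Lemma Rintegral_itv_cst (a b c : R) : a < b ->
  \int[mu]_(x in `[a, b]) cst c x = (b - a) * c.
Proof.
move=> ab; rewrite Rintegral_cst //=.
have -> : lebesgue_measure `[a, b]%classic = (b - a)%:E.
  by rewrite lebesgue_measure_itv /= lte_fin ab -EFinB.
by rewrite mulrC.
Qed.

Lemma moment_int_split n a b c : a <= b -> b <= c ->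
  moment_int n a c = moment_int n a b + moment_int n b c.
Proof.
move=> ab bc; have hi := moment_integrable h_cont n a c.
have := Rintegral_itvB (a := BLeft a) (b := BRight c) (x := b) hi.
rewrite !bnd_simp => /(_ ab bc) e.
rewrite -[LHS](subrK (moment_int n a b)) addrC; congr (_ + _).
rewrite /moment_int e Rintegral_itv_obnd_cbnd //.
apply: integrableS (moment_integrable h_cont n b c) => //.
by apply: subset_itvr; rewrite bnd_simp.
Qed.

Lemma moment_int_le n a b c : a <= b -> b <= c -> moment_int n a b <= moment_int n a c.
Proof. by move=> ab bc; rewrite (moment_int_split n ab bc) lerDl moment_int_ge0. Qed.

Lemma moment_int_momentS_le n a b : 0 <= a -> a <= b ->
  moment_int n.+1 a b <= b ^+ 2 * moment_int n a b.
Proof.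
move=> a0 ab; rewrite /moment_int -RintegralZl //; last exact: moment_integrable.
apply: le_Rintegral => //; first exact: moment_integrable.
  apply: continuous_compact_integrable; first exact: segment_compact.
  apply: continuous_subspaceT => x.
  by apply: cvgM; [exact: cvg_cst|exact: moment_continuous].
move=> x; rewrite /= in_itv /= => /andP[ax xb]; rewrite momentS.
rewrite ler_wpM2r ?moment_ge0 // ler_sqr ?nnegrE //; lra.
Qed.

Lemma moment_int_momentS_ge n a b : 0 <= a ->
  a ^+ 2 * moment_int n a b <= moment_int n.+1 a b.
Proof.
move=> a0; rewrite /moment_int -RintegralZl //; last exact: moment_integrable.
apply: le_Rintegral => //; last 2 first.
- exact: moment_integrable.
- move=> x; rewrite /= in_itv /= => /andP[ax xb]; rewrite momentS.
  rewrite ler_wpM2r ?moment_ge0 // ler_sqr ?nnegrE //; lra.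
apply: continuous_compact_integrable; first exact: segment_compact.
apply: continuous_subspaceT => x.
by apply: cvgM; [exact: cvg_cst|exact: moment_continuous].
Qed.

Definition gmoment n : R := limn (fun k => moment_int n 0 k%:R).

Let J_nd n : nondecreasing_seq (fun k => moment_int n 0 k%:R).
Proof. by move=> k l kl; apply: moment_int_le; rewrite ?ler_nat. Qed.

Lemma moment_int_bounded n : exists B, forall k, moment_int n 0 k <= B.
Proof.
have [S S2 hS] := p_top ((2 * n).+2%:R + 1).
exists (moment_int n 0 S + S ^+ (2 * n).+2 * expR (- h S)) => k.
have S0 : 0 <= S by lra.
have e0 : 0 <= S ^+ (2 * n).+2 * expR (- h S).
  by rewrite mulr_ge0 ?expR_ge0 // exprn_ge0.
have [kS|Sk] := leP k S.
  have [k0|k0] := leP 0 k.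
    by apply: le_trans (moment_int_le n k0 kS) _; rewrite lerDl.
  rewrite /moment_int [X in Rintegral _ X]set_itv_ge ?Rintegral_set0; last first.
    by rewrite bnd_simp -ltNge.
  by rewrite addr_ge0 // Rintegral_ge0 // => x _; exact: moment_ge0.
rewrite (moment_int_split n S0 (ltW Sk)) lerD2l.
by apply: (moment_int_bound h_cont h_derive p_cont) => //; lra.
Qed.

Lemma gmoment_cvg n : (moment_int n 0 k%:R) @[k --> \oo] --> gmoment n.
Proof.
have [B hB] := moment_int_bounded n.
by apply: nondecreasing_is_cvgn => //; exists B => _ [k _ <-].
Qed.

Lemma gmoment_ub n b : moment_int n 0 b <= gmoment n.
Proof.
have [k /ltW bk] := exists_natr_gt b.
apply: (@le_trans _ _ (moment_int n 0 k%:R)).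
  have [b0|b0] := leP 0 b; first exact: moment_int_le.
  rewrite {1}/moment_int [X in Rintegral _ X]set_itv_ge ?Rintegral_set0 ?moment_int_ge0 //.
  by rewrite bnd_simp -ltNge.
by apply: nondecreasing_cvgn_le; [exact: J_nd|exact: gmoment_cvg].
Qed.

Lemma gmoment_lin_le (c d : R) n m : (\forall k \near \oo,
  c * moment_int n 0 k%:R <= d * moment_int m 0 k%:R) -> c * gmoment n <= d * gmoment m.
Proof.
move=> hk; apply: (ler_cvg_to _ _ hk).
- by apply: cvgM; [exact: cvg_cst|exact: gmoment_cvg].
- by apply: cvgM; [exact: cvg_cst|exact: gmoment_cvg].
Qed.

(** Below [S] the inequality [x^2 <= S^2] suffices; beyond [S] it is [moment_int_upper]. *)
Lemma gmoment_upper n S al : 1 < S -> 2 <= al ->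
  (forall x, S <= x -> (2 * n).+2%:R + al <= p x) ->
  (al - 2) * gmoment n.+1 <= al * S ^+ 2 * gmoment n.
Proof.
move=> S1 al2 hp; apply: gmoment_lin_le.
have S0 : 0 <= S by lra.
have [k0 Sk0] := exists_natr_gt S.
exists k0 => // k /= k0k.
have Sk : S < k%:R by apply: lt_le_trans Sk0 _; rewrite ler_nat.
rewrite !(moment_int_split _ S0 (ltW Sk)) !mulrDr; apply: lerD; last first.
  by apply: (moment_int_upper h_cont h_derive p_cont) => //; lra.
have h1 := moment_int_momentS_le n (lexx 0) S0.
have h2 := moment_int_ge0 h n 0 S.
have h3 : 0 <= S ^+ 2 * moment_int n 0 S by rewrite mulr_ge0 // sqr_ge0.
have h4 : (al - 2) * moment_int n.+1 0 S <= (al - 2) * (S ^+ 2 * moment_int n 0 S).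
  by rewrite ler_wpM2l // subr_ge0.
lra.
Qed.

(** Bernoulli's inequality for [6/5], squared, since [(6/5)^2 <= 3/2]. *)
Lemma expr32_ge (N : nat) : 25^-1 * N.+1%:R ^+ 2 <= (3 / 2) ^+ N :> R.
Proof.
have bern : 5^-1 * N.+1%:R <= (6 / 5) ^+ N :> R.
  elim: N => [|N IHN]; first by rewrite expr0; lra.
  have : 1 <= (6 / 5) ^+ N :> R by apply: exprn_ege1; lra.
  rewrite exprS -(natr1 N.+1); move: IHN.
  move: ((6 / 5) ^+ N) (N.+1%:R) => a b h1 h2; lra.
apply: (@le_trans _ _ ((6 / 5) ^+ N ^+ 2)).
  have -> : 25^-1 * N.+1%:R ^+ 2 = (5^-1 * N.+1%:R) ^+ 2 :> R by rewrite exprMn; congr (_ * _); field.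
  by rewrite ler_sqr ?nnegrE ?mulr_ge0 ?exprn_ge0 //; lra.
rewrite -exprM mulnC exprM; apply: lerXn2r; rewrite ?nnegrE; lra.
Qed.

(** On [[0, 2]] the integrand is at most a constant times [2^(2n+1)], on [[3, 4]] at least a
    constant times [3^(2n+1)]. So the interval that integration by parts does not reach is
    negligible, even against the factor [2n+2]. *)
Lemma gmoment_tail : exists n0, forall n, (n0 <= n)%N ->
  (2 * n).+2%:R * moment_int n 0 2 <= moment_int n 0 4.
Proof.
have [E hE] : exists E : R, forall x, 0 <= x -> x <= 2 -> expR (- h x) <= E.
  have [c _ hc] := @EVT_max R (fun x => expR (- h `|x|)) 0 2 (ler0n _ 2)
    (continuous_subspaceT (continuous_abs_weight h_cont)).
  exists (expR (- h `|c|)) => x x0 x2; have := hc x; rewrite ger0_norm //; apply.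
  by rewrite in_itv /= x0.
have [c c0 hc] : exists2 c : R, 0 < c & forall x, 3 <= x -> x <= 4 -> c <= expR (- h x).
  have l34 : 3 <= 4 :> R by lra.
  have [c _ hc] := @EVT_min R (fun x => expR (- h `|x|)) 3 4 l34
    (continuous_subspaceT (continuous_abs_weight h_cont)).
  exists (expR (- h `|c|)); first exact: expR_gt0.
  move=> x x0 x2; have := hc x; rewrite (@ger0_norm _ x); last by lra.
  by apply; rewrite in_itv /= x0.
have E0 : 0 <= E by apply: le_trans (hE 0 _ _); rewrite ?expR_ge0.
(* With [2n+2 >= A], the product [(2n+2) 2 E / c] is at most [(2n+2)^2 / 25], the bound of
   [expr32_ge]. *)
pose A := 50 * E / c; have [k0 Ak] := exists_natr_gt A; exists k0 => n nA.
have low : moment_int n 0 2 <= 2 * (2 ^+ (2 * n).+1 * E).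
  have -> : 2 * (2 ^+ (2 * n).+1 * E) = \int[mu]_(x in `[0, 2]) cst (2 ^+ (2 * n).+1 * E) x.
    by rewrite Rintegral_itv_cst ?subr0.
  apply: le_Rintegral => //; first exact: moment_integrable.
    apply: continuous_compact_integrable; first exact: segment_compact.
    by apply: continuous_subspaceT => x; exact: cvg_cst.
  move=> x; rewrite /= in_itv /= => /andP[x0 x2]; rewrite /radial_moment ger0_norm //.
  apply: ler_pM; rewrite ?exprn_ge0 ?expR_ge0 ?hE //.
  by apply: lerXn2r; rewrite ?nnegrE.
have high : 3 ^+ (2 * n).+1 * c <= moment_int n 0 4.
  apply: (@le_trans _ _ (moment_int n 3 4)); last first.
    rewrite (@moment_int_split n 0 3 4) ?lerDr ?moment_int_ge0 //; lra.
  have -> : 3 ^+ (2 * n).+1 * c = \int[mu]_(x in `[3, 4]) cst (3 ^+ (2 * n).+1 * c) x.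
    rewrite Rintegral_itv_cst; last by lra.
    by rewrite -[LHS]mul1r; congr (_ * _); lra.
  apply: le_Rintegral => //; last 2 first.
  - exact: moment_integrable.
  - move=> x; rewrite /= in_itv /= => /andP[x0 x2]; rewrite /radial_moment ger0_norm; last by lra.
    apply: ler_pM; rewrite ?exprn_ge0 ?(ltW c0) ?hc //.
    by apply: lerXn2r; rewrite ?nnegrE //; lra.
  apply: continuous_compact_integrable; first exact: segment_compact.
  by apply: continuous_subspaceT => x; exact: cvg_cst.
apply: le_trans high; apply: le_trans (ler_wpM2l _ low) _; first exact: ler0n.
set N := (2 * n).+1.
have An : A <= N.+1%:R.
  by apply: le_trans (ltW Ak) _; rewrite ler_nat /N; lia.
have -> : 3 ^+ N = 2 ^+ N * (3 / 2) ^+ N :> R.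
  by rewrite -exprMn; congr (_ ^+ _); field.
have t2 : 0 < 2 ^+ N :> R by rewrite exprn_gt0.
have -> : N.+1%:R * (2 * (2 ^+ N * E)) = 2 ^+ N * (N.+1%:R * (2 * E)) by ring.
rewrite -mulrA ler_pM2l // -ler_pdivrMr //; apply: le_trans (expr32_ge N).
have -> : N.+1%:R * (2 * E) / c = N.+1%:R * (25^-1 * A) by rewrite /A; field; rewrite gt_eqF.
rewrite mulrCA ler_pM2l ?invr_gt0 // expr2 ler_pM2l // ltr0n //.
Qed.

(** [moment_int_lower] covers [[2, S]] and [S^2 <= x^2] covers the rest. The loss from [al] to
    [al - 1] pays for [[0, 2]]: by [gmoment_tail], [al] times its share is at most one full
    moment. *)
Lemma gmoment_lower : exists n0, forall n S al, (n0 <= n)%N -> 2 < S -> 0 < al ->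
  al <= (2 * n).+2%:R ->
  (forall x, 1 < x -> x <= S -> p x + al <= (2 * n).+2%:R) ->
  (al - 1) * S ^+ 2 * gmoment n <= (al + 2) * gmoment n.+1.
Proof.
have [n0 hn0] := gmoment_tail; exists n0 => n S al nn S2 al0 aln hp.
apply: gmoment_lin_le.
have [k0 Sk0] := exists_natr_gt S.
exists (4 + k0)%N => // k /= k0k.
have k4 : 4 <= k%:R :> R by rewrite ler_nat; lia.
have Sk : S < k%:R by apply: lt_le_trans Sk0 _; rewrite ler_nat; lia.
have S0 : 0 <= S by lra.
have z4 : 0 <= 4 :> R by [].
have t1 : al * moment_int n 0 2 <= moment_int n 0 k%:R.
  apply: le_trans (moment_int_le n z4 k4); apply: le_trans (hn0 n nn).
  by rewrite ler_wpM2r // moment_int_ge0.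
have sp m : moment_int m 0 k%:R =
    moment_int m 0 2 + (moment_int m 2 S + moment_int m S k%:R).
  rewrite -moment_int_split ?(ltW S2) ?(ltW Sk) // -moment_int_split //; lra.
have t2 := moment_int_lower h_cont h_derive p_cont S2 al0 hp.
have t3 := moment_int_momentS_ge n k%:R S0.
have t4 := moment_int_ge0 h n.+1 0 2.
have t5 := moment_int_ge0 h n.+1 S k%:R.
have S20 : 0 <= S ^+ 2 by exact: sqr_ge0.
have t6 := ler_wpM2l S20 t1.
have t7 : al * (S ^+ 2 * moment_int n S k%:R) <= al * moment_int n.+1 S k%:R.
  by rewrite ler_pM2l.
have t8 : 0 <= al * moment_int n.+1 0 2 by rewrite mulr_ge0 // ltW.
move: t1 t2 t3 t4 t5 t6 t7 t8; rewrite !sp.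
move: (moment_int n 0 2) (moment_int n 2 S) (moment_int n S k%:R) => a1 a2 a3.
move: (moment_int n.+1 0 2) (moment_int n.+1 2 S) (moment_int n.+1 S k%:R) => b1 b2 b3.
move: (S ^+ 2) => q; lra.
Qed.

Lemma gmoment_gt0 n : 0 < gmoment n.
Proof.
apply: lt_le_trans (gmoment_ub n 2).
have l12 : 1 <= 2 :> R by lra.
have [c _ hc] := @EVT_min R (fun x => expR (- h `|x|)) 1 2 l12
    (continuous_subspaceT (continuous_abs_weight h_cont)).
apply: (@lt_le_trans _ _ (moment_int n 1 2)); last first.
  by rewrite (@moment_int_split n 0 1 2) ?lerDr ?moment_int_ge0 //; lra.
apply: (@lt_le_trans _ _ (expR (- h `|c|))); first exact: expR_gt0.
have -> : expR (- h `|c|) = \int[mu]_(x in `[1, 2]) cst (expR (- h `|c|)) x.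
  rewrite Rintegral_itv_cst; last by lra.
  by rewrite -[LHS]mul1r; congr (_ * _); lra.
apply: le_Rintegral => //; last 2 first.
- exact: moment_integrable.
- move=> x; rewrite /= in_itv /= => /andP[x0 x2]; rewrite /radial_moment.
  rewrite -[X in X <= _]mul1r; apply: ler_pM; rewrite ?ler01 ?expR_ge0 //.
    by apply: exprn_ege1; rewrite ger0_norm //; lra.
  by apply: hc; rewrite in_itv /= x0.
apply: continuous_compact_integrable; first exact: segment_compact.
by apply: continuous_subspaceT => x; exact: cvg_cst.
Qed.

Lemma integral_gmoment n :
  (\int[mu]_(x in `[0%R, +oo[) (moment n x)%:E)%E = (gmoment n)%:E.
Proof.
have cv : (fun k => (moment_int n 0 k%:R)%:E) @ \oo --> (gmoment n)%:E.
  by apply: cvg_EFin; [exact: nearW|exact: gmoment_cvg].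
apply: (cvg_unique _ _ cv) => //.
have cup : \bigcup_k `[0, k%:R]%classic = `[0%R, +oo[%classic :> set R.
  apply/seteqP; split => [x [k _] /=|x /=]; rewrite !in_itv /= andbT.
    by case/andP.
  by move=> x0; have [k xk] := exists_natr_gt x; exists k => //=; rewrite in_itv /= x0 ltW.
have := @ge0_nondecreasing_set_cvg_integral _ (measurableTypeR R) R
  (fun k : nat => `[0, k%:R]%classic : set R)
  (fun x : R => (moment n x)%:E) mu.
rewrite cup => hcv.
have -> : (fun k => (moment_int n 0 k%:R)%:E) =
    (fun k => (\int[mu]_(x in `[0%R, k%:R]) (moment n x)%:E)%E).
  apply/funext => k; rewrite /moment_int /moment_int /Rintegral fineK //.
  by apply: integral_fune_fin_num => //; exact: moment_integrable.
apply: hcv => //.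
- by move=> k l kl; apply/subsetPset; apply: subset_itvl; rewrite bnd_simp ler_nat.
- by move=> k; apply/measurable_EFinP; exact: moment_measurable.
- by move=> k x _; rewrite lee_fin moment_ge0.
Qed.

Lemma fock_sqnorm_monomial n :
  fock_sqnorm h (fun z => z ^+ n) = (2 * pi * gmoment n)%:E.
Proof.
pose f (x : R) : R := `|x| ^+ (2 * n) * expR (- h `|x|).
have cf : continuous f.
  move=> x; apply: cvgM; last exact: (continuous_abs_weight h_cont).
  elim: (2 * n)%N => [|m IHm]; first by under eq_fun do rewrite expr0; exact: cvg_cst.
  under eq_fun do rewrite exprS; rewrite exprS; apply: cvgM => //.
  exact: (@norm_continuous R R^o).
have f0 x : 0 <= f x by rewrite mulr_ge0 ?exprn_ge0 // expR_ge0.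
have -> : fock_sqnorm h (fun z => z ^+ n) =
   (\int[mu \x mu]_p (f (Num.sqrt (p.1 ^+ 2 + p.2 ^+ 2)))%:E)%E.
  apply: eq_integral => q _; congr EFin; rewrite modulusX /f /weight modulus_plane_point.
  by rewrite ger0_norm ?sqrtr_ge0 // -exprM mulnC.
rewrite ge0_integral_polar //; last exact: continuous_measurable_fun.
rewrite integral_oneDsqrV.
have -> : (\int[mu]_x (`|x| * f `|x|)%:E = \int[mu]_x (moment n x)%:E)%E.
  by apply: eq_integral => x _; rewrite /f /radial_moment normr_id mulrA -exprS.
rewrite ge0_symfun_integralT; last 3 first.
- by move=> x; exact: moment_ge0.
- exact: moment_continuous.
- by move=> x; rewrite /= /radial_moment normrN.
rewrite -set_itvcy integral_gmoment -!EFinM; congr EFin; ring.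
Qed.

End GlobalMoments.

(** * Regions of regular growth *)

Section LogScale.
Context {R : realType}.
Implicit Types (f P Q : R -> R).

Lemma has_derivative_on_is_derive f (f' : R -> R) (x : R) :
  has_derivative_on `[0, +oo[ f f' -> 0 < x -> is_derive x 1 f (f' x).
Proof.
move=> hf x0.
have hx : `[0, +oo[%classic x by rewrite /= in_itv /= andbT ltW.
have cv : (h^-1 *: ((f \o shift x) (h *: 1) - f x)) @[h --> (0:R)^'] --> f' x.
  apply/cvgrPdist_lt => e e0.
  have /cvgrPdist_lt /(_ e e0) := hf x hx.
  rewrite near_withinE => /nbhs_ballP[d /= d0 hd].
  apply/nbhs_ballP; exists (Num.min d x) => /=; first by rewrite lt_min d0.
  move=> h; rewrite /ball /= sub0r normrN lt_min => /andP[hd1 hx1] h0.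
  have := hd (h + x); rewrite /ball /= opprD addrCA subrr addr0 normrN => /(_ hd1).
  have -> : (h + x == x) = (h == 0) by rewrite -subr_eq0 addrK.
  move=> /(_ h0); rewrite in_itv /= andbT addrK /GRing.scale /= mulr1 mulrC; apply.
  by have := ler_norm (- h); rewrite normrN; lra.
by apply: DeriveDef; [exact: cvgP cv|exact: cvg_lim cv].
Qed.

Lemma mean_value f (f' : R -> R) (a b : R) : (forall t : R, 0 < t -> is_derive t 1 f (f' t)) ->
  0 < a -> a < b -> exists c, [/\ a < c, c < b & f b - f a = f' c * (b - a)].
Proof.
move=> hf a0 ab.
have hd (x : R) : x \in `]a, b[ -> is_derive x 1 f (f' x).
  by rewrite in_itv /= => /andP[ax _]; apply: hf; exact: lt_trans ax.
have hc : {within `[a, b], continuous f}.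
  apply: continuous_in_subspaceT => x; rewrite inE /= in_itv /= => /andP[ax _].
  apply: differentiable_continuous; apply/derivable1_diffP.
  by case: (hf x (lt_le_trans a0 ax)).
have [c] := MVT ab hd hc.
by rewrite in_itv /= => /andP[ac cb] e; exists c.
Qed.

(** Otherwise each step [t + L / sqrt (Q t)] more than quadruples [Q], so the next step is at most
    half as long. The iterates stay below a finite point while [Q] exceeds every power of 4, against
    monotonicity. *)
Lemma slow_growth_point Q (L T1 B : R) :
  {in `[0, +oo[ &, {homo Q : s t / s <= t}} ->
  (forall B : R, exists S : R, forall t : R, S <= t -> B <= Q t) -> 0 < L ->
  exists t0, [/\ T1 <= t0, B <= Q t0 & Q (t0 + L / Num.sqrt (Q t0)) <= 4 * Q t0].
Proof.
move=> Qmono Qtop L0.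
have {Qmono} Qmono s t : 0 <= s -> s <= t -> Q s <= Q t.
  by move=> s0 st; apply: Qmono; rewrite ?in_itv /= ?andbT // (le_trans s0).
have [S hS] := Qtop (Num.max B 1).
pose t0 := Num.max 0 (Num.max T1 S).
have t00 : 0 <= t0 by rewrite le_max lexx.
have t01 : T1 <= t0 by rewrite !le_max lexx orbT.
have Qbig t : t0 <= t -> B <= Q t /\ 1 <= Q t.
  move=> t0t; have : Num.max B 1 <= Q t.
    by apply: hS; apply: le_trans t0t; rewrite !le_max lexx !orbT.
  by rewrite ge_max => /andP.
clearbody t0; apply: contrapT => hno.
have {}hno t : t0 <= t -> 4 * Q t < Q (t + L / Num.sqrt (Q t)).
  move=> t0t; rewrite ltNge; apply/negP => hle; apply: hno; exists t.
  by split=> //; [exact: le_trans t0t|have [] := Qbig t t0t].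
pose step t := t + L / Num.sqrt (Q t).
pose u j := iter j step t0.
(* Twice the first step bounds the geometric series of all steps; the invariant keeps twice the
   current step in reserve. *)
pose ts := t0 + 2 * (L / Num.sqrt (Q t0)).
have inv j : [/\ t0 <= u j, u j + 2 * (L / Num.sqrt (Q (u j))) <= ts & 4 ^+ j <= Q (u j)].
  elim: j => [|j [h1 h2 h3]].
    by split=> //=; rewrite expr0; have [] := Qbig t0 (lexx _).
  have uS : u j.+1 = u j + L / Num.sqrt (Q (u j)) by [].
  have q1 : 1 <= Q (u j) by have [] := Qbig _ h1.
  have sq0 : 0 < Num.sqrt (Q (u j)) by rewrite sqrtr_gt0; lra.
  have st0 : 0 < L / Num.sqrt (Q (u j)) by rewrite divr_gt0.
  have hq := hno _ h1; rewrite -uS in hq.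
  have sqS : 2 * Num.sqrt (Q (u j)) <= Num.sqrt (Q (u j.+1)).
    have q0 : 0 <= Q (u j) by lra.
    rewrite -(ger0_norm (mulr_ge0 (ler0n R 2) (sqrtr_ge0 (Q (u j))))) -sqrtr_sqr.
    rewrite ler_wsqrtr // exprMn sqr_sqrtr //; lra.
  split.
  - by rewrite uS; lra.
  - have hd : 2 * (L / Num.sqrt (Q (u j.+1))) <= L / Num.sqrt (Q (u j)).
      have -> : 2 * (L / Num.sqrt (Q (u j.+1))) = L / (Num.sqrt (Q (u j.+1)) / 2).
        by field; rewrite gt_eqF //; lra.
      by rewrite ler_pM2l // lef_pV2 ?posrE ?ler_pdivlMr //; lra.
    by apply: le_trans h2; rewrite {1}uS; lra.
  - by rewrite exprS; lra.
have [k hk] := exists_natr_gt (Q ts).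
have [h1 h2 h3] := inv k.
have : Q (u k) <= Q ts.
  apply: Qmono; first lra.
  apply: le_trans h2; rewrite lerDl mulr_ge0 // divr_ge0 ?sqrtr_ge0 // ltW //.
have : k%:R <= 4 ^+ k :> R by rewrite -natrX ler_nat; apply: ltnW; exact: ltn_expl.
lra.
Qed.

(** [P] may decrease at first, but its slope is bounded below and eventually at least 1. Past [T0] a
    bound on [P] over all smaller or all larger arguments can therefore be tested at one point. *)
Lemma eventual_maximum P Q :
  (forall t : R, 0 < t -> is_derive t 1 P (Q t)) ->
  {in `[0, +oo[ &, {homo Q : s t / s <= t}} ->
  (forall B : R, exists S : R, forall t : R, S <= t -> B <= Q t) ->
  (exists2 T0 : R, 1 < T0 & forall T t, T0 <= T -> 0 < t -> t <= T -> P t <= P T) /\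
  (forall B : R, exists2 S : R, 1 < S & forall t : R, S <= t -> B <= P t).
Proof.
move=> dP Qmono Qtop.
have {Qmono} Qmono s t : 0 <= s -> s <= t -> Q s <= Q t.
  by move=> s0 st; apply: Qmono; rewrite ?in_itv /= ?andbT // (le_trans s0).
have [S hS] := Qtop 1.
pose T1 := Num.max 2 S.
have T12 : 2 <= T1 by rewrite le_max lexx.
have Q1 t : T1 <= t -> 1 <= Q t.
  by move=> T1t; apply: hS; apply: le_trans T1t; rewrite le_max lexx orbT.
clearbody T1.
pose c := `|Q 0|.
have c0 : 0 <= c by exact: normr_ge0.
have Qc t : 0 <= t -> - c <= Q t.
  move=> t0; apply: le_trans (Qmono 0 t (lexx _) t0).
  by rewrite lerNl /c -normrN; exact: ler_norm.
clearbody c.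
have grow a b : T1 <= a -> a <= b -> P a + (b - a) <= P b.
  move=> T1a; rewrite le_eqVlt => /orP[/eqP ->|ab]; first by rewrite subrr addr0.
  have a0 : 0 < a by lra.
  have [x [ax xb e]] := mean_value dP a0 ab.
  have q1 : 1 <= Q x by apply: Q1; lra.
  have : 1 * (b - a) <= Q x * (b - a) by rewrite ler_pM2r //; lra.
  rewrite -e; lra.
have cT : 0 <= c * T1 by rewrite mulr_ge0 //; lra.
split.
  (* Before [T1] the drop of [P] is at most [c T1], which slope at least 1 recovers over a length
     [c T1]. *)
  exists (T1 + c * T1); first lra.
  move=> T t hT t0 tT.
  have [T1t|tT1] := leP T1 t; first by have := grow t T T1t tT; lra.
  have [x [ax xb e]] := mean_value dP t0 tT1.
  have q1 : - c <= Q x by apply: Qc; lra.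
  have h1 : - c * (T1 - t) <= Q x * (T1 - t) by rewrite ler_pM2r //; lra.
  have h2 : c * (T1 - t) <= c * T1 by rewrite ler_wpM2l //; lra.
  have h3 := grow T1 T; rewrite -e in h1; lra.
move=> B; exists (T1 + `|B - P T1|); first by have := normr_ge0 (B - P T1); lra.
move=> t ht; have h1 := normr_ge0 (B - P T1); have h2 := ler_norm (B - P T1).
have := grow T1 t; lra.
Qed.

Lemma increment_bounds P Q (t0 b A B : R) :
  (forall t : R, 0 < t -> is_derive t 1 P (Q t)) -> 0 < t0 ->
  (forall t : R, t0 <= t -> t <= b -> A <= Q t /\ Q t <= B) ->
  forall x y : R, t0 <= x -> x <= y -> y <= b ->
    A * (y - x) <= P y - P x /\ P y - P x <= B * (y - x).
Proof.
move=> dP t00 hQ x y tx; rewrite le_eqVlt => /orP[/eqP ->|xy] yb.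
  by rewrite !subrr !mulr0.
have x0 : 0 < x by lra.
have [z [xz zy ->]] := mean_value dP x0 xy.
have tz : t0 <= z by lra.
have zb : z <= b by lra.
by have [h1 h2] := hQ z tz zb; rewrite !ler_pM2r //; lra.
Qed.

End LogScale.

(** * Second moments of sequences with geometric decay *)

Section Sums.
Context {R : realType}.
Implicit Types (b : nat -> R) (rho K : R).

(* Summation by parts: shifting the index costs a factor [1 + rho], so each
   moment is controlled by the lower ones divided by [rho]. *)
Lemma geometric_variance b rho K : (forall i, 0 <= b i) -> 0 < rho -> rho <= 1 ->
  (forall i, (1 + rho) * b i.+1 <= b i) -> (forall M, \sum_(i < M) b i <= K) ->
  forall M, \sum_(i < M) i%:R ^+ 2 * b i <= 3 / rho ^+ 2 * K.
Proof.
move=> b0 r0 r1 hb hK.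
have first M : rho * \sum_(i < M) i%:R * b i <= K.
  have shift : (1 + rho) * \sum_(i < M.+1) i%:R * b i <=
      \sum_(i < M) i%:R * b i + \sum_(i < M) b i.
    rewrite big_ord_recl mul0r add0r mulr_sumr -big_split /=; apply: ler_sum => i _.
    rewrite /bump /= add1n mulrCA -natr1 [X in _ <= X](_ : _ = (i%:R + 1) * b i); last by ring.
    by rewrite ler_wpM2l // addr_ge0.
  have mono : \sum_(i < M) i%:R * b i <= \sum_(i < M.+1) i%:R * b i.
    by rewrite big_ord_recr lerDl mulr_ge0.
  have hM := hK M.
  have := ler_wpM2l (ltW r0) mono; lra.
move=> M.
have shift : (1 + rho) * \sum_(i < M.+1) i%:R ^+ 2 * b i <=
    \sum_(i < M) i%:R ^+ 2 * b i + 2 * \sum_(i < M) i%:R * b i + \sum_(i < M) b i.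
  rewrite big_ord_recl expr0n /= mul0r add0r !mulr_sumr -!big_split /=; apply: ler_sum => i _.
  rewrite /bump /= add1n mulrCA -natr1.
  rewrite [X in _ <= X](_ : _ = (i%:R + 1) ^+ 2 * b i); last by ring.
  by rewrite ler_wpM2l // sqr_ge0.
have mono : \sum_(i < M) i%:R ^+ 2 * b i <= \sum_(i < M.+1) i%:R ^+ 2 * b i.
  by rewrite big_ord_recr lerDl mulr_ge0 // sqr_ge0.
have h1 := ler_wpM2l (ltW r0) mono.
have h2 := first M; have h3 := hK M.
have K0 : 0 <= K by have := hK 0%N; rewrite big_ord0.
have h4 : rho * (rho * \sum_(i < M) i%:R ^+ 2 * b i) <= 3 * K.
  have e : rho * \sum_(i < M) i%:R ^+ 2 * b i <= 2 * \sum_(i < M) i%:R * b i + K by lra.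
  have := ler_wpM2l (ltW r0) e.
  have : rho * K <= 1 * K by rewrite ler_wpM2r.
  lra.
rewrite mulrAC ler_pdivlMr ?exprn_gt0 // mulrC expr2 -mulrA //.
Qed.

(** Truncated subtraction measures the excess beyond the window of radius [m] around [N], on either
    side. *)
Lemma sqr_dist_le (i N m : nat) : (i%:R - N%:R : R) ^+ 2 <=
  2 * m%:R ^+ 2 + 2 * (i - (N + m))%N%:R ^+ 2 + 2 * (N - m - i)%N%:R ^+ 2.
Proof.
have h1 : (i <= N + m + (i - (N + m)))%N by rewrite -leq_subLR.
have h2 : (N <= i + m + (N - m - i))%N by lia.
move: h1 h2; rewrite -!(ler_nat R) !natrD.
move: (i - (N + m))%N (N - m - i)%N => a c.
have := ler0n R m; have := ler0n R a; have := ler0n R c.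
move: i%:R N%:R m%:R a%:R c%:R => i' N' m' a' c' ? ? ? ? ?.
have [s|s] := leP 0 (i' - N').
  have : (i' - N') ^+ 2 <= (m' + a') ^+ 2 by rewrite ler_sqr ?nnegrE; lra.
  have := sqr_ge0 (m' - a'); have := sqr_ge0 c'; nra.
have : (N' - i') ^+ 2 <= (m' + c') ^+ 2 by rewrite ler_sqr ?nnegrE; lra.
have := sqr_ge0 (m' - c'); have := sqr_ge0 a'; nra.
Qed.

(** Inside the window the squared distance is at most [m^2]; outside, each side decays geometrically
    away from it and [geometric_variance] applies, to the left side after reversal. *)
Lemma two_sided_variance b rho K N m : (forall i, 0 <= b i) -> 0 < rho -> rho <= 1 ->
  (forall i, (N + m <= i)%N -> (1 + rho) * b i.+1 <= b i) ->
  (forall i, (i < N - m)%N -> (1 + rho) * b i <= b i.+1) ->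
  (forall M, \sum_(i < M) b i <= K) ->
  forall M, \sum_(i < M) (i%:R - N%:R) ^+ 2 * b i <= (2 * m%:R ^+ 2 + 12 / rho ^+ 2) * K.
Proof.
move=> b0 r0 r1 hu hl hK M.
have mono (F : nat -> R) k : (forall i, 0 <= F i) -> \sum_(i < M) F i <= \sum_(i < k + M) F i.
  by move=> F0; rewrite addnC big_split_ord /= lerDl sumr_ge0.
have up : \sum_(i < M) (i - (N + m))%N%:R ^+ 2 * b i <= 3 / rho ^+ 2 * K.
  apply: le_trans (mono (fun i => (i - (N + m))%N%:R ^+ 2 * b i) (N + m)%N _) _.
    by move=> i; rewrite mulr_ge0 // sqr_ge0.
  rewrite big_split_ord /= big1 ?add0r => [|i _]; last first.
    by rewrite (_ : (i - (N + m))%N = 0%N) ?expr0n ?mul0r //; apply/eqP; rewrite subn_eq0 ltnW.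
  under eq_bigr do rewrite addKn.
  apply: (geometric_variance (b := fun j => b (N + m + j)%N)) => //.
    by move=> j /=; rewrite addnS; apply: hu; exact: leq_addr.
  move=> M'; apply: le_trans (hK (N + m + M')%N).
  by rewrite [leRHS]big_split_ord /= lerDr sumr_ge0.
pose n := (N - m)%N.
(* The left part read backwards from the edge of the window and continued by zero, so that the decay
   hypothesis holds for every index. *)
pose b' j := if (j <= n)%N then b (n - j)%N else 0.
have rev (F : nat -> R) : \sum_(j < n.+1) F (n - j)%N = \sum_(j < n.+1) F j.
  by rewrite [RHS](reindex_inj rev_ord_inj); apply: eq_bigr => j _; rewrite /= subSS.
have low : \sum_(i < M) (n - i)%N%:R ^+ 2 * b i <= 3 / rho ^+ 2 * K.
  apply: le_trans (mono (fun i => (n - i)%N%:R ^+ 2 * b i) n.+1 _) _.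
    by move=> i; rewrite mulr_ge0 // sqr_ge0.
  rewrite big_split_ord /= [X in _ + X]big1 ?addr0 => [|i _]; last first.
    rewrite (_ : (n - (n.+1 + i))%N = 0%N) ?expr0n ?mul0r //; apply/eqP.
    by rewrite subn_eq0 addSn ltnW // ltnS leq_addr.
  rewrite -(rev (fun i => (n - i)%N%:R ^+ 2 * b i)).
  have -> : \sum_(j < n.+1) (n - (n - j))%N%:R ^+ 2 * b (n - j)%N =
      \sum_(j < n.+1) j%:R ^+ 2 * b' j.
    by apply: eq_bigr => j _; rewrite /b' -ltnS ltn_ord subKn // -ltnS.
  apply: geometric_variance => //.
  - by move=> j; rewrite /b'; case: ifP.
  - move=> j; rewrite /b'; case: (leqP j.+1 n) => jn.
      have e : (n - j)%N = (n - j.+1).+1 by rewrite subnSK.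
      rewrite (ltnW jn) e; apply: hl.
      by rewrite -/n ltn_subrL (leq_ltn_trans _ jn).
    by rewrite mulr0; case: ifP.
  - move=> M'; apply: (@le_trans _ _ (\sum_(j < n.+1 + M') b' j)).
      rewrite addnC [leRHS]big_split_ord /= lerDl sumr_ge0 // => j _.
      by rewrite /b'; case: ifP.
    rewrite big_split_ord /= [X in _ + X]big1 ?addr0 => [|i _]; last first.
      by rewrite /b' addSn ltnNge leq_addr.
    apply: le_trans (hK n.+1); rewrite -(rev b).
    by apply: ler_sum => j _; rewrite /b' -ltnS ltn_ord.
have : \sum_(i < M) (i%:R - N%:R) ^+ 2 * b i <= \sum_(i < M)
    (2 * m%:R ^+ 2 * b i + (2 * ((i - (N + m))%N%:R ^+ 2 * b i) + 2 * ((n - i)%N%:R ^+ 2 * b i))).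
  apply: ler_sum => i _; have := ler_wpM2r (b0 i) (sqr_dist_le i N m); rewrite -/n; lra.
rewrite !big_split /= -!mulr_sumr.
have := ler_wpM2l (sqr_ge0 (m%:R : R)) (hK M); have := up; have := low.
rewrite (_ : (2 * m%:R ^+ 2 + 12 / rho ^+ 2) * K =
  2 * (m%:R ^+ 2 * K) + 4 * (3 / rho ^+ 2 * K)); last by ring.
by move: (3 / rho ^+ 2 * K) => X; lra.
Qed.

End Sums.

(** * Variance and approximate eigenvectors from coefficient ratios *)

Section Localization.
Context {R : realType}.
Local Notation C := R[i].

Lemma variance_le_of_ratio (s : nat -> R) (z : C) rho N m :
  (forall n, 0 < s n) -> (forall B : R, exists N, forall n, (N <= n)%N -> B * s n <= s n.+1) ->
  0 < modulus z -> 0 < rho -> rho <= 1 ->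
  (forall i, (N + m <= i)%N -> (1 + rho) * modulus z ^+ 2 * s i ^+ 2 <= s i.+1 ^+ 2) ->
  (forall i, (i < N - m)%N -> (1 + rho) * s i.+1 ^+ 2 <= modulus z ^+ 2 * s i ^+ 2) ->
  variance_le s (2 * m%:R ^+ 2 + 12 / rho ^+ 2) z.
Proof.
move=> s0 sr z0 r0 r1 hu hl; exists N.
have mE i : modulus (monom s i z) ^+ 2 = modulus z ^+ (2 * i) / s i ^+ 2.
  by rewrite modulus_monom // expr_div_n -exprM mulnC.
have s20 i : 0 < s i ^+ 2 by rewrite exprn_gt0.
have z20 i : 0 < modulus z ^+ (2 * i) by rewrite exprn_gt0.
apply: (two_sided_variance (b := fun i => modulus (monom s i z) ^+ 2)) => //.
- by move=> i; exact: sqr_ge0.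
- move=> i hi; rewrite !mE mulnS exprD; have := hu i hi; have := z20 i.
  have := s20 i; have := s20 i.+1.
  move: (s i ^+ 2) (s i.+1 ^+ 2) (modulus z ^+ (2 * i)) (modulus z ^+ 2) => a b c d b0 a0 c0 h.
  rewrite ler_pdivlMr // mulrA mulrAC ler_pdivrMr //.
  have := ler_wpM2l (ltW c0) h; lra.
- move=> i hi; rewrite !mE mulnS exprD; have := hl i hi; have := z20 i.
  have := s20 i; have := s20 i.+1.
  move: (s i ^+ 2) (s i.+1 ^+ 2) (modulus z ^+ (2 * i)) (modulus z ^+ 2) => a b c d b0 a0 c0 h.
  rewrite ler_pdivlMr // mulrA mulrAC ler_pdivrMr //.
  have := ler_wpM2l (ltW c0) h; lra.
- by move=> M; exact: ksum_ub.
Qed.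

(** A tent with integer slopes, of height [2 q], vanishing at [N] and [N + 4 q]; truncated
    subtraction makes it zero outside. *)
Let hat (N q i : nat) : nat := minn (i - N) (N + 4 * q - i).

Let hat_step N q i : hat N q i = hat N q i.+1 \/
  (N <= i)%N /\ (i < N + 4 * q)%N /\ (hat N q i = (hat N q i.+1).+1 \/ (hat N q i).+1 = hat N q i.+1).
Proof. rewrite /hat; lia. Qed.

(** Two errors occur: the slope of the tent, of total square at most [4 q |z|^2], and the deviation
    of [s n.+1 / s n] from [|z|]. The first is small because the tent has squared norm at least
    [2 q^3] and [q] is at least of order [1 / rho]. *)
Lemma localized_of_ratio (s : nat -> R) (z : C) (rho : R) N q :
  0 < modulus z -> 0 < rho -> (0 < q)%N -> 1 <= 16 * rho * q%:R ->
  (forall n, (N <= n)%N -> (n < N + 4 * q)%N ->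
     `|s n.+1 / s n - modulus z| <= 20 * rho * modulus z) ->
  localized s (2000 * rho ^+ 2) z.
Proof.
move=> z0 r0 q0 hq hs.
have zn : z != 0 by rewrite -modulus_gt0.
(* The phases [th^i] turn [z] into its modulus, leaving a real computation with the tent. *)
pose th : C := (modulus z)%:C / z.
have th1 : modulus th = 1.
  by rewrite modulusM modulusV modulus_real gtr0_norm // divff // gt_eqF.
pose c i : R := (hat N q i)%:R.
pose x i : C := th ^+ i * (c i)%:C.
have xm i : modulus (x i) = c i.
  by rewrite modulusM modulusX th1 expr1n mul1r modulus_real ger0_norm.
(* The middle [2 q] indices have height at least [q]. *)
have cge : 2 * q%:R ^+ 3 <= \sum_(i < N + 4 * q) c i ^+ 2.
  have -> : (N + 4 * q = (N + q) + (2 * q + q))%N by lia.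
  rewrite big_split_ord /= [X in _ <= _ + X]big_split_ord /=.
  apply: (@le_trans _ _ (\sum_(j < 2 * q) q%:R ^+ 2)).
    by rewrite sumr_const card_ord -[leRHS]mulr_natl natrM -mulrA -exprS.
  apply: (@le_trans _ _ (\sum_(j < 2 * q) c (N + q + j)%N ^+ 2)).
    apply: ler_sum => j _; rewrite ler_sqr ?nnegrE // ler_nat /hat; have := ltn_ord j; lia.
  rewrite -[leLHS]add0r; apply: lerD; first by apply: sumr_ge0 => i _; exact: sqr_ge0.
  by rewrite lerDl; apply: sumr_ge0 => i _; exact: sqr_ge0.
have qp : 0 < q%:R :> R by rewrite ltr0n.
exists (N + 4 * q)%N, x; split.
- move=> i hi; rewrite /x /c (_ : hat N q i = 0%N) ?mulr0 // /hat; lia.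
- under eq_bigr do rewrite xm.
  by apply: lt_le_trans cge; rewrite mulr_gt0 // exprn_gt0.
rewrite big_ord_recl /=.
have -> : modulus (0 - z * x 0%N) ^+ 2 = 0.
  rewrite /x /c (_ : hat N q 0 = 0%N); last by rewrite /hat sub0n min0n.
  by rewrite !mulr0 subr0 modulus0 expr0n.
rewrite add0r; under [X in _ <= _ * X]eq_bigr do rewrite xm.
pose d i : R := if (N <= i)%N then 1 else 0.
have step (i : 'I_(N + 4 * q)) : modulus (shift_mul s z x (bump 0 i)) ^+ 2 <=
    2 * modulus z ^+ 2 * (d i + 400 * rho ^+ 2 * c i ^+ 2).
  rewrite /bump /= add1n /shift_mul.
  have -> : x i * (s i.+1 / s i)%:C - z * x i.+1 =
      th ^+ i * (s i.+1 / s i * c i - modulus z * c i.+1)%:C.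
    have e : z * th = (modulus z)%:C by rewrite mulrC divfK.
    rewrite /x exprSr rmorphB !rmorphM /= -e; ring.
  rewrite modulusM modulusX th1 expr1n mul1r modulus_real real_normK ?num_real //.
  have h1 : (c i - c i.+1) ^+ 2 <= d i.
    rewrite /c /d; have [->|[-> [_ [->|<-]]]] := hat_step N q i.
    - by rewrite subrr expr0n; case: ifP.
    - by rewrite -natr1 addrAC subrr add0r expr1n.
    - by rewrite -natr1 opprD addrA subrr sub0r sqrrN expr1n.
  have h2 : ((s i.+1 / s i - modulus z) * c i) ^+ 2 <= 400 * rho ^+ 2 * modulus z ^+ 2 * c i ^+ 2.
    have [Ni|iN] := leqP N i; last first.
      by rewrite /c (_ : hat N q i = 0%N) ?mulr0 ?expr0n ?mulr0 // /hat; lia.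
    rewrite exprMn ler_wpM2r ?sqr_ge0 //.
    rewrite -(real_normK (num_real _)) (_ : _ * _ * _ = (20 * rho * modulus z) ^+ 2); last by ring.
    rewrite ler_sqr ?nnegrE ?hs // !mulr_ge0 ?ltW //.
  have -> : s i.+1 / s i * c i - modulus z * c i.+1 =
    (s i.+1 / s i - modulus z) * c i + modulus z * (c i - c i.+1) by ring.
  have h3 := ler_wpM2l (sqr_ge0 (modulus z)) h1.
  move: h2 h3; move: ((s i.+1 / s i - modulus z) * c i) => u.
  have := sqr_ge0 (u - modulus z * (c i - c i.+1)).
  by nra.
apply: le_trans (ler_sum _ (fun i _ => step i)) _.
rewrite -mulr_sumr big_split /= -mulr_sumr.
have -> : \sum_(i < N + 4 * q) d i = 4 * q%:R.
  rewrite big_split_ord /= big1 ?add0r => [|i _]; last by rewrite /d leqNgt ltn_ord.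
  under eq_bigr do rewrite /d leq_addr.
  by rewrite sumr_const card_ord -natrM.
move: cge; move: (\sum_(i < _) _) => S cge.
have z2 : 0 < modulus z ^+ 2 by rewrite exprn_gt0.
(* From [1 <= 256 rho^2 q^2] and [S >= 2 q^3]. With the 400 from the ratios, 912 stays below 1000,
   hence the constant 2000. *)
have h : 4 * q%:R <= 512 * rho ^+ 2 * S.
  have h1 : 1 <= (16 * rho * q%:R) ^+ 2 by rewrite expr_ge1 ?mulr_ge0 // ltW.
  have h2 : 0 <= 512 * rho ^+ 2 by rewrite mulr_ge0 ?ler0n ?sqr_ge0.
  have := ler_wpM2l h2 cge; have := ler_wpM2l (ltW qp) h1; rewrite !exprS expr0; lra.
rewrite (_ : 2000 * _ * _ * _ = 2 * modulus z ^+ 2 * (1000 * rho ^+ 2 * S)); last by ring.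
rewrite ler_wpM2l //; first by rewrite mulr_ge0 // ltW.
have S0 : 0 <= S by apply: le_trans cge; rewrite mulr_ge0 ?exprn_ge0.
have : 0 <= rho ^+ 2 * S by rewrite mulr_ge0 ?sqr_ge0.
lra.
Qed.

End Localization.

Section RegionArithmetic.
Context {R : realType}.
Lemma near_of_sqr (x y e : R) : 0 < y -> 0 <= x -> 0 <= e -> e <= 1 ->
  x ^+ 2 <= (1 + e) * y ^+ 2 -> (1 - e) * y ^+ 2 <= x ^+ 2 -> `|x - y| <= e * y.
Proof.
move=> y0 x0 e0 e1 h1 h2; rewrite ler_distl; apply/andP; split.
  rewrite -(ler_sqr (_ : _ \is Num.nneg) (_ : x \is Num.nneg)) ?nnegrE //; last first.
    by rewrite -[X in X - _]mul1r -mulrBl mulr_ge0 ?(ltW y0) // subr_ge0.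
  apply: le_trans h2; rewrite (_ : (y - e * y) ^+ 2 = (1 - e) ^+ 2 * y ^+ 2); last by ring.
  rewrite ler_wpM2r ?sqr_ge0 //; nra.
have ey : 0 <= e * y by rewrite mulr_ge0 // ltW.
rewrite -(ler_sqr (_ : x \is Num.nneg) (_ : _ \is Num.nneg)) ?nnegrE //; last by lra.
apply: le_trans h1 _; rewrite (_ : (y + e * y) ^+ 2 = (1 + e) ^+ 2 * y ^+ 2); last by ring.
rewrite ler_wpM2r ?sqr_ge0 //; nra.
Qed.

(** Converts the moment inequalities at [al = 1 / rho] into ratio bounds. [E] stands for [|z|^2],
    [g] and [g'] for consecutive moments, [x] and [y] for the exponentials of [expR_bounds]. The
    first two parts give decay at rate [1 + rho] away from the centre, the last two a ratio within
    [20 rho] of [E]. *)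
Lemma ratio_arith (rho al : R) : 0 < rho -> rho <= 20^-1 -> rho * al = 1 ->
  [/\ forall E x g g', 0 <= E -> 0 <= g -> 1 + 6 * rho <= x ->
        (al - 1) * (E * x) * g <= (al + 2) * g' -> (1 + rho) * E * g <= g',
      forall E y g g', 0 <= E -> 0 <= g -> 0 <= g' -> y * (1 + 6 * rho) <= 1 ->
        (al - 2) * g' <= al * (E * y) * g -> (1 + rho) * g' <= E * g,
      forall E x g g', 0 <= E -> 0 <= g -> 0 <= g' -> x * (1 - 6 * rho) <= 1 ->
        (al - 2) * g' <= al * (E * x) * g -> g' <= (1 + 20 * rho) * (E * g) &
      forall E y g g', 0 <= E -> 0 <= g -> 1 - 2 * rho <= y ->
        (al - 1) * (E * y) * g <= (al + 2) * g' -> (1 - 20 * rho) * (E * g) <= g'].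
Proof.
move=> r0 r20 ral; have r1 : 0 <= 1 - rho by lra.
have sq : rho ^+ 2 <= 20^-1 * rho by rewrite expr2 ler_wpM2r // ltW.
have cu : 0 <= rho ^+ 3 by rewrite exprn_ge0 // ltW.
have r12 : 0 < 1 + 2 * rho by lra.
have low E x g g' : (al - 1) * (E * x) * g <= (al + 2) * g' ->
    (1 - rho) * x * (E * g) <= (1 + 2 * rho) * g'.
  move=> /(ler_wpM2l (ltW r0)).
  rewrite [leLHS](_ : _ = (rho * al - rho) * x * (E * g)); last by ring.
  rewrite [leRHS](_ : _ = (rho * al + 2 * rho) * g'); last by ring.
  by rewrite ral.
have up E x g g' : (al - 2) * g' <= al * (E * x) * g ->
    (1 - 2 * rho) * g' <= x * (E * g).
  move=> /(ler_wpM2l (ltW r0)).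
  rewrite [leLHS](_ : _ = (rho * al - 2 * rho) * g'); last by ring.
  rewrite [leRHS](_ : _ = (rho * al) * (x * (E * g))); last by ring.
  by rewrite ral mul1r.
clear ral; split.
- move=> E x g g' E0 g0 hx /low h; rewrite -(ler_pM2l r12); apply: le_trans h.
  have Eg : 0 <= E * g by rewrite mulr_ge0.
  rewrite [leLHS](_ : _ = ((1 + 2 * rho) * (1 + rho)) * (E * g)); last by ring.
  by rewrite ler_wpM2r //; have := ler_wpM2l r1 hx; lra.
- move=> E y g g' E0 g0 g0' hy /up h.
  have r16 : 0 <= 1 + 6 * rho by lra.
  have Eg : 0 <= E * g by rewrite mulr_ge0.
  have h1 := ler_wpM2l r16 h; have h2 := ler_wpM2r Eg hy.
  apply: (@le_trans _ _ ((1 + 6 * rho) * ((1 - 2 * rho) * g'))); last by lra.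
  by rewrite mulrA ler_wpM2r //; lra.
- move=> E x g g' E0 g0 g0' hx /up h.
  have d6 : 0 <= 1 - 6 * rho by lra.
  have Eg : 0 <= E * g by rewrite mulr_ge0.
  have h1 := ler_wpM2l d6 h; have h2 := ler_wpM2r Eg hx.
  have h3 : (1 - 6 * rho) * ((1 - 2 * rho) * g') <= E * g by lra.
  have r20' : 0 <= 1 + 20 * rho by lra.
  apply: le_trans (ler_wpM2l r20' h3).
  by rewrite !mulrA ler_peMl //; lra.
- move=> E y g g' E0 g0 hy /low h; rewrite -(ler_pM2l r12); apply: le_trans h.
  have Eg : 0 <= E * g by rewrite mulr_ge0.
  rewrite mulrA ler_wpM2r //; have := ler_wpM2l r1 hy; have := sqr_ge0 rho; lra.
Qed.

Lemma expR_bounds (rho : R) : 0 < rho ->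
  [/\ 1 + 6 * rho <= expR (2 * (3 * rho)),
      expR (2 * - (3 * rho)) * (1 + 6 * rho) <= 1,
      expR (2 * (3 * rho)) * (1 - 6 * rho) <= 1 & 1 - 2 * rho <= expR (2 * - rho)].
Proof.
move=> r0; rewrite mulrN mulrA -natrM; split.
- exact: expR_ge1Dx.
- by rewrite expRN mulrC ler_pdivrMr ?expR_gt0 // mul1r; exact: expR_ge1Dx.
- rewrite -[X in expR X]opprK expRN mulrC ler_pdivrMr ?expR_gt0 // mul1r.
  exact: expR_ge1Dx.
- by rewrite mulrN; exact: expR_ge1Dx.
Qed.

Lemma nat_floor (x : R) : 0 <= x -> exists k : nat, k%:R <= x /\ x < k%:R + 1.
Proof. by move=> /truncn_itv /andP[h1 h2]; exists (Num.truncn x); rewrite natr1. Qed.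

End RegionArithmetic.

(** At [|z| = e^T] the dominant indices satisfy [2n+2] near [P T], with [P] the derivative of [psi].
    The moment bounds are used at the radii [e^(T + 3 rho)], [e^(T - 3 rho)] and [e^(T - rho)]: such
    shifts change [P] by a multiple of [1 / rho], enough to provide the gap [al], and change the
    squared radius only by a factor [1 + O(rho)]. *)
Lemma region_point (R : realType) (P : R -> R) (gm s : nat -> R) (kap : R) n0
    (T0 rho T : R) (z : R[i]) :
  (forall n, 0 < gm n) -> (forall n, 0 < s n) -> 0 < kap ->
  (forall B : R, exists N, forall n, (N <= n)%N -> B * s n <= s n.+1) ->
  (forall n, s n ^+ 2 = kap * gm n) ->
  (forall n t al, T0 <= t -> 2 <= al -> (2 * n).+2%:R + al <= P t ->
    (al - 2) * gm n.+1 <= al * expR t ^+ 2 * gm n) ->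
  (forall n t al, T0 <= t -> (n0 <= n)%N -> 0 < al -> al <= (2 * n).+2%:R ->
    P t + al <= (2 * n).+2%:R ->
    (al - 1) * expR t ^+ 2 * gm n <= (al + 2) * gm n.+1) ->
  0 < rho -> rho <= 20^-1 -> T0 <= T - 3 * rho ->
  2 * n0%:R + 2 <= P (T - 3 * rho) -> P (T - 3 * rho) <= P T ->
  P T <= P (T + 3 * rho) ->
  P (T - rho) + rho^-1 <= P T ->
  P T + 3 * rho^-1 <= P (T + 3 * rho) ->
  P (T + 3 * rho) <= P T + 12 * rho^-1 ->
  P T <= P (T - 3 * rho) + 12 * rho^-1 ->
  0 <= P (T - rho) ->
  modulus z = expR T ->
  variance_le s (140 / rho ^+ 2) z /\ localized s (2000 * rho ^+ 2) z.
Proof.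
move=> gm_gt0 s_gt0 kap_gt0 s_growth s_sqr up low r0 r20 TT0 Pn P1 P2 i1 i2 i3 i4 P3 zT.
have ratio_sqr n : (s n.+1 / s n) ^+ 2 = gm n.+1 / gm n.
  rewrite expr_div_n !s_sqr invfM mulrACA divff ?mul1r //.
  by rewrite gt_eqF.
pose al := rho^-1.
have ral : rho * al = 1 by rewrite divff // gt_eqF.
have al20 : 20 <= al by rewrite -[leLHS]invrK lef_pV2 ?posrE // invr_gt0.
rewrite -/al in i1 i2 i3 i4; have -> : 140 / rho ^+ 2 = 2 * (8 * al) ^+ 2 + 12 * al ^+ 2.
  by rewrite -exprVn -/al; ring.
have rV : 12 / rho ^+ 2 = 12 * al ^+ 2 by rewrite exprVn.
have rE (n : nat) : (2 * n).+2%:R = 2 * n%:R + 2 :> R by rewrite -2!natr1 natrM; ring.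
have [a1 a2 a3 a4] := ratio_arith r0 r20 ral.
have [e1 e2 e3 e4] := expR_bounds r0.
have z0 : 0 < modulus z by rewrite zT expR_gt0.
have E0 : 0 <= modulus z ^+ 2 by rewrite sqr_ge0.
have eT j : expR (T + j) ^+ 2 = modulus z ^+ 2 * expR (2 * j).
  by rewrite zT -!expRM_natl -expRD; congr expR; ring.
have g0 n := ltW (gm_gt0 n).
have al0 : 0 < al by clear -al20; lra.
have al2 : 2 <= al by clear -al20; lra.
have t1 : T0 <= T + 3 * rho by clear -TT0 r0; lra.
have t2 : T0 <= T - rho by clear -TT0 r0; lra.
have PT0 : 2 * n0%:R + 2 <= P T := le_trans Pn P1.
have PTp : 0 <= P T by apply: le_trans PT0; rewrite addr_ge0 ?mulr_ge0.
have P3p : 0 <= P (T + 3 * rho) := le_trans PTp P2.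
(* The central index, where [2 k] is [P T] up to rounding. *)
have [k [k1 k2]] := nat_floor (divr_ge0 PTp (ler0n R 2)).
(* At distance [m] from [k], [2n] has moved by nearly [16 / rho], which exceeds the change of [P]
   over [3 rho], at most [12 / rho], by the gap [al] and all roundings. *)
have [m [m1 m2]] := nat_floor (mulr_ge0 (ler0n R 8) (ltW al0)).
(* Over the tent [2n+2] increases by at most [8 q <= 1 / rho], so the upper bound at [T + 3 rho],
   where [P] has gained [3 / rho], applies throughout. *)
have [q [q1 q2]] := nat_floor (divr_ge0 (ltW al0) (ler0n R 8)).
have n0k : (n0 <= k)%N by rewrite -(ler_nat R); clear -PT0 k2; lra.
have al_le (c t n : R) : 0 <= c -> c + al <= t -> al <= t by clear; lra.
split.
  have [N hN] : variance_le s (2 * m%:R ^+ 2 + 12 / rho ^+ 2) z.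
    apply: (@variance_le_of_ratio _ s z rho k m s_gt0 s_growth z0 r0).
    - by clear -r20; lra.
    - move=> i hi; rewrite !s_sqr.
      rewrite [leLHS](_ : _ = kap * ((1 + rho) * modulus z ^+ 2 * gm i)); last by ring.
      rewrite ler_pM2l //; apply: (a1 _ _ _ _ E0 (g0 i) e1).
      have ki : (k <= i)%N by apply: leq_trans hi; exact: leq_addr.
      have hi' : k%:R + m%:R <= i%:R :> R by rewrite -natrD ler_nat.
      have h : P (T + 3 * rho) + al <= (2 * i).+2%:R.
        by rewrite rE; clear -hi' i3 k2 m2 al2; lra.
      by rewrite -eT; apply: low => //; [exact: leq_trans ki|exact: al_le h].
    - move=> i hi; rewrite !s_sqr.
      rewrite [leLHS](_ : _ = kap * ((1 + rho) * gm i.+1)); last by ring.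
      rewrite [leRHS](_ : _ = kap * (modulus z ^+ 2 * gm i)); last by ring.
      rewrite ler_pM2l //; apply: (a2 _ _ _ _ E0 (g0 i) (g0 i.+1) e2).
      have hi' : i%:R + 1 + m%:R <= k%:R :> R.
        by rewrite natr1 -natrD ler_nat addSn addnC -ltn_subRL.
      rewrite -eT; apply: up => //; rewrite rE; clear -hi' i4 k1 m2 al2; lra.
  exists N => M; apply: le_trans (hN M) _; rewrite rV; apply: ler_wpM2r.
    by apply: ltW; apply: ksum_gt0; [exact: s_gt0|exact: s_growth].
  by rewrite lerD2r ler_pM2l // ler_sqr ?nnegrE // mulr_ge0 // ltW.
apply: (@localized_of_ratio _ s z rho k q) => //.
- by rewrite -(ltr_nat R); clear -q2 al20; lra.
- have h1 : al / 16 <= q%:R by clear -q2 al20; lra.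
  by have := ler_wpM2l (ltW r0) h1; clear -ral; lra.
move=> n kn nq.
have kn' : k%:R <= n%:R :> R by rewrite ler_nat.
have nq' : n%:R + 1 <= k%:R + 4 * q%:R :> R by rewrite natr1 -natrM -natrD ler_nat.
apply: near_of_sqr => //.
- by rewrite divr_ge0 // ltW // s_gt0.
- by rewrite mulr_ge0 // ltW.
- by clear -r20; lra.
- rewrite ratio_sqr ler_pdivrMr // -mulrA; apply: (a3 _ _ _ _ E0 (g0 n) (g0 n.+1) e3).
  by rewrite -eT; apply: up => //; rewrite rE; clear -nq' k1 q1 i2 al0; lra.
- rewrite ratio_sqr ler_pdivlMr // -mulrA; apply: (a4 _ _ _ _ E0 (g0 n) e4).
  have h : P (T - rho) + al <= (2 * n).+2%:R by rewrite rE; clear -kn' i1 k2; lra.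
  by rewrite -eT; apply: low => //; [exact: leq_trans kn|exact: al_le h].
Qed.

Lemma increments_around (R : realType) (P : R -> R) (M al rho T a b : R) :
  0 < rho -> M * rho = al -> 0 <= al -> a + 3 * rho <= T -> T + 3 * rho <= b ->
  (forall x y, a <= x -> x <= y -> y <= b ->
     M * (y - x) <= P y - P x /\ P y - P x <= 4 * M * (y - x)) ->
  [/\ P (T - 3 * rho) <= P T, P T <= P (T + 3 * rho), P (T - rho) + al <= P T,
      P T + 3 * al <= P (T + 3 * rho) &
      P (T + 3 * rho) <= P T + 12 * al /\ P T <= P (T - 3 * rho) + 12 * al].
Proof.
move=> r0 Mr al0 aT Tb inc.
have h1 : a <= T - 3 * rho by lra.
have h2 : T - 3 * rho <= T by lra.
have h3 : T <= T + 3 * rho by lra.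
have h4 : T - rho <= T by lra.
have h5 : a <= T - rho by lra.
have [a1 a2] := inc _ _ h1 h2 (le_trans h3 Tb).
have [b1 b2] := inc _ _ (le_trans h1 h2) h3 Tb.
have [c1 c2] := inc _ _ h5 h4 (le_trans h3 Tb).
clear inc; rewrite -Mr in al0 *; move: a1 a2 b1 b2 c1 c2.
by move: (P _) (P _) (P _) (P _) => p1 p2 p3 p4; split; [| | | |split]; lra.
Qed.

(** * Application to the weight of the theorem *)

Section LogConvexWeight.
Context {R : realType}.
Local Notation C := R[i].
Variables h psi psi' psi'' : R -> R.
Hypothesis h_cont : {within `[0, +oo[, continuous h}.
Hypothesis psiE : forall t, psi t = h (expR t).
Hypothesis psi_derive : has_derivative_on `[0, +oo[ psi psi'.
Hypothesis psi'_derive : has_derivative_on `[0, +oo[ psi' psi''.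
Hypothesis psi''_incr : {in `[0, +oo[ &, {homo psi'' : s t / s <= t}}.
Hypothesis psi''_lim : psi'' t @[t --> +oo] --> +oo.

Let p (x : R) : R := psi' (ln x).

Let dpsi' (t : R) : 0 < t -> is_derive t 1 psi' (psi'' t).
Proof. exact: has_derivative_on_is_derive. Qed.

Lemma h_derive (x : R) : 1 < x -> is_derive x 1 h (p x / x).
Proof.
move=> x1; have x0 : 0 < x by lra.
have lx : 0 < ln x by exact: ln_gt0.
have d1 : is_derive (ln x) 1 psi (psi' (ln x)) by exact: has_derivative_on_is_derive.
apply: (near_eq_is_derive _ (is_derive1_comp d1 (is_derive1_ln x0))).
apply/nbhs_ballP; exists x => //= y; rewrite /ball /= => hy.
by rewrite psiE lnK // posrE; have := ler_norm (x - y); lra.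
Qed.

Lemma log_derivative_cont (x : R) : 1 < x -> {for x, continuous p}.
Proof.
move=> x1; have x0 : 0 < x by lra.
have lx : 0 < ln x by exact: ln_gt0.
apply: continuous_comp; first exact: continuous_ln.
apply: differentiable_continuous; apply/derivable1_diffP.
by case: (dpsi' lx).
Qed.

Let psi''_top (B : R) : exists S : R, forall t : R, S <= t -> B <= psi'' t.
Proof.
move/cvgryPge: psi''_lim => /(_ B) [M [_ hM]].
by exists (M + 1) => t Mt; apply: hM; rewrite /=; lra.
Qed.

Let psi'_top (B : R) : exists2 S : R, 1 < S & forall t : R, S <= t -> B <= psi' t.
Proof. by have [_ hB] := eventual_maximum dpsi' psi''_incr psi''_top. Qed.

Let le_ln (t x : R) : expR t <= x -> t <= ln x.
Proof.
move=> tx; rewrite -{1}(expRK t) ler_ln ?posrE ?expR_gt0 //.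
exact: lt_le_trans (expR_gt0 t) tx.
Qed.

Lemma log_derivative_top (B : R) : exists2 S : R, 2 < S & forall x : R, S <= x -> B <= p x.
Proof.
have [S S1 hS] := psi'_top B.
exists (expR S); first by have := expR_ge1Dx S; lra.
by move=> x Sx; apply: hS; exact: le_ln.
Qed.

Local Notation gm := (gmoment h).

(** By [eventual_maximum] the conditions on [p] over a whole half-line or interval reduce to one on
    [psi' t], with [S = expR t]. *)
Lemma moment_ratio_bounds : exists n0 (T0 : R), [/\ 1 < T0,
  forall n t al, T0 <= t -> 2 <= al -> (2 * n).+2%:R + al <= psi' t ->
    (al - 2) * gm n.+1 <= al * expR t ^+ 2 * gm n &
  forall n t al, T0 <= t -> (n0 <= n)%N -> 0 < al -> al <= (2 * n).+2%:R ->
    psi' t + al <= (2 * n).+2%:R ->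
    (al - 1) * expR t ^+ 2 * gm n <= (al + 2) * gm n.+1].
Proof.
have [[T0 T01 hT0] _] := eventual_maximum dpsi' psi''_incr psi''_top.
have [n0 hn0] := gmoment_lower h_cont h_derive log_derivative_cont log_derivative_top.
exists n0, T0; split; first exact: T01.
- move=> n t al T0t al2 hal.
  apply: (gmoment_upper h_cont h_derive log_derivative_cont log_derivative_top) => //.
    by rewrite expR_gt1; lra.
  move=> x tx; apply: le_trans hal _; apply: hT0 => //; last 2 first.
  - lra.
  - exact: le_ln.
  - exact: le_trans T0t (le_ln tx).
- move=> n t al T0t nn al0 aln hal; apply: hn0 => //.
    by have := expR_ge1Dx t; lra.
  move=> x x1 xt; apply: le_trans hal; rewrite lerD2r; apply: hT0 => //.
    exact: ln_gt0.
  by rewrite -[leRHS](expRK t) ler_ln ?posrE ?expR_gt0 //; lra.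
Qed.

Definition coef_scale n : R := Num.sqrt (2 * pi * gm n).
Local Notation s := coef_scale.

Let gm_gt0 n : 0 < gm n.
Proof. exact: (gmoment_gt0 h_cont h_derive log_derivative_cont log_derivative_top). Qed.

Lemma coef_scale_gt0 n : 0 < s n.
Proof. by rewrite sqrtr_gt0 !mulr_gt0 // pi_gt0. Qed.

Lemma coef_scale_sqr n : s n ^+ 2 = 2 * pi * gm n.
Proof. by rewrite sqr_sqrtr // !mulr_ge0 ?pi_ge0 // ltW. Qed.

(** At a fixed radius the lower moment bound is available for all large [n]. With [al = 2] it gives
    [e^(2t) gm n <= 4 gm n.+1], and the radius is arbitrary. *)
Lemma coef_scale_growth (B : R) : exists N, forall n, (N <= n)%N -> B * s n <= s n.+1.
Proof.
have [n0 [T0 [T01 _ low]]] := moment_ratio_bounds.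
(* Then [e^t >= 1 + t >= 2 |B|], which absorbs the factor 4. *)
pose t := T0 + 2 * `|B|.
have tT : T0 <= t by rewrite lerDl mulr_ge0.
have [k hk] := exists_natr_gt (`|psi' t| + 2).
exists (n0 + k)%N => n nn.
have nk : psi' t + 2 <= (2 * n).+2%:R.
  apply: (@le_trans _ _ k%:R); first by have := ler_norm (psi' t); lra.
  by rewrite ler_nat; lia.
have n2 : 2 <= (2 * n).+2%:R :> R by rewrite ler_nat.
have nn0 : (n0 <= n)%N by lia.
have := low n t 2 tT nn0 (ltr0n R 2) n2 nk => h1.
have e1 := expR_ge1Dx t.
have eB : 2 * `|B| <= expR t by rewrite /t in e1 *; lra.
have e2 : (2 * `|B|) ^+ 2 <= expR t ^+ 2.
  by rewrite ler_sqr ?nnegrE ?expR_ge0 ?mulr_ge0.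
apply: le_trans (ler_wpM2r (ltW (coef_scale_gt0 n)) (ler_norm B)) _.
rewrite -ler_sqr ?nnegrE ?mulr_ge0 ?(ltW (coef_scale_gt0 _)) //.
rewrite exprMn (coef_scale_sqr n) (coef_scale_sqr n.+1) mulrCA.
have kap0 : 0 < 2 * pi :> R by rewrite mulr_gt0 // pi_gt0.
rewrite (ler_pM2l kap0).
have := ler_wpM2r (ltW (gm_gt0 n)) e2; rewrite exprMn; lra.
Qed.

Lemma fock_region (W e : R) : 0 < W -> 0 < e ->
  exists rho r, [/\ 0 < rho, rho < e, 0 < r &
    forall z : C, r <= modulus z -> modulus z <= r * (1 + W * rho) ->
       variance_le s (140 / rho ^+ 2) z /\ localized s (2000 * rho ^+ 2) z].
Proof.
move=> W0 e0.
have [n0 [T0 [T01 up low]]] := moment_ratio_bounds.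
have [S S1 hS] := psi'_top (2 * n0%:R + 2).
(* [W] for the logarithmic width of the annulus and 3 on each side for the shifted radii of
   [region_point]. *)
have L0 : 0 < W + 6 by lra.
(* As [rho = psi''(t0)^(-1/2)], the bound 400 yields [rho <= 1/20] and the other one [rho < e]. *)
pose B := Num.max (400 : R) ((2 / e) ^+ 2).
have [t0 [t0T t0B t0q]] := slow_growth_point (Num.max T0 S) B psi''_incr psi''_top L0.
move: t0T t0B; rewrite !ge_max => /andP[T0t0 St0] /andP[M400 Me].
move: t0q; set M := psi'' t0 in M400 Me *.
set al := Num.sqrt M => t0q.
have M0 : 0 < M by lra.
have alE : al ^+ 2 = M by rewrite sqr_sqrtr // ltW.
have al0 : 0 < al by rewrite sqrtr_gt0.
have al20 : 20 <= al.
  by rewrite -(ler_sqr (_ : _ \is Num.nneg) (_ : al \is Num.nneg)) ?nnegrE ?(ltW al0) // alE; lra.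
have ale : 2 / e <= al.
  by rewrite -(ler_sqr (_ : _ \is Num.nneg) (_ : al \is Num.nneg)) ?nnegrE ?(ltW al0) ?alE // divr_ge0 // ltW.
pose rho := al^-1.
have r0 : 0 < rho by rewrite invr_gt0.
have ral : rho * al = 1 by rewrite mulVf // gt_eqF.
have Mr : M * rho = al by rewrite -alE expr2 -mulrA mulfV ?mulr1 // gt_eqF.
(* Starting at [t0 + 3 rho] keeps [T - 3 rho] in the range where [psi''] is comparable to
   [psi''(t0)]. *)
exists rho, (expR (t0 + 3 * rho)); split => //.
- rewrite /rho -[e]invrK ltf_pV2 ?posrE ?invr_gt0 //.
  by apply: lt_le_trans ale; rewrite ltr_pMl ?invr_gt0 //; lra.
- exact: expR_gt0.
move=> z rz zr.
have z0 : 0 < modulus z by apply: lt_le_trans rz; exact: expR_gt0.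
pose T := ln (modulus z).
have zT : modulus z = expR T by rewrite lnK.
have T1 : t0 + 3 * rho <= T by rewrite -ler_expR -zT.
have T2 : T + 3 * rho <= t0 + (W + 6) * rho.
  have : T <= t0 + 3 * rho + W * rho.
    rewrite -ler_expR -zT; apply: le_trans zr _; rewrite [leRHS]expRD.
    by rewrite ler_wpM2l ?expR_ge0 // expR_ge1Dx.
  lra.
have t00 : 0 < t0 by lra.
have Qb (t : R) : t0 <= t -> t <= t0 + (W + 6) * rho -> M <= psi'' t /\ psi'' t <= 4 * M.
  move=> h1 h2; split.
    by apply: psi''_incr; rewrite ?in_itv /= ?andbT //; lra.
  apply: le_trans t0q; apply: psi''_incr; rewrite ?in_itv /= ?andbT //; first lra.
  by rewrite -/rho; lra.
have inc := increment_bounds dpsi' t00 Qb.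
have [j1 j2 j3 j4 [j5 j6]] := increments_around r0 Mr (ltW al0) T1 T2 inc.
have rV : rho^-1 = al by rewrite invrK.
have Pn : 2 * n0%:R + 2 <= psi' (T - 3 * rho) by apply: hS; lra.
have Pn' : 0 <= psi' (T - rho).
  apply: le_trans (hS (T - rho) _); last by lra.
  by rewrite addr_ge0 // mulr_ge0.
have TT : T0 <= T - 3 * rho by lra.
have r20 : rho <= 20^-1 by rewrite lef_pV2 ?posrE.
have kap0 : 0 < 2 * pi :> R by rewrite mulr_gt0 // pi_gt0.
rewrite -rV in j3 j4 j5 j6.
exact: (region_point gm_gt0 coef_scale_gt0 kap0 coef_scale_growth coef_scale_sqr
  up low r0 r20 TT Pn j1 j2 j3 j4 j5 j6 Pn' zT).
Qed.

Lemma fock_sqnorm_coef_scale n : fock_sqnorm h (fun z => z ^+ n) = (s n ^+ 2)%:E.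
Proof.
by rewrite coef_scale_sqr (fock_sqnorm_monomial h_cont h_derive log_derivative_cont log_derivative_top).
Qed.

End LogConvexWeight.

(** * Contour integrals and Taylor expansion *)

Section ComplexAnalysis.
Context {R : realType}.
Local Notation C := R[i].
Local Notation mu := (@lebesgue_measure R).

(** Bridges the topology of [R[i]], whose radii are positive elements of [R[i]], hence real, and
    estimates of the real modulus. *)
Lemma cvg_modulusP (T : Type) (F : set_system T) (FF : Filter F) (u : T -> C) (l : C) :
  (u x @[x --> F] --> (l : C^o)) <->
  (forall e : R, 0 < e -> \forall x \near F, modulus (l - u x) < e).
Proof.
split.
  move=> hu e e0.
  have [h _] := @cvgrPdist_lt C C^o T F FF u l; have {}h := h hu.
  have ec : 0 < e%:C by rewrite ltcR.
  by apply: filterS (h _ ec) => x; rewrite /Num.norm /= ltcR.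
move=> h; apply: (proj2 (@cvgrPdist_lt C C^o T F FF u l)) => -[e e']; rewrite ltcE /= => /andP[/eqP -> e0].
by apply: filterS (h e e0) => x hx; rewrite /Num.norm /= ltcR.
Qed.

Lemma continuous_modulusP (u : C -> C) (z : C) :
  {for z, continuous (u : C^o -> C^o)} <->
  (forall e : R, 0 < e -> exists2 d : R, 0 < d &
     forall w, modulus (w - z) < d -> modulus (u w - u z) < e).
Proof.
split.
  move=> /cvg_modulusP h e e0.
  have /nbhs_ballP[[d d'] /=] := h e e0.
  rewrite ltcE /= => /andP[/eqP -> d0] hd; exists d => // w wz.
  rewrite modulusBC; apply: hd; rewrite /ball /= /ball_ /Num.norm /= ltcR modulusBC //.
move=> h; apply/(@cvg_modulusP _ (nbhs (z : C^o))) => e e0; have [d d0 hd] := h e e0.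
apply/nbhs_ballP; exists d%:C => /=; first by rewrite ltcR.
move=> w; rewrite /ball /= /ball_ /Num.norm /= ltcR => wz.
by rewrite modulusBC hd // modulusBC.
Qed.

Lemma is_derive_modulusP (f : C -> C) (z l : C) : is_derive (z : C^o) 1 (f : C^o -> C^o) l ->
  forall e : R, 0 < e -> exists2 d : R, 0 < d & forall w, modulus (w - z) < d ->
    modulus (f w - f z - l * (w - z)) <= e * modulus (w - z).
Proof.
move=> [df dv] e e0.
have cv : (h^-1 *: (((f : C^o -> C^o) \o shift z) (h *: (1 : C^o)) - f z)) @[h --> (0 : C^o)^'] --> (l : C^o).
  by rewrite -dv; exact: df.
have /cvg_modulusP h := cv.
have := h e e0; rewrite near_withinE => /nbhs_ballP[[d d'] /=].
rewrite ltcE /= => /andP[/eqP -> d0] hd; exists d => // w wz.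
have [->|wn] := eqVneq w z.
  by rewrite !subrr mulr0 subr0 modulus0 mulr0.
have w0 : w - z != 0 by rewrite subr_eq0.
have := hd (w - z); rewrite /ball /= /ball_ /Num.norm /= ltcR sub0r modulusN => /(_ wz w0).
rewrite /GRing.scale /= mulr1 subrK => /ltW hl.
have -> : f w - f z - l * (w - z) = - ((l - (w - z)^-1 * (f w - f z)) * (w - z)).
  by field.
by rewrite modulusN modulusM ler_wpM2r // modulus_ge0.
Qed.

Lemma entire_continuous (f : C -> C) : entire f -> continuous (f : C^o -> C^o).
Proof.
move=> ef z; apply: differentiable_continuous; apply/derivable1_diffP.
exact: ef.
Qed.

Definition pcont (u : R -> C) := continuous (u : R -> C^o).

Lemma pcont_cst (c : C) : pcont (fun=> c).
Proof. by move=> x; exact: cvg_cst. Qed.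

Lemma pcontD u v : pcont u -> pcont v -> pcont (fun x => u x + v x).
Proof. by move=> hu hv x; apply: (@cvgD C C^o); [exact: hu|exact: hv]. Qed.

Lemma pcontM u v : pcont u -> pcont v -> pcont (fun x => u x * v x).
Proof. by move=> hu hv x; apply: cvgM; [exact: hu|exact: hv]. Qed.

Lemma pcontV u : (forall x, u x != 0) -> pcont u -> pcont (fun x => (u x)^-1).
Proof. by move=> u0 hu x; apply: cvgV; [exact: u0|exact: hu]. Qed.

Lemma pcont_comp (f : C -> C) u : continuous (f : C^o -> C^o) -> pcont u -> pcont (fun x => f (u x)).
Proof. by move=> hf hu x; apply: (continuous_comp (hu x)); exact: hf. Qed.

Lemma pcont_sum (I : Type) (r : seq I) (F : I -> R -> C) :
  (forall i, pcont (F i)) -> pcont (fun x => \sum_(i <- r) F i x).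
Proof.
move=> hF; elim: r => [|i r IHr].
  by under eq_fun do rewrite big_nil; exact: pcont_cst.
have -> : (fun x => \sum_(j <- i :: r) F j x) = (fun x => F i x + \sum_(j <- r) F j x).
  by apply/funext => x; rewrite big_cons.
exact: (pcontD (hF i) IHr).
Qed.

Lemma pcont_line (z v : C) : pcont (fun t => z + t%:C * v).
Proof.
apply: pcontD; first exact: pcont_cst.
apply: pcontM; last exact: pcont_cst.
move=> x; apply/cvg_modulusP => e e0; apply/nbhs_ballP; exists e => // y hy.
by rewrite -(rmorphB (@real_complex R)) modulus_real.
Qed.

Lemma pcont_Re u : pcont u -> continuous (fun x : R => complex.Re (u x)).
Proof.
move=> hu x; apply/cvgrPdist_lt => e e0.
have /cvg_modulusP := hu x => /(_ e e0); apply: filterS => y.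
by apply: le_lt_trans; rewrite -raddfB; exact: modulus_ge_Re.
Qed.

Lemma pcont_Im u : pcont u -> continuous (fun x : R => complex.Im (u x)).
Proof.
move=> hu x; apply/cvgrPdist_lt => e e0.
have /cvg_modulusP := hu x => /(_ e e0); apply: filterS => y.
by apply: le_lt_trans; rewrite -raddfB; exact: modulus_ge_Im.
Qed.

Definition cint (u : R -> C) (a b : R) : C :=
  (\int[mu]_(x in `[a, b]) complex.Re (u x)) +i* (\int[mu]_(x in `[a, b]) complex.Im (u x)).

Lemma continuous_integrable (g : R -> R) a b : continuous g ->
  mu.-integrable `[a, b] (EFin \o g).
Proof.
move=> hg; apply: continuous_compact_integrable; first exact: segment_compact.
exact: continuous_subspaceT.
Qed.

Let iRe u a b : pcont u -> mu.-integrable `[a, b] (EFin \o (fun x => complex.Re (u x))).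
Proof. by move=> hu; apply: continuous_integrable; exact: pcont_Re. Qed.

Let iIm u a b : pcont u -> mu.-integrable `[a, b] (EFin \o (fun x => complex.Im (u x))).
Proof. by move=> hu; apply: continuous_integrable; exact: pcont_Im. Qed.

Lemma cintD u v a b : pcont u -> pcont v ->
  cint (fun x => u x + v x) a b = cint u a b + cint v a b.
Proof.
move=> hu hv; rewrite /cint; under eq_Rintegral do rewrite raddfD /=.
under [X in _ +i* X]eq_Rintegral do rewrite raddfD /=.
by rewrite !RintegralD //; first [exact: iRe|exact: iIm].
Qed.

Lemma cintZ (c : C) u a b : pcont u -> cint (fun x => c * u x) a b = c * cint u a b.
Proof.
case: c => p q hu; rewrite /cint.
have iZ (g : R -> R) (k : R) : mu.-integrable `[a, b] (EFin \o g) ->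
    mu.-integrable `[a, b] (EFin \o (fun x => k * g x)).
  by move=> hg; apply: (integrableZl _ k hg).
have e1 : \int[mu]_(x in `[a, b]) complex.Re ((p +i* q) * u x) =
    p * (\int[mu]_(x in `[a, b]) complex.Re (u x)) - q * (\int[mu]_(x in `[a, b]) complex.Im (u x)).
  rewrite -!RintegralZl -?RintegralB //; try (first [exact: iRe|exact: iIm]).
  - by apply: eq_Rintegral => x _; case: (u x).
  - by apply: iZ; exact: iRe.
  - by apply: iZ; exact: iIm.
have e2 : \int[mu]_(x in `[a, b]) complex.Im ((p +i* q) * u x) =
    p * (\int[mu]_(x in `[a, b]) complex.Im (u x)) + q * (\int[mu]_(x in `[a, b]) complex.Re (u x)).
  rewrite -!RintegralZl -?RintegralD //; try (first [exact: iRe|exact: iIm]).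
  - by apply: eq_Rintegral => x _; case: (u x).
  - by apply: iZ; exact: iIm.
  - by apply: iZ; exact: iRe.
by rewrite e1 e2.
Qed.

Lemma cint_split u a b c : pcont u -> a <= b -> b <= c ->
  cint u a c = cint u a b + cint u b c.
Proof.
move=> hu ab bc.
have split (g : R -> R) : continuous g -> \int[mu]_(x in `[a, c]) g x =
    \int[mu]_(x in `[a, b]) g x + \int[mu]_(x in `[b, c]) g x.
  move=> hg; have hi := continuous_integrable a c hg.
  have := Rintegral_itvB (a := BLeft a) (b := BRight c) (x := b) hi.
  rewrite !bnd_simp => /(_ ab bc) e.
  rewrite -[LHS](subrK (\int[mu]_(x in `[a, b]) g x)) addrC; congr (_ + _).
  rewrite e Rintegral_itv_obnd_cbnd //.
  apply: integrableS hi => //.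
  by apply: subset_itvr; rewrite bnd_simp.
by rewrite /cint (split _ (pcont_Re hu)) (split _ (pcont_Im hu)).
Qed.

Lemma cint_bound u a b (M : R) : pcont u -> a <= b -> 0 <= M ->
  (forall x, a <= x -> x <= b -> modulus (u x) <= M) ->
  modulus (cint u a b) <= 2 * M * (b - a).
Proof.
move=> hu ab M0 hM.
have bound (g : R -> R) : continuous g -> (forall x, a <= x -> x <= b -> `|g x| <= M) ->
    `|\int[mu]_(x in `[a, b]) g x| <= M * (b - a).
  move=> hg gM; apply: le_trans (le_normr_Rintegral _ (continuous_integrable a b hg)) _ => //.
  have -> : M * (b - a) = \int[mu]_(x in `[a, b]) cst M x.
    rewrite Rintegral_cst //=; have := lebesgue_measure_itv (R := R) `[a, b].
    rewrite /= lte_fin => ->; case: ifP => ab'; first by rewrite -EFinB.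
    have -> : b = a by apply/eqP; rewrite eq_le ab leNgt ab'.
    by rewrite subrr.
  apply: le_Rintegral => //.
  - apply: continuous_integrable => x; apply: (cvg_norm (hg x)).
  - by apply: continuous_integrable => x; exact: cvg_cst.
  - by move=> x; rewrite /= in_itv /= => /andP[ax xb]; exact: gM.
apply: le_trans (modulus_le_ReIm _) _ => /=; rewrite -mulrA mulr_natl mulr2n; apply: lerD.
  apply: bound (pcont_Re hu) _ => x ax xb.
  exact: le_trans (modulus_ge_Re _) (hM x ax xb).
apply: bound (pcont_Im hu) _ => x ax xb.
exact: le_trans (modulus_ge_Im _) (hM x ax xb).
Qed.

Lemma is_derive_of_bound (g : R -> R) (x l : R) :
  (forall e : R, 0 < e -> exists2 d : R, 0 < d &
     forall y, `|y - x| < d -> `|g y - g x - l * (y - x)| <= e * `|y - x|) ->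
  is_derive x 1 g l.
Proof.
move=> h.
have cv : (k^-1 *: ((g \o shift x) (k *: 1) - g x)) @[k --> (0:R)^'] --> l.
  apply/cvgrPdist_le => e e0; rewrite near_withinE; have [d d0 hd] := h e e0.
  apply/nbhs_ballP; exists d => //= k; rewrite /ball /= sub0r normrN => kd k0.
  have := hd (k + x); rewrite addrK => /(_ kd) hk.
  rewrite /GRing.scale /= mulr1.
  have -> : l - k^-1 * (g (k + x) - g x) = - (k^-1 * (g (k + x) - g x - l * k)) by field.
  by rewrite normrN normrM normfV ler_pdivrMl ?normr_gt0 // [leRHS]mulrC.
by apply: DeriveDef; [exact: cvgP cv|exact: cvg_lim cv].
Qed.

Lemma cint_FTC (F f : C -> C) (z v : C) (a b : R) : a <= b ->
  (forall t : R, is_derive (z + t%:C * v : C^o) 1 (F : C^o -> C^o) (f (z + t%:C * v))) ->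
  pcont (fun t => f (z + t%:C * v)) ->
  cint (fun t => v * f (z + t%:C * v)) a b = F (z + b%:C * v) - F (z + a%:C * v).
Proof.
move=> ab dF cf.
have cu : pcont (fun t => v * f (z + t%:C * v)) := pcontM (@pcont_cst v) cf.
pose U t := F (z + t%:C * v); pose u t := v * f (z + t%:C * v).
have dU (x : R) (e : R) : 0 < e -> exists2 d : R, 0 < d & forall y, `|y - x| < d ->
    modulus (U y - U x - u x * (y - x)%:C) <= e * `|y - x|.
  move=> e0; pose k := modulus v + 1.
  have k0 : 0 < k by rewrite /k ltr_wpDl ?modulus_ge0.
  have ek : 0 < e / k by rewrite divr_gt0.
  have [d d0 hd] := is_derive_modulusP (dF x) ek.
  have vk : modulus v <= k by rewrite /k lerDl.
  exists (d / k); first by rewrite divr_gt0.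
  move=> y yx.
  have e1 : (z + y%:C * v) - (z + x%:C * v) = (y - x)%:C * v by rewrite rmorphB /=; ring.
  have h1 : modulus ((y - x)%:C * v) <= `|y - x| * k.
    by rewrite modulusM modulus_real ler_wpM2l.
  have := hd (z + y%:C * v); rewrite e1 => hy.
  rewrite /U /u (_ : v * _ * _ = f (z + x%:C * v) * ((y - x)%:C * v)); last by ring.
  apply: le_trans (hy _) _; first by apply: le_lt_trans h1 _; rewrite -ltr_pdivlMr.
  apply: le_trans (ler_wpM2l (ltW ek) h1) _.
  by rewrite mulrC -mulrA [k * _]mulrC divfK ?gt_eqF // mulrC.
have dRe (x : R) : is_derive x 1 (fun t : R => complex.Re (U t)) (complex.Re (u x)).
  apply: is_derive_of_bound => e e0; have [d d0 hd] := dU x e e0; exists d => // y yx.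
  apply: le_trans (hd y yx); apply: le_trans (modulus_ge_Re _).
  have -> : complex.Re (U y) - complex.Re (U x) - complex.Re (u x) * (y - x) =
    complex.Re (U y - U x - u x * (y - x)%:C); last by [].
  by case: (U y) (U x) (u x) => [p1 q1] [p2 q2] [p3 q3] /=; ring.
have dIm (x : R) : is_derive x 1 (fun t : R => complex.Im (U t)) (complex.Im (u x)).
  apply: is_derive_of_bound => e e0; have [d d0 hd] := dU x e e0; exists d => // y yx.
  apply: le_trans (hd y yx); apply: le_trans (modulus_ge_Im _).
  have -> : complex.Im (U y) - complex.Im (U x) - complex.Im (u x) * (y - x) =
    complex.Im (U y - U x - u x * (y - x)%:C); last by [].
  by case: (U y) (U x) (u x) => [p1 q1] [p2 q2] [p3 q3] /=; ring.
have ftc (G g : R -> R) : (forall x : R, is_derive x 1 G (g x)) -> continuous g ->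
    \int[mu]_(x in `[a, b]) g x = G b - G a.
  move=> dG cg; move: ab; rewrite le_eqVlt => /orP[/eqP ->|ab'].
    by rewrite set_itv1 Rintegral_set1 subrr.
  have cG (x : R) : {for x, continuous G}.
    by apply: differentiable_continuous; apply/derivable1_diffP; case: (dG x).
  rewrite /Rintegral (continuous_FTC2 (F := G) ab' (continuous_subspaceT cg)) //; first split.
  - by move=> x _; case: (dG x).
  - by apply: cvg_at_right_filter; exact: cG.
  - by apply: cvg_at_left_filter; exact: cG.
  - by move=> x _; have hx := dG x; rewrite derive1E (@derive_val _ _ _ _ _ _ _ hx).
rewrite /cint (ftc _ _ dRe (pcont_Re cu)) (ftc _ _ dIm (pcont_Im cu)) /U.
by case: (F _) => p q; case: (F _).
Qed.

End ComplexAnalysis.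

Section Rectangles.
Context {R : realType}.
Local Notation C := R[i].
Local Notation iu := (0 +i* 1 : R[i]).

Definition hint (f : C -> C) (y a b : R) : C := cint (fun t => f (t +i* y)) a b.
Definition vint (f : C -> C) (x c d : R) : C := cint (fun t => f (x +i* t)) c d.

(** The contour integral of [f dz] along the boundary, counterclockwise; [iu] is [dz] on the
    vertical edges. *)
Definition rint (f : C -> C) (a b c d : R) : C :=
  hint f c a b - hint f d a b + iu * (vint f b c d - vint f a c d).

Lemma hlineE (y t : R) : t +i* y = (0 +i* y) + t%:C * 1.
Proof. by rewrite mulr1; apply/eqP; rewrite eq_complex /= add0r addr0 !eqxx. Qed.

Lemma vlineE (x t : R) : x +i* t = x%:C + t%:C * iu.
Proof. by apply/eqP; rewrite eq_complex /= !mulr0 ?mul0r mulr1 ?subr0 ?subrr ?addr0 ?add0r !eqxx. Qed.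

Lemma pcont_hline y : pcont (fun t : R => t +i* y).
Proof. by under eq_fun do rewrite hlineE; exact: pcont_line. Qed.

Lemma pcont_vline x : pcont (fun t : R => x +i* t).
Proof. by under eq_fun do rewrite vlineE; exact: pcont_line. Qed.

(** Continuity only along the lines carrying the edges, so that functions with a pole inside the
    rectangle are covered. *)
Definition edges_cont (f : C -> C) (a b c d : R) :=
  [/\ pcont (fun t : R => f (t +i* c)), pcont (fun t : R => f (t +i* d)),
      pcont (fun t : R => f (a +i* t)) & pcont (fun t : R => f (b +i* t))].

Lemma continuous_edges (f : C -> C) a b c d : continuous (f : C^o -> C^o) -> edges_cont f a b c d.
Proof.
move=> hf; split; apply: (pcont_comp hf).
- exact: pcont_hline.
- exact: pcont_hline.
- exact: pcont_vline.
- exact: pcont_vline.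
Qed.

Lemma edges_contD f g a b c d : edges_cont f a b c d -> edges_cont g a b c d ->
  edges_cont (fun z => f z + g z) a b c d.
Proof. by move=> [h1 h2 h3 h4] [k1 k2 k3 k4]; split; exact: pcontD. Qed.

Lemma edges_contM f g a b c d : edges_cont f a b c d -> edges_cont g a b c d ->
  edges_cont (fun z => f z * g z) a b c d.
Proof. by move=> [h1 h2 h3 h4] [k1 k2 k3 k4]; split; exact: pcontM. Qed.

Lemma edges_cont_cst (k : C) a b c d : edges_cont (fun=> k) a b c d.
Proof. by split; exact: pcont_cst. Qed.

Lemma edges_cont_sum (f : nat -> C -> C) a b c d N : (forall n, edges_cont (f n) a b c d) ->
  edges_cont (fun z => \sum_(n < N) f n z) a b c d.
Proof. by move=> hf; split; apply: pcont_sum => i; case: (hf i). Qed.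

Lemma rintD f g a b c d : edges_cont f a b c d -> edges_cont g a b c d ->
  rint (fun z => f z + g z) a b c d = rint f a b c d + rint g a b c d.
Proof.
move=> [h1 h2 h3 h4] [k1 k2 k3 k4]; rewrite /rint /hint /vint !cintD //; ring.
Qed.

Lemma rintZ (k : C) f a b c d : edges_cont f a b c d ->
  rint (fun z => k * f z) a b c d = k * rint f a b c d.
Proof. by move=> [h1 h2 h3 h4]; rewrite /rint /hint /vint !cintZ //; ring. Qed.

Lemma rint_sum (f : nat -> C -> C) a b c d N : (forall n, edges_cont (f n) a b c d) ->
  rint (fun z => \sum_(n < N) f n z) a b c d = \sum_(n < N) rint (f n) a b c d.
Proof.
move=> hf; elim: N => [|N IHN].
  rewrite big_ord0; have -> : (fun z : C => \sum_(n < 0) f n z) = (fun z => 0 * f 0%N z).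
    by apply/funext => z; rewrite big_ord0 mul0r.
  by rewrite rintZ // mul0r.
rewrite big_ord_recr /= -IHN -(rintD (edges_cont_sum N hf) (hf N)).
congr rint; apply/funext => z; exact: big_ord_recr.
Qed.

Lemma rint_bound f a b c d (M : R) : edges_cont f a b c d -> a <= b -> c <= d -> 0 <= M ->
  (forall t, a <= t -> t <= b -> modulus (f (t +i* c)) <= M /\ modulus (f (t +i* d)) <= M) ->
  (forall t, c <= t -> t <= d -> modulus (f (a +i* t)) <= M /\ modulus (f (b +i* t)) <= M) ->
  modulus (rint f a b c d) <= 4 * M * ((b - a) + (d - c)).
Proof.
move=> [h1 h2 h3 h4] ab cd M0 hM vM.
have b1 : modulus (hint f c a b) <= 2 * M * (b - a).
  by apply: cint_bound => // t at_ tb; case: (hM t at_ tb).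
have b2 : modulus (hint f d a b) <= 2 * M * (b - a).
  by apply: cint_bound => // t at_ tb; case: (hM t at_ tb).
have b3 : modulus (vint f a c d) <= 2 * M * (d - c).
  by apply: cint_bound => // t at_ tb; case: (vM t at_ tb).
have b4 : modulus (vint f b c d) <= 2 * M * (d - c).
  by apply: cint_bound => // t at_ tb; case: (vM t at_ tb).
have i1 : modulus (iu : C) = 1 by rewrite /= expr0n expr1n add0r sqrtr1.
apply: le_trans (modulusD _ _) _; rewrite modulusM i1 mul1r.
have m1 := modulusB (hint f c a b) (hint f d a b).
have m2 := modulusB (vint f b c d) (vint f a c d).
lra.
Qed.

Lemma rint_hsplit f a b c d x : continuous (f : C^o -> C^o) -> a <= x -> x <= b ->
  rint f a b c d = rint f a x c d + rint f x b c d.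
Proof.
move=> cf ax xb; have [h1 h2 h3 h4] := continuous_edges a b c d cf.
rewrite /rint /hint (cint_split h1 ax xb) (cint_split h2 ax xb); ring.
Qed.

Lemma rint_vsplit f a b c d y : continuous (f : C^o -> C^o) -> c <= y -> y <= d ->
  rint f a b c d = rint f a b c y + rint f a b y d.
Proof.
move=> cf cy yd; have [h1 h2 h3 h4] := continuous_edges a b c d cf.
rewrite /rint /vint (cint_split h3 cy yd) (cint_split h4 cy yd); ring.
Qed.

(* The primitive need only exist along the four edges, so the lemma applies to
   [z ^- n.+2], whose pole is inside the rectangle. *)
Lemma rint_primitive (F f : C -> C) a b c d : a <= b -> c <= d -> edges_cont f a b c d ->
  (forall t : R, [/\ is_derive (t +i* c : C^o) 1 (F : C^o -> C^o) (f (t +i* c)),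
    is_derive (t +i* d : C^o) 1 (F : C^o -> C^o) (f (t +i* d)),
    is_derive (a +i* t : C^o) 1 (F : C^o -> C^o) (f (a +i* t)) &
    is_derive (b +i* t : C^o) 1 (F : C^o -> C^o) (f (b +i* t))]) ->
  rint f a b c d = 0.
Proof.
move=> ab cd [h1 h2 h3 h4] dF.
have hE y : pcont (fun t : R => f (t +i* y)) ->
    (forall t : R, is_derive (t +i* y : C^o) 1 (F : C^o -> C^o) (f (t +i* y))) ->
    hint f y a b = F (b +i* y) - F (a +i* y).
  move=> hc hd; have e := @cint_FTC R F f (0 +i* y) 1 a b ab.
  have e1 (t : R) : is_derive ((0 +i* y) + t%:C * 1 : C^o) 1 (F : C^o -> C^o)
      (f ((0 +i* y) + t%:C * 1)) by rewrite -hlineE; exact: hd.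
  have e2 : pcont (fun t => f ((0 +i* y) + t%:C * 1)) by under eq_fun do rewrite -hlineE.
  have := e e1 e2; rewrite -!hlineE => <-.
  by rewrite /hint; congr cint; apply/funext => t; rewrite mul1r hlineE.
have vE x : pcont (fun t : R => f (x +i* t)) ->
    (forall t : R, is_derive (x +i* t : C^o) 1 (F : C^o -> C^o) (f (x +i* t))) ->
    iu * vint f x c d = F (x +i* d) - F (x +i* c).
  move=> hc hd; have e := @cint_FTC R F f x%:C iu c d cd.
  have e1 (t : R) : is_derive (x%:C + t%:C * iu : C^o) 1 (F : C^o -> C^o)
      (f (x%:C + t%:C * iu)) by rewrite -vlineE; exact: hd.
  have e2 : pcont (fun t => f (x%:C + t%:C * iu)) by under eq_fun do rewrite -vlineE.
  have := e e1 e2; rewrite -!vlineE => <-.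
  by rewrite /vint -cintZ //; congr cint; apply/funext => t; rewrite vlineE.
have d1 t : is_derive (t +i* c : C^o) 1 (F : C^o -> C^o) (f (t +i* c)) by case: (dF t).
have d2 t : is_derive (t +i* d : C^o) 1 (F : C^o -> C^o) (f (t +i* d)) by case: (dF t).
have d3 t : is_derive (a +i* t : C^o) 1 (F : C^o -> C^o) (f (a +i* t)) by case: (dF t).
have d4 t : is_derive (b +i* t : C^o) 1 (F : C^o -> C^o) (f (b +i* t)) by case: (dF t).
rewrite /rint mulrBr (hE c h1 d1) (hE d h2 d2) (vE a h3 d3) (vE b h4 d4); ring.
Qed.

Lemma rint_affine (k l : C) a b c d : a <= b -> c <= d ->
  rint (fun z => k + l * z) a b c d = 0.
Proof.
move=> ab cd.
have dF (z : C) : is_derive (z : C^o) 1 ((fun z => k * z + l / 2 * (z * z)) : C^o -> C^o) (k + l * z).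
  have e1 := @is_deriveM C C^o id id z 1 1 1 (is_derive_id _ _) (is_derive_id _ _).
  have e2 := @is_deriveZ C C^o C^o _ (l / 2) _ _ _ e1.
  have e3 := @is_deriveZ C C^o C^o _ k _ _ _ (is_derive_id (z : C^o) (1 : C^o)).
  have e4 := is_deriveD e3 e2.
  by apply: (is_derive_eq e4); rewrite /GRing.scale /=; field.
have ce : edges_cont (fun z => k + l * z) a b c d.
  apply: continuous_edges => w; apply/continuous_modulusP => e e0.
  have l0 : 0 < modulus l + 1 by rewrite ltr_wpDl ?modulus_ge0.
  exists (e / (modulus l + 1)); first by rewrite divr_gt0.
  move=> x; rewrite ltr_pdivlMr // => hx.
  have -> : k + l * x - (k + l * w) = (x - w) * l by ring.
  rewrite modulusM; apply: le_lt_trans hx; rewrite ler_wpM2l ?modulus_ge0 //.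
  by rewrite lerDl.
exact (@rint_primitive (fun z => k * z + l / 2 * (z * z)) (fun z => k + l * z)
  a b c d ab cd ce (fun t => And4 (dF _) (dF _) (dF _) (dF _))).
Qed.

Lemma nested_intervals (u : nat -> R) (p : R) : 0 <= p ->
  (forall k, u k <= u k.+1) -> (forall k, u k.+1 + p / 2 ^+ k.+1 <= u k + p / 2 ^+ k) ->
  exists x, forall k, u k <= x /\ x <= u k + p / 2 ^+ k.
Proof.
move=> p0 hu hv.
have p2 k : 0 <= p / 2 ^+ k by rewrite divr_ge0 // exprn_ge0.
have um k j : u k <= u (k + j)%N.
  by elim: j => [|j IHj]; rewrite ?addn0 // addnS; exact: le_trans (hu _).
have vm k j : u (k + j)%N + p / 2 ^+ (k + j) <= u k + p / 2 ^+ k.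
  by elim: j => [|j IHj]; rewrite ?addn0 // addnS; apply: le_trans (hv _) IHj.
have uv k j : u j <= u k + p / 2 ^+ k.
  have [kj|jk] := leqP k j.
    by have := vm k (j - k)%N; rewrite subnKC //; have := p2 j; lra.
  by have := um j (k - j)%N; rewrite subnKC ?(ltnW jk) //; have := p2 k; lra.
pose E := [set u k | k in [set: nat]].
have E0 : E !=set0 by exists (u 0%N); exists 0%N.
have Eb k : ubound E (u k + p / 2 ^+ k) by move=> _ [j _ <-].
exists (sup E) => k; split.
  by apply: ub_le_sup; [exists (u 0%N + p / 2 ^+ 0); exact: Eb|exists k].
exact: ge_sup.
Qed.

End Rectangles.

(** * Goursat's theorem and Cauchy's formula *)

Section Goursat.
Context {R : realType}.
Local Notation C := R[i].
Local Notation edges_cont := (@edges_cont R).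

Lemma continuous_affine (k l : C) : continuous ((fun z => k + l * z) : C^o -> C^o).
Proof.
move=> w; apply/continuous_modulusP => e e0.
have l0 : 0 < modulus l + 1 by rewrite ltr_wpDl ?modulus_ge0.
exists (e / (modulus l + 1)); first by rewrite divr_gt0.
move=> x; rewrite ltr_pdivlMr // => hx.
have -> : k + l * x - (k + l * w) = (x - w) * l by ring.
rewrite modulusM; apply: le_lt_trans hx; rewrite ler_wpM2l ?modulus_ge0 //.
by rewrite lerDl.
Qed.

Lemma rint_ext (f g : C -> C) a b c d :
  (forall t, [/\ f (t +i* c) = g (t +i* c), f (t +i* d) = g (t +i* d),
     f (a +i* t) = g (a +i* t) & f (b +i* t) = g (b +i* t)]) ->
  rint f a b c d = rint g a b c d.
Proof.
move=> h; rewrite /rint /hint /vint.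
by congr (cint _ _ _ - cint _ _ _ + _ * (cint _ _ _ - cint _ _ _));
  apply/funext => t; case: (h t).
Qed.

Lemma modulus_sum4_lt (x y z w : C) (e : R) :
  modulus x < e -> modulus y < e -> modulus z < e -> modulus w < e ->
  modulus (x + y + (z + w)) < 4 * e.
Proof.
move=> hx hy hz hw; have := modulusD (x + y) (z + w).
have := modulusD x y; have := modulusD z w; lra.
Qed.

(** Bisection: one quarter always keeps at least a quarter of the integral. Near the limit point [f]
    is affine up to an error small compared with the side, and the affine part integrates to zero,
    so the integral is small compared with the squared side. *)
Lemma goursat (f : C -> C) a b c d : continuous (f : C^o -> C^o) -> a <= b -> c <= d ->
  (forall x y, a <= x -> x <= b -> c <= y -> y <= d ->
     exists l : C, is_derive (x +i* y : C^o) 1 (f : C^o -> C^o) l) ->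
  rint f a b c d = 0.
Proof.
move=> cf ab cd df; apply: modulus_eq0; apply/eqP; apply: contraT => I0.
set I := modulus _ in I0.
have {I0} Ip : 0 < I by rewrite lt_def I0 modulus_ge0.
pose p := b - a; pose q := d - c.
have p0 : 0 <= p by rewrite subr_ge0.
have q0 : 0 <= q by rewrite subr_ge0.
have half (s : R) k : s / 2 ^+ k = s / 2 ^+ k.+1 + s / 2 ^+ k.+1.
  by rewrite exprS; field; rewrite expf_neq0.
have t0 (s : R) k : 0 <= s -> 0 <= s / 2 ^+ k by move=> s0; rewrite divr_ge0 // exprn_ge0.
pose Bad k (z : R * R) := I / 4 ^+ k <=
  modulus (rint f z.1 (z.1 + p / 2 ^+ k) z.2 (z.2 + q / 2 ^+ k)).
have step (kz : nat * (R * R)) : exists z' : R * R,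
   [/\ kz.2.1 <= z'.1, z'.1 <= kz.2.1 + p / 2 ^+ kz.1.+1,
       kz.2.2 <= z'.2, z'.2 <= kz.2.2 + q / 2 ^+ kz.1.+1 &
       Bad kz.1 kz.2 -> Bad kz.1.+1 z'].
  case: kz => k [x y]; rewrite /Bad /=.
  set sp := p / 2 ^+ k.+1; set sq := q / 2 ^+ k.+1.
  have sp0 : 0 <= sp by exact: t0.
  have sq0 : 0 <= sq by exact: t0.
  have [hb|hb] := lerP (I / 4 ^+ k) (modulus (rint f x (x + p / 2 ^+ k) y (y + q / 2 ^+ k))); last first.
    (* The choice function has to be total: a rectangle that is not bad returns its own corner. *)
    by exists (x, y); rewrite /= !lexx !lerDl; split=> //; rewrite leNgt hb.
  move: hb; rewrite (half p) (half q) -/sp -/sq !addrA => hb.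
  have xs : x <= x + sp by rewrite lerDl.
  have ys : y <= y + sq by rewrite lerDl.
  apply: contrapT => hno.
  have small x' y' : x <= x' -> x' <= x + sp -> y <= y' -> y' <= y + sq ->
      modulus (rint f x' (x' + sp) y' (y' + sq)) < I / 4 ^+ k.+1.
    move=> h1 h2 h3 h4; rewrite ltNge; apply/negP => h5; apply: hno.
    by exists (x', y').
  have s1 := small x y (lexx _) xs (lexx _) ys.
  have s2 := small (x + sp) y xs (lexx _) (lexx _) ys.
  have s3 := small x (y + sq) (lexx _) xs ys (lexx _).
  have s4 := small (x + sp) (y + sq) xs (lexx _) ys (lexx _).
  have xs' : x + sp <= x + sp + sp by rewrite lerDl.
  have ys' : y + sq <= y + sq + sq by rewrite lerDl.
  move: hb; rewrite (rint_hsplit _ _ cf xs xs') !(rint_vsplit _ _ cf ys ys').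
  have e4 : I / 4 ^+ k = 4 * (I / 4 ^+ k.+1) by rewrite exprS; field; rewrite expf_neq0.
  rewrite e4 leNgt => /negP; apply.
  exact: modulus_sum4_lt.
have [st hst] := choice step.
pose u := fix u k := if k is j.+1 then st (j, u j) else (a, c).
have hu k : [/\ (u k).1 <= (u k.+1).1, (u k.+1).1 <= (u k).1 + p / 2 ^+ k.+1,
    (u k).2 <= (u k.+1).2 & (u k.+1).2 <= (u k).2 + q / 2 ^+ k.+1].
  by have [h1 h2 h3 h4 _] := hst (k, u k).
have hB k : Bad k (u k).
  elim: k => [|k IHk]; last by have [_ _ _ _] := hst (k, u k); exact.
  by rewrite /Bad /= expr0 !divr1 /p /q !subrKC.
have [x hx] : exists x, forall k, (u k).1 <= x /\ x <= (u k).1 + p / 2 ^+ k.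
  apply: (nested_intervals (u := fun k => (u k).1)) p0 _ _ => k; have [h1 h2 h3 h4] := hu k => //.
  by rewrite (half p k) addrA lerD2r.
have [y hy] : exists y, forall k, (u k).2 <= y /\ y <= (u k).2 + q / 2 ^+ k.
  apply: (nested_intervals (u := fun k => (u k).2)) q0 _ _ => k; have [h1 h2 h3 h4] := hu k => //.
  by rewrite (half q k) addrA lerD2r.
have [l hl] : exists l : C, is_derive (x +i* y : C^o) 1 (f : C^o -> C^o) l.
  have := hx 0%N; have := hy 0%N; rewrite /= expr0 !divr1 /p /q !subrKC => -[h1 h2] [h3 h4].
  exact: df.
pose s := p + q; have s0 : 0 <= s by rewrite addr_ge0.
have ss : 0 < 8 * (s ^+ 2 + 1) by rewrite mulr_gt0 // ltr_wpDl ?sqr_ge0.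
(* Makes the final bound [4 e s^2] at most half of [I]. *)
pose e := I / (8 * (s ^+ 2 + 1)).
have e0 : 0 < e by rewrite divr_gt0.
have eE : e * (8 * (s ^+ 2 + 1)) = I by rewrite divfK // gt_eqF.
have [dl d0 hd] := is_derive_modulusP hl e0.
have [k hk] := exists_natr_gt (s / dl).
have sk : s / 2 ^+ k < dl.
  rewrite ltr_pdivrMr ?exprn_gt0 //; move: hk; rewrite ltr_pdivrMr // => hk.
  rewrite mulrC; apply: lt_le_trans hk _; rewrite ler_wpM2r ?(ltW d0) //.
  by rewrite -natrX ler_nat ltnW // ltn_expl.
set ux := (u k).1; set uy := (u k).2.
pose A := f (x +i* y) - l * (x +i* y).
pose r z := f z + -1 * (A + l * z).
have := hB k; rewrite /Bad -/ux -/uy.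
have uxp : ux <= ux + p / 2 ^+ k by rewrite lerDl t0.
have uyq : uy <= uy + q / 2 ^+ k by rewrite lerDl t0.
have ca := continuous_edges ux (ux + p / 2 ^+ k) uy (uy + q / 2 ^+ k) (@continuous_affine A l).
have cfe := continuous_edges ux (ux + p / 2 ^+ k) uy (uy + q / 2 ^+ k) cf.
have cr : edges_cont r ux (ux + p / 2 ^+ k) uy (uy + q / 2 ^+ k).
  exact: (edges_contD cfe (edges_contM (edges_cont_cst (-1) _ _ _ _) ca)).
have -> : rint f ux (ux + p / 2 ^+ k) uy (uy + q / 2 ^+ k) =
    rint r ux (ux + p / 2 ^+ k) uy (uy + q / 2 ^+ k).
  rewrite -[RHS]add0r -(rint_affine A l uxp uyq) -(rintD ca cr).
  by apply: rint_ext => t; split; rewrite /r; ring.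
move=> hI.
have near z : ux <= complex.Re z -> complex.Re z <= ux + p / 2 ^+ k ->
    uy <= complex.Im z -> complex.Im z <= uy + q / 2 ^+ k -> modulus (r z) <= e * (s / 2 ^+ k).
  move=> h1 h2 h3 h4.
  have [k1 k2] := hx k; have [k3 k4] := hy k.
  have zz : modulus (z - (x +i* y)) <= s / 2 ^+ k.
    apply: le_trans (modulus_le_ReIm _) _; rewrite /s mulrDl; case: z h1 h2 h3 h4 => zx zy /=.
    rewrite -/ux in k1 k2; rewrite -/uy in k3 k4 => h1 h2 h3 h4.
    by apply: lerD; rewrite ler_distlC; apply/andP; split; lra.
  have -> : r z = f z - f (x +i* y) - l * (z - (x +i* y)) by rewrite /r /A; ring.
  apply: le_trans (hd z (le_lt_trans zz sk)) _.
  by rewrite ler_wpM2l // ltW.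
have es0 : 0 <= e * (s / 2 ^+ k) by rewrite mulr_ge0 ?t0 // ltW.
have := @rint_bound R r ux (ux + p / 2 ^+ k) uy (uy + q / 2 ^+ k) _ cr uxp uyq es0.
have pk := t0 _ k p0; have qk := t0 _ k q0.
move=> /(_ _ _)/(le_trans hI) hI'.
have {}hI' : I / 4 ^+ k <= 4 * (e * (s / 2 ^+ k)) * (ux + p / 2 ^+ k - ux + (uy + q / 2 ^+ k - uy)).
  apply: hI' => t ta tb; split.
  - exact: (near (t +i* uy) ta tb (lexx _) uyq).
  - exact: (near (t +i* (uy + q / 2 ^+ k)) ta tb uyq (lexx _)).
  - exact: (near (ux +i* t) (lexx _) uxp ta tb).
  - exact: (near ((ux + p / 2 ^+ k) +i* t) uxp (lexx _) ta tb).
move: hI'; rewrite (_ : ux + p / 2 ^+ k - ux + _ = s / 2 ^+ k); last by rewrite /s; ring.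
have p2 : 0 < 2 ^+ k :> R by rewrite exprn_gt0.
have -> : (4 : R) ^+ k = 2 ^+ k * 2 ^+ k by rewrite -exprMn; congr (_ ^+ _); ring.
rewrite ler_pdivrMr ?mulr_gt0 //.
have -> : 4 * (e * (s / 2 ^+ k)) * (s / 2 ^+ k) * (2 ^+ k * 2 ^+ k) = 4 * (e * s ^+ 2).
  by field; rewrite gt_eqF.
have := mulr_ge0 (ltW e0) (sqr_ge0 s); rewrite -eE; lra.
Qed.

(** Goursat disposes of everything but a small square around [w], on which [g] is bounded by
    continuity; its contribution is proportional to the side. *)
Lemma rint_removable (g : C -> C) (w : C) a b c d : continuous (g : C^o -> C^o) ->
  a < complex.Re w -> complex.Re w < b -> c < complex.Im w -> complex.Im w < d ->
  (forall z, z != w -> exists l : C, is_derive (z : C^o) 1 (g : C^o -> C^o) l) ->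
  rint g a b c d = 0.
Proof.
move=> cg aw wb cw wd dg.
have off x y : x != complex.Re w \/ y != complex.Im w -> exists l,
    is_derive (x +i* y : C^o) 1 (g : C^o -> C^o) l.
  move=> h; apply: dg; apply/eqP => e; move: h; rewrite -e /= !eqxx; by case.
have [dl d0 hd] := (proj1 (continuous_modulusP g w)) (cg w) 1 ltr01.
pose M := modulus (g w) + 1.
have M0 : 0 < M by rewrite ltr_wpDl ?modulus_ge0.
have bound z : modulus (z - w) < dl -> modulus (g z) <= M.
  move=> /hd h; have -> : g z = g w + (g z - g w) by ring.
  by apply: le_trans (modulusD _ _) _; rewrite lerD2l ltW.
pose m := Num.min (Num.min (complex.Re w - a) (b - complex.Re w))
  (Num.min (Num.min (complex.Im w - c) (d - complex.Im w)) (dl / 2)).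
have m0 : 0 < m by rewrite !lt_min !subr_gt0 aw wb cw wd divr_gt0.
have key s : 0 < s -> s < m -> modulus (rint g a b c d) <= 16 * M * s.
  move=> s0; rewrite !lt_min => /andP[/andP[h1 h2] /andP[/andP[h3 h4] h5]].
  set x := complex.Re w in aw wb off h1 h2 *; set y := complex.Im w in cw wd off h3 h4 *.
  have x1 : a <= x - s by lra.
  have x2 : x - s <= x + s by lra.
  have x3 : x + s <= b by lra.
  have y1 : c <= y - s by lra.
  have y2 : y - s <= y + s by lra.
  have y3 : y + s <= d by lra.
  have cd : c <= d by lra.
  rewrite (rint_hsplit _ _ cg x1 (le_trans x2 x3)) (rint_hsplit _ _ cg x2 x3).
  rewrite (rint_vsplit (x - s) (x + s) cg y1 (le_trans y2 y3)) (rint_vsplit (x - s) (x + s) cg y2 y3).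
  rewrite (goursat cg x1 cd) ?add0r; last first.
    by move=> x' y' _ hx' _ _; apply: off; left; rewrite lt_eqF //; lra.
  rewrite (goursat cg x3 cd) ?addr0; last first.
    by move=> x' y' hx' _ _ _; apply: off; left; rewrite gt_eqF //; lra.
  rewrite (goursat cg x2 y1) ?add0r; last first.
    by move=> x' y' _ _ _ hy'; apply: off; right; rewrite lt_eqF //; lra.
  rewrite (goursat cg x2 y3) ?addr0; last first.
    by move=> x' y' _ _ hy' _; apply: off; right; rewrite gt_eqF //; lra.
  have inside x' y' : x - s <= x' -> x' <= x + s -> y - s <= y' -> y' <= y + s ->
      modulus (g (x' +i* y')) <= M.
    move=> k1 k2 k3 k4; apply: bound; apply: le_lt_trans (modulus_le_ReIm _) _.
    have -> : complex.Re (x' +i* y' - w) = x' - x by rewrite /x; case: (w).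
    have -> : complex.Im (x' +i* y' - w) = y' - y by rewrite /y; case: (w).
    have a1 : `|x' - x| <= s by rewrite ler_distlC; apply/andP; split; lra.
    have a2 : `|y' - y| <= s by rewrite ler_distlC; apply/andP; split; lra.
    lra.
  have := rint_bound (continuous_edges (x - s) (x + s) (y - s) (y + s) cg) x2 y2 (ltW M0).
  move=> h; apply: le_trans (h _ _) _.
  - move=> t k1 k2; split; first exact: (inside t (y - s) k1 k2 (lexx _) y2).
    exact: (inside t (y + s) k1 k2 y2 (lexx _)).
  - move=> t k1 k2; split; first exact: (inside (x - s) t (lexx _) x2 k1 k2).
    exact: (inside (x + s) t x2 (lexx _) k1 k2).
  - lra.
apply: modulus_eq0; apply/eqP; apply: contraT => I0.
set I := modulus _ in I0 key.
have {I0} Ip : 0 < I by rewrite lt_def I0 modulus_ge0.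
pose s := Num.min (m / 2) (I / (32 * M)).
have s0 : 0 < s by rewrite lt_min !divr_gt0 // mulr_gt0.
have sm : s < m by apply: le_lt_trans (_ : m / 2 < m); [rewrite ge_min lexx|lra].
have := key s s0 sm.
have : s <= I / (32 * M) by rewrite ge_min lexx orbT.
rewrite ler_pdivlMr ?mulr_gt0 //; lra.
Qed.

Lemma edges_avoid (w : C) a b c d t :
  a < complex.Re w -> complex.Re w < b -> c < complex.Im w -> complex.Im w < d ->
  [/\ t +i* c != w, t +i* d != w, a +i* t != w & b +i* t != w].
Proof.
by case: w => x y /= h1 h2 h3 h4; split; rewrite eq_complex /= negb_and;
  rewrite ?(lt_eqF h1) ?(gt_eqF h2) ?(lt_eqF h3) ?(gt_eqF h4) ?orbT.
Qed.

Lemma edges_cont_inv (w : C) a b c d :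
  a < complex.Re w -> complex.Re w < b -> c < complex.Im w -> complex.Im w < d ->
  edges_cont (fun z => (z - w)^-1) a b c d.
Proof.
move=> h1 h2 h3 h4; have av t := edges_avoid t h1 h2 h3 h4.
have [k1 k2 k3 k4] : edges_cont (fun z => z - w) a b c d.
  apply: continuous_edges.
  have -> : (fun z : C => z - w) = (fun z => - w + 1 * z).
    by apply/funext => z; rewrite mul1r addrC.
  exact: continuous_affine.
by split; apply: pcontV => // t; rewrite subr_eq0; case: (av t).
Qed.

(** The difference quotient, completed by the derivative at [w], falls under [rint_removable]. The
    integral of [1 / (z - w)] is left unevaluated. *)
Theorem cauchy_formula (f : C -> C) (w : C) a b c d : entire f ->
  a < complex.Re w -> complex.Re w < b -> c < complex.Im w -> complex.Im w < d ->
  rint (fun z => f z * (z - w)^-1) a b c d = f w * rint (fun z => (z - w)^-1) a b c d.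
Proof.
move=> ef h1 h2 h3 h4; have cf := entire_continuous ef.
pose l := 'D_1 (f : C^o -> C^o) w.
have dw : is_derive (w : C^o) 1 (f : C^o -> C^o) l by apply: derivableP; exact: ef.
pose g z := if z == w then l else (f z - f w) * (z - w)^-1.
have dg z : z != w -> exists l : C, is_derive (z : C^o) 1 (g : C^o -> C^o) l.
  move=> zw.
  have d1 : derivable (f - cst (f w) : C^o -> C^o) z 1.
    by apply: derivableB; [exact: ef|exact: derivable_cst].
  have d2 : derivable ((fun z => (z - w)^-1) : C^o -> C^o) z 1.
    apply: derivableV; first by rewrite subr_eq0.
    by apply: derivableB; [exact: derivable_id|exact: derivable_cst].
  have d3 := derivableP (derivableM d1 d2).
  eexists; apply: near_eq_is_derive d3.
  have : nbhs (z : C^o) (fun z => z != w).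
    apply/nbhs_ballP; exists `|z - w| => /=; first by rewrite normr_gt0 subr_eq0.
    move=> y; rewrite /ball /= => hy; apply/eqP => yw; move: hy; rewrite /ball_ yw.
    by rewrite /= ltxx.
  by apply: filterS => y /negbTE yw; rewrite /g yw.
have cg : continuous (g : C^o -> C^o).
  move=> z; have [->|zw] := eqVneq z w; last first.
    apply: differentiable_continuous; apply/derivable1_diffP.
    by have [k hk] := dg z zw; case: hk.
  apply/continuous_modulusP => e e0.
  have e2 : 0 < e / 2 by rewrite divr_gt0.
  have [dl d0 hd] := is_derive_modulusP dw e2.
  have gw : g w = l by rewrite /g eqxx.
  exists dl => // y yw; rewrite gw; have [->|yw'] := eqVneq y w.
    by rewrite gw subrr modulus0.
  rewrite /g (negbTE yw').
  have y0 : y - w != 0 by rewrite subr_eq0.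
  have -> : (f y - f w) * (y - w)^-1 - l = (f y - f w - l * (y - w)) * (y - w)^-1 by field.
  rewrite modulusM modulusV ltr_pdivrMr ?modulus_gt0 //.
  apply: le_lt_trans (hd y yw) _; rewrite ltr_pM2r ?modulus_gt0 //; lra.
have ci := edges_cont_inv h1 h2 h3 h4.
have -> : rint (fun z => f z * (z - w)^-1) a b c d = rint (fun z => g z + f w * (z - w)^-1) a b c d.
  apply: rint_ext => t; have [k1 k2 k3 k4] := edges_avoid t h1 h2 h3 h4.
  by split; rewrite /g ifN // -mulrDl subrK.
rewrite rintD; last 2 first.
- exact: continuous_edges.
- exact: (edges_contM (edges_cont_cst (f w) _ _ _ _) ci).
by rewrite (rint_removable cg h1 h2 h3 h4 dg) add0r (rintZ _ ci).
Qed.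

End Goursat.

(** * Taylor expansion of entire functions *)

Section Taylor.
Context {R : realType}.
Local Notation C := R[i].
Local Notation mu := (@lebesgue_measure R).

Lemma pcont_bounded (u : R -> C) a b : a <= b -> pcont u ->
  exists2 B : R, 0 <= B & forall t, a <= t -> t <= b -> modulus (u t) <= B.
Proof.
move=> ab hu.
have bd (g : R -> R) : continuous g -> exists2 B : R, 0 <= B &
    forall t, a <= t -> t <= b -> `|g t| <= B.
  move=> cg; have cn : continuous (fun t : R => `|g t|) by move=> t; exact: cvg_norm (cg t).
  have [c _ hc] := @EVT_max R (fun t => `|g t|) a b ab (continuous_subspaceT cn).
  by exists `|g c| => // t at_ tb; apply: hc; rewrite in_itv /= at_.
have [B1 B10 h1] := bd _ (pcont_Re hu); have [B2 B20 h2] := bd _ (pcont_Im hu).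
exists (B1 + B2); first by rewrite addr_ge0.
move=> t at_ tb; apply: le_trans (modulus_le_ReIm _) _.
by apply: lerD; [exact: h1|exact: h2].
Qed.

Lemma geometric_sum_le2 (x : R) n : 0 <= x -> x <= 2^-1 -> \sum_(i < n) x ^+ i <= 2.
Proof.
move=> x0 x2; elim: n => [|n IHn]; first by rewrite big_ord0.
rewrite big_ord_recl expr0; under eq_bigr do rewrite lift0 exprS.
rewrite -mulr_sumr; have := ler_wpM2l x0 IHn.
have : x * 2 <= 1 by lra.
lra.
Qed.

Lemma geometric_kernel (z w : C) N : z != 0 -> z != w ->
  (z - w)^-1 = \sum_(n < N) w ^+ n * z^-1 ^+ n.+1 + (w * z^-1) ^+ N * (z - w)^-1.
Proof.
move=> z0 zw; have zw0 : z - w != 0 by rewrite subr_eq0.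
elim: N => [|N IHN]; first by rewrite big_ord0 expr0 mul1r add0r.
rewrite {1}IHN big_ord_recr /= -addrA; congr (_ + _).
rewrite !exprSr exprMn -!mulrA -mulrDr -mulrDr; congr (_ * (_ * _)).
by field; rewrite ?z0 ?zw0.
Qed.

Section Square.
Variable r : R.
Hypothesis r0 : 0 < r.

Let rr : - r <= r.
Proof. by rewrite (le_trans _ (ltW r0)) // oppr_le0 ltW. Qed.

Local Notation edges f := (edges_cont f (- r) r (- r) r).
Local Notation sq f := (rint f (- r) r (- r) r).

Let inside (w : C) : modulus w < r ->
  [/\ - r < complex.Re w, complex.Re w < r, - r < complex.Im w & complex.Im w < r].
Proof.
move=> wr; have h1 := le_lt_trans (modulus_ge_Re w) wr.
have h2 := le_lt_trans (modulus_ge_Im w) wr.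
by move: h1 h2; rewrite !ltr_norml => /andP[? ?] /andP[? ?].
Qed.

Lemma edges_cont_invX n : edges (fun z : C => z^-1 ^+ n).
Proof.
have e1 : edges (fun z : C => z^-1).
  have [|h1 h2 h3 h4] := @inside 0; first by rewrite modulus0.
  have -> : (fun z : C => z^-1) = (fun z => (z - 0)^-1).
    by apply/funext => z; rewrite subr0.
  exact: edges_cont_inv.
elim: n => [|n IHn]; first exact: edges_cont_cst.
have -> : (fun z : C => z^-1 ^+ n.+1) = (fun z => z^-1 * z^-1 ^+ n).
  by apply/funext => z; rewrite exprS.
exact: (edges_contM e1 IHn).
Qed.

Lemma edges_cont_1invX n : edges (fun z : C => 1 * z^-1 ^+ n).
Proof.
have -> : (fun z : C => 1 * z^-1 ^+ n) = (fun z => z^-1 ^+ n).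
  by apply/funext => z; rewrite mul1r.
exact: edges_cont_invX.
Qed.

Lemma edge_far t : r <= modulus (t +i* (- r)) /\ r <= modulus (t +i* r) /\
  r <= modulus ((- r) +i* t) /\ r <= modulus (r +i* t).
Proof.
have := modulus_ge_Im (t +i* (- r)); have := modulus_ge_Im (t +i* r).
have := modulus_ge_Re ((- r) +i* t); have := modulus_ge_Re (r +i* t).
by rewrite /= !normrN !(gtr0_norm r0).
Qed.

Lemma square_bound (f : C -> C) (B : R) : edges f -> 0 <= B ->
  (forall z, r <= modulus z -> (exists t, [\/ z = t +i* (- r), z = t +i* r,
     z = (- r) +i* t | z = r +i* t] /\ - r <= t /\ t <= r) -> modulus (f z) <= B) ->
  modulus (sq f) <= 16 * r * B.
Proof.
move=> ef B0 hB; apply: le_trans (rint_bound ef rr rr B0 _ _) _; last by lra.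
- move=> t h1 h2; have [k1 [k2 [k3 k4]]] := edge_far t.
  by split; apply: hB => //; exists t; split => //; [exact: Or41|exact: Or42].
- move=> t h1 h2; have [k1 [k2 [k3 k4]]] := edge_far t.
  by split; apply: hB => //; exists t; split => //; [exact: Or43|exact: Or44].
Qed.

Lemma edges_bounded (f : C -> C) : edges f -> exists2 B : R, 0 <= B &
  forall z, (exists t, [\/ z = t +i* (- r), z = t +i* r,
     z = (- r) +i* t | z = r +i* t] /\ - r <= t /\ t <= r) -> modulus (f z) <= B.
Proof.
move=> [h1 h2 h3 h4]; have [B1 p1 b1] := pcont_bounded rr h1; have [B2 p2 b2] := pcont_bounded rr h2.
have [B3 p3 b3] := pcont_bounded rr h3; have [B4 p4 b4] := pcont_bounded rr h4.
exists (B1 + B2 + B3 + B4); first by rewrite !addr_ge0.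
move=> z [t [hz [t1 t2]]].
have := b1 t t1 t2; have := b2 t t1 t2; have := b3 t t1 t2; have := b4 t t1 t2.
by case: hz => ->; lra.
Qed.

Lemma coefficient_bound (f : C -> C) : edges f ->
  exists2 B : R, 0 <= B & forall n, modulus (sq (fun z : C => f z * z^-1 ^+ n.+1)) <= B / r ^+ n.
Proof.
move=> ef; have [B B0 hB] := edges_bounded ef.
exists (16 * B); first by rewrite mulr_ge0.
move=> n; have e1 := edges_contM ef (edges_cont_invX n.+1).
have rn : 0 < r ^+ n.+1 by rewrite exprn_gt0.
have h : 0 <= B / r ^+ n.+1 by rewrite divr_ge0 // ltW.
apply: le_trans (square_bound e1 h _) _.
  move=> z rz hz; rewrite modulusM modulusX modulusV; apply: ler_pM.
  - exact: modulus_ge0.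
  - by rewrite exprn_ge0 // invr_ge0 modulus_ge0.
  - exact: hB.
  - rewrite exprVn lef_pV2 ?posrE ?exprn_gt0 ?(lt_le_trans r0) //.
    by apply: lerXn2r; rewrite ?nnegrE ?modulus_ge0 // ltW.
rewrite exprS le_eqVlt; apply/orP; left; apply/eqP; field.
by rewrite expf_neq0 gt_eqF.
Qed.

Lemma kernel_expansion (f : C -> C) (w : C) : edges f -> modulus w < r ->
  cconv (fun N => \sum_(n < N) w ^+ n * sq (fun z : C => f z * z^-1 ^+ n.+1))
        (sq (fun z : C => f z * (z - w)^-1)).
Proof.
move=> ef wr; have [h1 h2 h3 h4] := inside wr.
have [B B0 hB] := edges_bounded ef.
pose dl := r - modulus w; have d0 : 0 < dl by rewrite subr_gt0.
have ei := edges_cont_inv h1 h2 h3 h4.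
have en n : edges (fun z : C => w ^+ n * (f z * z^-1 ^+ n.+1)).
  exact: (edges_contM (edges_cont_cst (w ^+ n) _ _ _ _) (edges_contM ef (edges_cont_invX n.+1))).
have eN N : edges (fun z : C => f z * (w ^+ N * z^-1 ^+ N * (z - w)^-1)).
  exact: (edges_contM ef (edges_contM
    (edges_contM (edges_cont_cst (w ^+ N) _ _ _ _) (edges_cont_invX N)) ei)).
have diff N : \sum_(n < N) w ^+ n * sq (fun z : C => f z * z^-1 ^+ n.+1) - sq (fun z : C => f z * (z - w)^-1) =
    - sq (fun z : C => f z * (w ^+ N * z^-1 ^+ N * (z - w)^-1)).
  have -> : sq (fun z : C => f z * (z - w)^-1) = sq (fun z : C =>
      (\sum_(n < N) w ^+ n * (f z * z^-1 ^+ n.+1)) + f z * (w ^+ N * z^-1 ^+ N * (z - w)^-1)).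
    have pt z : z != w -> r <= modulus z -> f z * (z - w)^-1 =
        \sum_(n < N) w ^+ n * (f z * z^-1 ^+ n.+1) + f z * (w ^+ N * z^-1 ^+ N * (z - w)^-1).
      move=> zw rz; have z0 : z != 0 by rewrite -modulus_gt0; exact: lt_le_trans rz.
      rewrite {1}(geometric_kernel N z0 zw) mulrDr mulr_sumr exprMn; congr (_ + _).
      by apply: eq_bigr => n _; rewrite mulrCA.
    apply: rint_ext => t; have [k1 k2 k3 k4] := edges_avoid t h1 h2 h3 h4.
    have [l1 [l2 [l3 l4]]] := edge_far t.
    by split; apply: pt.
  rewrite (rintD (edges_cont_sum N en) (eN N)) (rint_sum N en) opprD addrA -sumrB big1 ?sub0r // => n _.
  by rewrite (rintZ _ (edges_contM ef (edges_cont_invX n.+1))) subrr.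
have bound N : modulus (sq (fun z : C => f z * (w ^+ N * z^-1 ^+ N * (z - w)^-1))) <=
    16 * r * (B / dl) * (modulus w / r) ^+ N.
  have q0 : 0 <= (modulus w / r) ^+ N by rewrite exprn_ge0 // divr_ge0 ?modulus_ge0 // ltW.
  have b0 : 0 <= B / dl * (modulus w / r) ^+ N by rewrite mulr_ge0 // divr_ge0 // ltW.
  rewrite -mulrA; apply: (square_bound (eN N) b0) => z rz hz.
  have zd : dl <= modulus (z - w).
    by have := modulusD (z - w) w; rewrite subrK /dl; lra.
  have zp : 0 < modulus z := lt_le_trans r0 rz.
  have -> : B / dl * (modulus w / r) ^+ N = B * ((modulus w / r) ^+ N / dl) by ring.
  rewrite modulusM; apply: ler_pM; rewrite ?modulus_ge0 ?hB //.
  rewrite !modulusM !modulusX !modulusV -exprMn; apply: ler_pM.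
  - by rewrite exprn_ge0 // mulr_ge0 ?invr_ge0 ?modulus_ge0.
  - by rewrite invr_ge0 modulus_ge0.
  - apply: lerXn2r; rewrite ?nnegrE ?mulr_ge0 ?invr_ge0 ?modulus_ge0 // ?(ltW r0) //.
    by rewrite ler_wpM2l ?modulus_ge0 // lef_pV2 ?posrE.
  - by rewrite lef_pV2 ?posrE // (lt_le_trans d0 zd).
have lim0 : (16 * r * (B / dl)) * (modulus w / r) ^+ N @[N --> \oo] --> (0 : R).
  apply: cvg_geometric; rewrite normrM normfV (ger0_norm (modulus_ge0 w)) gtr0_norm //.
  by rewrite ltr_pdivrMr // mul1r.
apply: (cconv_squeeze _ lim0); apply: nearW => N.
by rewrite diff modulusN.
Qed.

Lemma is_derive_invX n (z : C) : z != 0 -> is_derive (z : C^o) 1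
  ((fun z => - n.+1%:R^-1 * z^-1 ^+ n.+1) : C^o -> C^o) (1 * z^-1 ^+ n.+2).
Proof.
move=> z0.
have d1 : is_derive (z : C^o) 1 ((fun z => z^-1) : C^o -> C^o) (- z ^- 2).
  apply: DeriveDef; first by apply: derivableV => //; exact: derivable_id.
  rewrite (@deriveV C C^o id z 1 z0 (@derivable_id C C^o z 1)).
  by rewrite derive_id /GRing.scale /= mulr1.
have d2 := @is_deriveX C C^o _ n.+1 _ _ _ d1.
have d3 := @is_deriveZ C C^o C^o _ (- n.+1%:R^-1) _ _ _ d2.
have e : (fun z : C => - n.+1%:R^-1 * z^-1 ^+ n.+1) =
    (- n.+1%:R^-1) \*: ((fun z => z^-1) : C^o -> C^o) ^+ n.+1.
  by apply/funext => y; rewrite /= exprfctE.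
rewrite e; apply: (is_derive_eq d3); rewrite /GRing.scale /= mul1r.
have nn : n.+1%:R != 0 :> C by rewrite pnatr_eq0.
rewrite -exprVn.
rewrite [LHS](_ : _ = (n.+1%:R^-1 * n.+1%:R) * (z^-1 ^+ n * z^-1 ^+ 2)); last by ring.
by rewrite mulVf // mul1r -exprD addn2.
Qed.

Lemma square_inv0 n : sq (fun z : C => 1 * z^-1 ^+ n.+2) = 0.
Proof.
have e := edges_cont_1invX n.+2.
have pt z : r <= modulus z -> z != 0 by rewrite -modulus_gt0; exact: lt_le_trans.
apply: (rint_primitive (F := fun z => - n.+1%:R^-1 * z^-1 ^+ n.+1) rr rr e) => t.
have [l1 [l2 [l3 l4]]] := edge_far t.
by split; apply: is_derive_invX; exact: pt.
Qed.

Lemma Im_rint (f : C -> C) a b c d : complex.Im (rint f a b c d) =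
  complex.Im (hint f c a b) - complex.Im (hint f d a b) +
  (complex.Re (vint f b c d) - complex.Re (vint f a c d)).
Proof.
rewrite /rint; case: (hint f c a b) (hint f d a b) (vint f b c d) (vint f a c d).
by move=> x1 y1 [x2 y2] [x3 y3] [x4 y4] /=; ring.
Qed.

(** Being nonzero is enough, the constant cancels in the Taylor coefficients. Each of the four edges
    contributes at least 1 to the imaginary part. *)
Lemma square_inv_neq0 : sq (fun z : C => 1 * z^-1 ^+ 1) != 0.
Proof.
have rr' : - r < r by rewrite (lt_trans _ r0) // oppr_lt0.
have [k1 k2 k3 k4] := edges_cont_1invX 1.
have ge (g : R -> R) : continuous g ->
   (forall t, - r <= t -> t <= r -> r / (t ^+ 2 + r ^+ 2) <= g t) ->
   1 <= \int[mu]_(t in `[- r, r]) g t.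
  move=> cg hg; have -> : 1 = \int[mu]_(t in `[- r, r]) cst (2 * r)^-1 t.
    by rewrite Rintegral_itv_cst //; field; rewrite gt_eqF.
  apply: le_Rintegral => //.
  - by apply: continuous_integrable => x; exact: cvg_cst.
  - exact: continuous_integrable.
  move=> t; rewrite /= in_itv /= => /andP[t1 t2]; apply: le_trans (hg t t1 t2).
  have r2 : 0 < r ^+ 2 by rewrite exprn_gt0.
  have t2r : t ^+ 2 <= r ^+ 2.
    by rewrite -(real_normK (num_real t)) ler_sqr ?nnegrE ?normr_ge0 ?(ltW r0) // ler_norml t1.
  rewrite ler_pdivlMr; last by rewrite ltr_wpDl ?sqr_ge0.
  have -> : (2 * r)^-1 * (t ^+ 2 + r ^+ 2) = (t ^+ 2 + r ^+ 2) / (2 * r) by rewrite mulrC.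
  rewrite ler_pdivrMr ?mulr_gt0 //; lra.
have ge' (g : R -> R) : continuous g ->
   (forall t, - r <= t -> t <= r -> r / (t ^+ 2 + r ^+ 2) <= - g t) ->
   \int[mu]_(t in `[- r, r]) g t <= -1.
  move=> cg hg; rewrite lerNr.
  have cn : continuous (fun t => - g t) by move=> t; apply: cvgN; exact: cg.
  have -> : - (\int[mu]_(t in `[- r, r]) g t) = \int[mu]_(t in `[- r, r]) (-1 * g t).
    by rewrite RintegralZl ?mulN1r //; exact: continuous_integrable.
  apply: ge => [t|t t1 t2]; last by rewrite mulN1r; exact: hg.
  by under eq_fun do rewrite mulN1r; exact: cn.
have invE (x y : R) : 1 * (x +i* y)^-1 ^+ 1 =
    (x / (x ^+ 2 + y ^+ 2)) +i* (- (y / (x ^+ 2 + y ^+ 2))) :> C by rewrite mul1r.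
have i1 : 1 <= complex.Im (hint (fun z : C => 1 * z^-1 ^+ 1) (- r) (- r) r).
  by apply: ge (pcont_Im k1) _ => t _ _; rewrite invE /= sqrrN mulNr opprK.
have i2 : complex.Im (hint (fun z : C => 1 * z^-1 ^+ 1) r (- r) r) <= -1.
  by apply: ge' (pcont_Im k2) _ => t _ _; rewrite invE /= opprK.
have i3 : complex.Re (vint (fun z : C => 1 * z^-1 ^+ 1) (- r) (- r) r) <= -1.
  by apply: ge' (pcont_Re k3) _ => t _ _; rewrite invE /= sqrrN mulNr opprK addrC.
have i4 : 1 <= complex.Re (vint (fun z : C => 1 * z^-1 ^+ 1) r (- r) r).
  by apply: ge (pcont_Re k4) _ => t _ _; rewrite invE /= addrC.
apply/eqP => e; have : complex.Im (sq (fun z : C => 1 * z^-1 ^+ 1)) = 0 by rewrite e.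
by rewrite Im_rint => h5; lra.
Qed.

(** Cauchy's formula combined with the expanded kernel, normalized by the integral [J] of
    [1 / z]. *)
Lemma taylor_disk (f : C -> C) : entire f -> exists (a : nat -> C) (B : R),
  (forall n, modulus (a n) <= B / r ^+ n) /\
  forall w, modulus w < r -> cconv (fun N => \sum_(n < N) a n * w ^+ n) (f w).
Proof.
move=> ef; have efe := continuous_edges (- r) r (- r) r (entire_continuous ef).
pose J := sq (fun z : C => 1 * z^-1 ^+ 1); have J0 : J != 0 := square_inv_neq0.
have [B B0 hB] := coefficient_bound efe.
pose c n := sq (fun z : C => f z * z^-1 ^+ n.+1).
exists (fun n => J^-1 * c n), (modulus J^-1 * B); split.
  by move=> n; rewrite modulusM -mulrA ler_wpM2l ?modulus_ge0 //; exact: hB.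
move=> w wr; have [h1 h2 h3 h4] := inside wr.
(* The expansion applied to the constant 1: all terms but the first have a primitive along the
   edges, so the integral does not depend on [w]. *)
have jw : sq (fun z : C => (z - w)^-1) = J.
  have k1 := kernel_expansion (edges_cont_cst 1 _ _ _ _) wr.
  have e1 : sq (fun z : C => 1 * (z - w)^-1) = sq (fun z : C => (z - w)^-1).
    by apply: rint_ext => t; split; rewrite mul1r.
  rewrite e1 in k1; apply: (cconv_unique k1).
  apply: (@cconv_ext _ (fun=> J)); last exact: cconv_cst.
  exists 1%N => // -[//|N] _; rewrite big_ord_recl expr0 mul1r big1 ?addr0 // => i _.
  by rewrite lift0 square_inv0 mulr0.
have k2 := kernel_expansion efe wr.
rewrite (cauchy_formula ef h1 h2 h3 h4) jw in k2.
have := cconvZ J^-1 k2; rewrite mulrCA mulVf // mulr1.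
apply: cconv_ext; apply: nearW => N; rewrite mulr_sumr; apply: eq_bigr => n _.
by rewrite /c; ring.
Qed.

End Square.

(** Once the lower coefficients vanish, evaluation at [q r] leaves [d n] against a tail smaller by a
    factor [q], and [q] is arbitrary. *)
Lemma power_series_eq0 (d : nat -> C) (r B : R) : 0 < r ->
  (forall n, modulus (d n) <= B / r ^+ n) ->
  (forall w, modulus w < r -> cconv (fun N => \sum_(n < N) d n * w ^+ n) 0) ->
  forall n, d n = 0.
Proof.
move=> r0 hB hd; elim/ltn_ind => n IHn; apply: modulus_eq0; apply/eqP; apply: contraT => dn0.
have {dn0} dp : 0 < modulus (d n) by rewrite lt_def dn0 modulus_ge0.
have rn m : 0 < r ^+ m by rewrite exprn_gt0.
have B0 : 0 <= B by have := le_trans (modulus_ge0 _) (hB 0%N); rewrite expr0 divr1.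
have key (q : R) : 0 < q -> q <= 2^-1 -> modulus (d n) * r ^+ n <= 2 * B * q.
  move=> q0 q2; pose w : C := (q * r)%:C.
  have qr : 0 < q * r by rewrite mulr_gt0.
  have wm : modulus w = q * r by rewrite modulus_real gtr0_norm.
  have wr : modulus w < r by rewrite wm -[ltRHS]mul1r ltr_pM2r //; lra.
  have tail N : modulus (\sum_(m < N) d (n.+1 + m)%N * w ^+ (n.+1 + m)) <= 2 * (B * q ^+ n.+1).
    apply: le_trans (modulus_sum _ _ _) _.
    apply: (@le_trans _ _ (\sum_(m < N) B * q ^+ n.+1 * q ^+ m)).
      apply: ler_sum => m _; rewrite modulusM modulusX wm.
      rewrite exprMn -mulrA -exprD; have := hB (n.+1 + m)%N.
      rewrite ler_pdivlMr // => hm.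
      have := ler_wpM2r (exprn_ge0 (n.+1 + m) (ltW q0)) hm.
      by apply: le_trans; rewrite le_eqVlt; apply/orP; left; apply/eqP; ring.
    rewrite -mulr_sumr [leRHS]mulrC.
    by rewrite ler_wpM2l ?mulr_ge0 ?exprn_ge0 ?(ltW q0) // geometric_sum_le2 // ltW.
  have h : modulus (d n) * (q * r) ^+ n <= 2 * (B * q ^+ n.+1).
    apply/ler_addgt0Pr => e e0.
    have [N _ hN] := (proj1 (cconvP _ _)) (hd w wr) e e0.
    have := hN (n.+1 + N)%N; rewrite /= leq_addl subr0 => /(_ isT).
    rewrite big_split_ord /= big_ord_recr big1 /= => [|i _]; last first.
      by rewrite IHn ?mul0r.
    rewrite add0r => hs.
    rewrite -wm -modulusX -modulusM.
    have -> : d n * w ^+ n = (d n * w ^+ n + \sum_(m < N) d (n.+1 + m)%N * w ^+ (n.+1 + m)) -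
       \sum_(m < N) d (n.+1 + m)%N * w ^+ (n.+1 + m) by rewrite addrK.
    apply: le_trans (modulusB _ _) _; rewrite [leRHS]addrC.
    by apply: lerD; [exact: ltW hs|exact: tail].
  have qn : 0 < q ^+ n by rewrite exprn_gt0.
  rewrite -(ler_pM2r qn); move: h; rewrite exprMn exprS; lra.
have X0 : 0 < modulus (d n) * r ^+ n by rewrite mulr_gt0.
move: X0 key; move: (modulus (d n) * r ^+ n) => X X0 key.
have B4 : 0 < 4 * (B + 1) by rewrite mulr_gt0 // ltr_wpDl.
pose q := Num.min 2^-1 (X / (4 * (B + 1))).
have q0 : 0 < q by rewrite lt_min invr_gt0 ltr0n divr_gt0.
have q2 : q <= 2^-1 by rewrite ge_min lexx.
have qX : q * (4 * (B + 1)) <= X by rewrite -ler_pdivlMr // ge_min lexx orbT.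
have := key q q0 q2; nra.
Qed.

(** Squares of all sizes give the same coefficients, by uniqueness on the unit disc. So one sequence
    obeys the bounds [B / r^n] for every [r >= 1], with [B] depending on [r]; at [r = 2 t + 1] the
    series at [t] is dominated by a geometric one. *)
Theorem entire_power_series (f : C -> C) : entire f -> exists a : nat -> C,
  (forall t : R, 0 <= t -> exists B : R, forall n, \sum_(i < n) modulus (a i) * t ^+ i <= B) /\
  forall z, cconv (fun N => \sum_(n < N) a n * z ^+ n) (f z).
Proof.
move=> ef; have [a [B1 [ha fa]]] := taylor_disk (ltr01 : 0 < 1 :> R) ef.
have all (r : R) : 1 <= r -> (exists B, forall n, modulus (a n) <= B / r ^+ n) /\
    forall z, modulus z < r -> cconv (fun N => \sum_(n < N) a n * z ^+ n) (f z).
  move=> r1; have r0 : 0 < r by lra.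
  have [b [B [hb fb]]] := taylor_disk r0 ef.
  have ab n : a n = b n.
    apply/eqP; rewrite -subr_eq0; apply/eqP; move: n.
    apply: (@power_series_eq0 _ 1 (B1 + B) ltr01) => [n|w w1].
      rewrite expr1n divr1; apply: le_trans (modulusB _ _) _; apply: lerD.
        by have := ha n; rewrite expr1n divr1.
      apply: le_trans (hb n) _; rewrite ler_pdivrMr ?exprn_gt0 // ler_peMr //.
        by have := le_trans (modulus_ge0 _) (hb 0%N); rewrite expr0 divr1.
      exact: exprn_ege1.
    have := cconvB (fa w w1) (fb w (lt_le_trans w1 r1)); rewrite subrr.
    by apply: cconv_ext; apply: nearW => N; rewrite -sumrB; apply: eq_bigr => i _; rewrite mulrBl.
  have -> : a = b by apply/funext => n.
  by split; [exists B|].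
exists a; split; last first.
  move=> z; have z1 : 1 <= modulus z + 1 by rewrite lerDr modulus_ge0.
  by have [_] := all _ z1; apply; rewrite ltrDl.
move=> t t0; have r1 : 1 <= 2 * t + 1 by lra.
have [[B hB] _] := all _ r1.
have r0 : 0 < 2 * t + 1 by lra.
exists (B * 2) => n.
have B0 : 0 <= B by have := le_trans (modulus_ge0 _) (hB 0%N); rewrite expr0 divr1.
apply: (@le_trans _ _ (\sum_(i < n) B * (t / (2 * t + 1)) ^+ i)).
  apply: ler_sum => i _; have := ler_wpM2r (exprn_ge0 i t0) (hB i).
  by rewrite expr_div_n mulrA mulrAC.
rewrite -mulr_sumr ler_wpM2l // geometric_sum_le2 //.
  by rewrite divr_ge0 // ltW.
by rewrite ler_pdivrMr //; lra.
Qed.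

End Taylor.

(** * From functions to coefficient sequences *)

Section Representation.
Context {R : realType}.
Local Notation C := R[i].
Local Notation area := (@lebesgue_measure R \x @lebesgue_measure R)%E.
Variables (h : R -> R) (s : nat -> R).
Hypothesis h_cont : {within `[0, +oo[, continuous h}.
Hypothesis s_gt0 : forall n, 0 < s n.
Hypothesis s_ratio : forall B : R, exists N, forall n, (N <= n)%N -> B * s n <= s n.+1.
Hypothesis sE : forall n, fock_sqnorm h (fun z => z ^+ n) = (s n ^+ 2)%:E.

Definition represents (f : C -> C) (x : nat -> C) := forall z, has_sum_at s x z (f z).

Let repr_series f x : represents f x ->
  forall z, cconv (fun N => \sum_(n < N) (x n / (s n)%:C) * z ^+ n) (f z).
Proof.
move=> fx z; apply: cconv_ext (fx z); apply: nearW => N; apply: eq_bigr => n _.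
by rewrite /monom mulrA mulrAC.
Qed.

Let coef_sqr x n : modulus (x n / (s n)%:C) ^+ 2 * s n ^+ 2 = modulus (x n) ^+ 2.
Proof.
rewrite modulusM modulusV modulus_real gtr0_norm // -exprMn divfK //.
by rewrite gt_eqF.
Qed.

Lemma represents_sqnorm_le f x (B : R) : represents f x -> sqsum_le x B ->
  (fock_sqnorm h f <= B%:E)%E.
Proof.
move=> fx xB; apply: (fock_sqnorm_le h_cont sE (a := fun n => x n / (s n)%:C)) => [|N].
  exact: repr_series.
by under eq_bigr do rewrite coef_sqr; exact: xB.
Qed.

(** Separate from square-summability: for a function of the Fock space, absolute convergence is
    known from its Taylor series first, and the l^2 bound is deduced from it. *)
Definition abs_summable (x : nat -> C) := forall t : R, 0 <= t ->
  exists B, forall n, \sum_(i < n) modulus (x i / (s i)%:C) * t ^+ i <= B.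

Lemma represents_sqnorm_ge f x N : represents f x -> abs_summable x ->
  ((\sum_(n < N) modulus (x n) ^+ 2)%:E <= fock_sqnorm h f)%E.
Proof.
move=> fx ax; have := fock_sqnorm_ge h_cont sE N (a := fun n => x n / (s n)%:C) ax (repr_series fx).
by under eq_bigr do rewrite coef_sqr.
Qed.

Lemma sqsum_abs_summable x B : sqsum_le x B -> abs_summable x.
Proof.
move=> xB t t0; exists (B + ksum s t%:C) => n.
apply: (@le_trans _ _ (\sum_(i < n) (modulus (x i) ^+ 2 + modulus (monom s i t%:C) ^+ 2))).
  apply: ler_sum => i _.
  have -> : modulus (x i / (s i)%:C) * t ^+ i = modulus (x i) * modulus (monom s i t%:C).
    by rewrite modulus_monom // modulusM modulusV !modulus_real (ger0_norm t0) gtr0_norm // mulrAC mulrA.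
  have := sqr_ge0 (modulus (x i) - modulus (monom s i t%:C)).
  have := mulr_ge0 (modulus_ge0 (x i)) (modulus_ge0 (monom s i t%:C)).
  lra.
rewrite big_split /=; apply: lerD; first exact: xB.
exact: ksum_ub.
Qed.

Lemma fock_sqnorm_ge0 f : (0 <= fock_sqnorm h f)%E.
Proof. by apply: integral_ge0 => p _; rewrite lee_fin mulr_ge0 ?sqr_ge0 ?weight_ge0. Qed.

Lemma fock_normK f : (fock_sqnorm h f < +oo)%E -> fock_sqnorm h f = (fock_norm h f ^+ 2)%:E.
Proof.
move=> ff; have f0 := fock_sqnorm_ge0 f; rewrite sqr_sqrtr ?fine_ge0 //.
by rewrite fineK // ge0_fin_numE.
Qed.

Lemma represents_norm_le f x B : represents f x -> sqsum_le x B -> fock_norm h f ^+ 2 <= B.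
Proof.
move=> fx xB; have fB := represents_sqnorm_le fx xB.
by rewrite -lee_fin -fock_normK //; exact: le_lt_trans fB (ltry _).
Qed.

Lemma represents_sqsum f x : represents f x -> abs_summable x ->
  (fock_sqnorm h f < +oo)%E -> sqsum_le x (fock_norm h f ^+ 2).
Proof.
by move=> fx ax ff M; rewrite -lee_fin -fock_normK //; exact: represents_sqnorm_ge.
Qed.

Lemma represents_sqsum_norm f x B : represents f x -> sqsum_le x B ->
  sqsum_le x (fock_norm h f ^+ 2).
Proof.
move=> fx xB; apply: represents_sqsum => //; first exact: sqsum_abs_summable xB.
exact: le_lt_trans (represents_sqnorm_le fx xB) (ltry _).
Qed.

Lemma fock_space_represents f : fock_space h f ->
  exists x, represents f x /\ sqsum_le x (fock_norm h f ^+ 2).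
Proof.
move=> [ef ff]; have [a [ha fa]] := entire_power_series ef.
pose x n := a n * (s n)%:C; exists x.
have xa n : x n / (s n)%:C = a n by rewrite /x mulfK // fmorph_eq0 gt_eqF.
have fx : represents f x.
  move=> z; apply: cconv_ext (fa z); apply: nearW => N; apply: eq_bigr => n _.
  by rewrite -(xa n) /monom mulrAC mulrA.
split=> //; apply: represents_sqsum => // t t0; have [B hB] := ha t t0.
by exists B => n; under eq_bigr do rewrite xa; exact: hB.
Qed.

Lemma representsD f g x y : represents f x -> represents g y ->
  represents (fun z => f z + g z) (fun i => x i + y i).
Proof. by move=> fx gy z; exact: has_sum_atD. Qed.

Lemma representsZ c f x : represents f x -> represents (fun z => c * f z) (fun i => c * x i).
Proof. by move=> fx z; exact: has_sum_atZ. Qed.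

Lemma represents_sum (A : {fset C}) (F : C -> C -> C) (X : C -> nat -> C) :
  (forall l, l \in A -> represents (F l) (X l)) ->
  represents (fun z => \sum_(l <- A) F l z) (fun i => \sum_(l <- A) X l i).
Proof.
move=> FX; have : {subset enum_fset A <= A} by [].
elim: (enum_fset A) => [|l r IHr] rA z.
  rewrite big_nil; apply: cconv_ext (cconv_cst 0); apply: nearW => N.
  by rewrite big1 // => i _; rewrite big_nil mul0r.
have h1 := FX l (rA l (mem_head _ _)).
have h2 : represents (fun z => \sum_(l <- r) F l z) (fun i => \sum_(l <- r) X l i).
  by apply: IHr => y yr; apply: rA; rewrite inE yr orbT.
rewrite big_cons; apply: cconv_ext (representsD h1 h2 z).
by apply: nearW => N; apply: eq_bigr => i _; rewrite big_cons.
Qed.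

Definition unit_seq (m : nat) (c : C) (i : nat) : C := if i == m then c else 0.

Let unit_seqE m c : unit_seq m c m = c. Proof. by rewrite /unit_seq eqxx. Qed.

Lemma represents_monom m c : represents (fun z => c * monom s m z) (unit_seq m c).
Proof.
move=> z; have := @has_sum_at_finite R s (unit_seq m c) m.+1 z.
rewrite big_ord_recr big1 /=; last by move=> i _; rewrite /unit_seq ltn_eqF ?mul0r.
rewrite add0r unit_seqE; apply => i mi.
by rewrite /unit_seq gtn_eqF.
Qed.

Lemma sqsum_unit_seq m c : sqsum_le (unit_seq m c) (modulus c ^+ 2).
Proof.
move=> M; apply: le_trans (finite_sqsum (n := m.+1) _ M) _.
  by move=> i mi; rewrite /unit_seq gtn_eqF.
rewrite big_ord_recr big1 /=; last first.
  by move=> i _; rewrite /unit_seq ltn_eqF // modulus0 expr0n.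
by rewrite add0r /unit_seq eqxx.
Qed.

(** Changing one coefficient changes the squared norm accordingly. This exact form of Parseval
    follows from upper bounds only, because the perturbation can be undone. *)
Lemma norm_perturb f x B m c : represents f x -> sqsum_le x B ->
  fock_norm h (fun z => c * monom s m z + f z) ^+ 2 =
  fock_norm h f ^+ 2 + (modulus (x m + c) ^+ 2 - modulus (x m) ^+ 2).
Proof.
have half g y D d : represents g y -> sqsum_le y D ->
    sqsum_le (fun i => unit_seq m d i + y i)
      (fock_norm h g ^+ 2 + (modulus (y m + d) ^+ 2 - modulus (y m) ^+ 2)).
  move=> gy yD M; have hy := represents_sqsum_norm gy yD.
  apply: (@le_trans _ _ (\sum_(i < m.+1 + M) modulus (unit_seq m d i + y i) ^+ 2)).
    by rewrite addnC [leRHS]big_split_ord /= lerDl sumr_ge0 // => i _; rewrite sqr_ge0.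
  have := hy (m.+1 + M)%N; rewrite !big_split_ord /= !big_ord_recr /=.
  rewrite unit_seqE (addrC d).
  have -> : \sum_(i < m) modulus (unit_seq m d i + y i) ^+ 2 = \sum_(i < m) modulus (y i) ^+ 2.
    by apply: eq_bigr => i _; rewrite /unit_seq ltn_eqF // add0r.
  have -> : \sum_(i < M) modulus (unit_seq m d (m.+1 + i)%N + y (m.+1 + i)%N) ^+ 2 =
      \sum_(i < M) modulus (y (m.+1 + i)%N) ^+ 2.
    by apply: eq_bigr => i _; rewrite /unit_seq gtn_eqF ?add0r // addSn ltnS leq_addr.
  move: (\sum_(i < m) _) (\sum_(i < M) _) => S1 S2; lra.
move=> fx xB; have h1 := half f x B c fx xB.
have gx := representsD (represents_monom m c) fx.
have n1 := represents_norm_le gx h1.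
(* The same estimate with [- c] returns to [f] and gives the reverse inequality. *)
have h2 := half _ _ _ (- c) gx h1.
have gy : represents f (fun i => unit_seq m (- c) i + (unit_seq m c i + x i)).
  move=> z; apply: cconv_ext (fx z); apply: nearW => N; apply: eq_bigr => i _.
  by congr (_ * _); rewrite /unit_seq; case: eqP => _; rewrite ?add0r // addrA addNr add0r.
have n2 := represents_norm_le gy h2.
apply/eqP; rewrite eq_le n1 /=; move: n2.
rewrite unit_seqE (addrC c) addrK; lra.
Qed.

Lemma entire_scale_pow c n : entire (fun z : C => c * z ^+ n).
Proof.
move=> z; have d1 := @is_deriveX C C^o id n z 1 1 (is_derive_id _ _).
have d2 := @is_deriveZ C C^o C^o _ c _ _ _ d1.
have [d3 _] := d2.
have -> : (fun z : C => c * z ^+ n) = (c \*: (id : C^o -> C^o) ^+ n : C^o -> C^o); last exact: d3.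
by apply/funext => y /=; rewrite exprfctE.
Qed.

Lemma fock_space_monom m : fock_space h (monom s m).
Proof.
have e : monom s m = (fun z => 1 * monom s m z) by apply/funext => z; rewrite mul1r.
split; last first.
  rewrite e; apply: le_lt_trans (represents_sqnorm_le (represents_monom m 1) (@sqsum_unit_seq m 1)) _.
  exact: ltry.
have -> : monom s m = (fun z => (s m)%:C^-1 * z ^+ m) by apply/funext => z; rewrite /monom mulrC.
exact: entire_scale_pow.
Qed.

Lemma represents_measurable f x : represents f x -> plane_measurable f.
Proof.
move=> fx; have := lim_dilation_measurable (a := fun n => x n / (s n)%:C) (repr_series fx) 1.
by under eq_fun do rewrite mul1r.
Qed.

Let integrand f p := modulus (f (plane_point p)) ^+ 2 * weight h (plane_point p).

Let sqnorm_integrable f : plane_measurable f -> (fock_sqnorm h f < +oo)%E ->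
  area.-integrable setT (EFin \o integrand f).
Proof.
move=> mf ff; apply/integrableP; split.
  exact: (measurable_sqnorm_integrand h_cont mf).
apply: le_lt_trans ff; rewrite /fock_sqnorm le_eqVlt; apply/orP; left; apply/eqP.
by apply: eq_integral => p _; rewrite /= ger0_norm // mulr_ge0 ?sqr_ge0 ?weight_ge0.
Qed.

(** Only the real part is expressed through norms; the imaginary part is reached by multiplying the
    first argument by a unit. *)
Lemma inner_polarization f g : plane_measurable f -> plane_measurable g ->
  (fock_sqnorm h f < +oo)%E -> (fock_sqnorm h g < +oo)%E ->
  (fock_sqnorm h (fun z => (f z + g z)%R) < +oo)%E ->
  complex.Re (fock_inner h f g) =
  2^-1 * (fock_norm h (fun z => f z + g z) ^+ 2 - fock_norm h f ^+ 2 - fock_norm h g ^+ 2).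
Proof.
move=> mf mg ff fg ffg; have mfg := plane_measurableD mf mg.
have i1 := sqnorm_integrable mf ff; have i2 := sqnorm_integrable mg fg.
have i3 := sqnorm_integrable mfg ffg.
have nE f' : (fock_sqnorm h f' < +oo)%E -> fock_norm h f' ^+ 2 = Rintegral area setT (integrand f').
  by move=> ff'; rewrite /Rintegral -[X in fine X]/(fock_sqnorm h f') fock_normK.
rewrite (nE _ ff) (nE _ fg) (nE _ ffg) -RintegralB //.
have i4 : area.-integrable setT (EFin \o (fun p => integrand (fun z => f z + g z) p - integrand f p)).
  exact: (integrableB _ i3 i1).
rewrite -RintegralB // -RintegralZl //; last exact: (integrableB _ i4 i2).
apply: eq_Rintegral => p _; rewrite /integrand !modulus_sqr.
by case: (f _) (g _) => [a b] [c d] /=; field.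
Qed.

(** The reproducing property is tested on the orthonormal monomials, and the inner product with
    [monom s m] reads off the [m]-th coefficient of [k], up to conjugation. *)
Lemma reproducing_kernel_coef l k x : is_reproducing_kernel h l k -> represents k x ->
  sqsum_le x (fock_norm h k ^+ 2) -> forall m, x m = conjc (monom s m l).
Proof.
move=> [[ek kk] rk] kx xB m.
have mk := represents_measurable kx.
have re c : complex.Re (fock_inner h (fun z => c * monom s m z) k) =
    2^-1 * (modulus (x m + c) ^+ 2 - modulus (x m) ^+ 2 - modulus c ^+ 2).
  have rm := represents_monom m c.
  have f1 : (fock_sqnorm h (fun z => (c * monom s m z)%R) < +oo)%E.
    by apply: le_lt_trans (represents_sqnorm_le rm (@sqsum_unit_seq m c)) (ltry _).
  have f2 : (fock_sqnorm h (fun z => (c * monom s m z + k z)%R) < +oo)%E.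
    have b := sqsum_leD (@sqsum_unit_seq m c) xB.
    exact: le_lt_trans (represents_sqnorm_le (representsD rm kx) b) (ltry _).
  rewrite (inner_polarization (represents_measurable rm) mk f1 kk f2).
  rewrite (norm_perturb m c kx xB).
  have n0 : sqsum_le (fun=> 0 : C) 0 by move=> M; rewrite big1 // => i _; rewrite modulus0 expr0n.
  have r0 : represents (fun=> 0) (fun=> 0).
    move=> z; apply: cconv_ext (cconv_cst 0); apply: nearW => N.
    by rewrite big1 // => i _; rewrite mul0r.
  have := norm_perturb m c r0 n0; rewrite add0r modulus0 expr0n subr0.
  have -> : fock_norm h (fun=> 0) ^+ 2 = 0.
    by apply/eqP; rewrite eq_le sqr_ge0 (represents_norm_le r0 n0).
  under eq_fun do rewrite addr0; rewrite add0r => ->; ring.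
have e1 : monom s m = (fun z => 1 * monom s m z) by apply/funext => z; rewrite mul1r.
have := rk _ (fock_space_monom m) => hl.
have hRe : complex.Re (monom s m l) = complex.Re (x m).
  by rewrite hl {1}e1 re !modulus_sqr; case: (x m) => a b /=; field.
have hIm : complex.Im (monom s m l) = - complex.Im (x m).
  (* The imaginary part of [w] is the real part of [- i w]. *)
  rewrite hl; have -> : complex.Im (fock_inner h (monom s m) k) =
      complex.Re (fock_inner h (fun z => (0 -i* 1) * monom s m z) k).
    rewrite /fock_inner /=; apply: eq_Rintegral => p _.
    by case: (monom s m _) (k _) => [p1 q1] [p2 q2] /=; ring.
  by rewrite re !modulus_sqr; case: (x m) => a b /=; field.
by case: (x m) hRe hIm => a b /= <- hb; case: (monom s m l) hb => p q /= ->; rewrite opprK.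
Qed.

Lemma reproducing_kernel_norm l k : is_reproducing_kernel h l k ->
  represents k (fun m => conjc (monom s m l)) /\ fock_norm h k = Num.sqrt (ksum s l).
Proof.
move=> hk; have [x [kx xB]] := fock_space_represents hk.1.
have xE : x = (fun m => conjc (monom s m l)).
  by apply/funext => m; exact: reproducing_kernel_coef hk kx xB m.
rewrite xE in kx xB; split=> //.
have xK : sqsum_le (fun m => conjc (monom s m l)) (ksum s l).
  by move=> M; under eq_bigr do rewrite modulus_conj; exact: ksum_ub.
have le1 := represents_norm_le kx xK.
have le2 : ksum s l <= fock_norm h k ^+ 2.
  have cv := @ksum_cvg R s s_gt0 s_ratio l.
  rewrite -(cvg_lim _ cv) //; apply: limr_le; first exact: cvgP cv.
  by apply: nearW => M; have := xB M; under eq_bigr do rewrite modulus_conj.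
have e : fock_norm h k ^+ 2 = ksum s l by apply/eqP; rewrite eq_le le1.
by rewrite -e sqrtr_sqr ger0_norm // sqrtr_ge0.
Qed.

Lemma normalized_kernel_represents l k : is_reproducing_kernel h l k -> k = kernel_at h l ->
  represents (normalized_kernel h l) (nkernel s l).
Proof.
move=> hk kE; have [rk nk] := reproducing_kernel_norm hk.
rewrite /normalized_kernel -kE nk => z; have := representsZ ((Num.sqrt (ksum s l))^-1)%:C rk z.
apply: cconv_ext; apply: nearW => N; apply: eq_bigr => i _.
by rewrite /nkernel fmorphV /= [X in X * _]mulrC.
Qed.

(** If no kernel existed at [l], [kernel_at] would take its default value 0, and a single
    coefficient 1 would violate the lower Riesz bound. *)
Lemma riesz_basis_kernel (L : set C) l : riesz_basis h L (normalized_kernel h) -> L l ->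
  is_reproducing_kernel h l (kernel_at h l).
Proof.
move=> [_ [c1 [c2 [c10 c20 hc]]]] Ll; apply: contrapT => hno.
have k0 : kernel_at h l = (fun=> 0).
  rewrite /kernel_at xgetPN // => k hk; apply: hno.
  exact: (@xgetPex _ (fun=> 0) [set k | is_reproducing_kernel h l k] (ex_intro _ k hk)).
have Al : [set` [fset l]%fset] `<=` L by move=> z /=; rewrite inE => /eqP ->.
have [h1 _] := hc [fset l]%fset (fun=> 1) Al.
move: h1; rewrite big_seq_fset1 modulus1 expr1n mulr1.
have -> : lincomb (normalized_kernel h) [fset l]%fset (fun=> 1) = (fun=> 0).
  by apply/funext => z; rewrite /lincomb big_seq_fset1 /normalized_kernel k0 !mulr0.
have n0 : sqsum_le (fun=> 0 : C) 0 by move=> M; rewrite big1 // => i _; rewrite modulus0 expr0n.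
have r0 : represents (fun=> 0) (fun=> 0).
  move=> z; apply: cconv_ext (cconv_cst 0); apply: nearW => N.
  by rewrite big1 // => i _; rewrite mul0r.
by move=> hh; have := represents_norm_le r0 n0; lra.
Qed.

Lemma no_riesz_basis (V T : R) : 0 < V -> 0 < T ->
  (forall W e : R, 0 < W -> 0 < e -> exists rho r, [/\ 0 < rho, rho < e, 0 < r &
     forall z : C, r <= modulus z -> modulus z <= r * (1 + W * rho) ->
       variance_le s (V / rho ^+ 2) z /\ localized s (T * rho ^+ 2) z]) ->
  ~ exists L : set C, riesz_basis h L (normalized_kernel h).
Proof.
move=> V0 T0 region [L hL]; have ker := riesz_basis_kernel hL.
case: hL => comp [c1 [c2 [c10 c20 hc]]].
have lin A a : [set` A] `<=` L ->
    represents (lincomb (normalized_kernel h) A a) (kcomb s A a).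
  move=> AL; apply: represents_sum => l lA; apply: representsZ.
  by apply: normalized_kernel_represents (ker l _) _ => //; exact: AL.
have bounded A a : exists B, sqsum_le (kcomb s A a) B.
  rewrite /kcomb; elim: (enum_fset A) => [|l r [B hB]].
    by exists 0 => M; rewrite big1 // => i _; rewrite big_nil modulus0 expr0n.
  have nk : sqsum_le (nkernel s l) (modulus ((Num.sqrt (ksum s l))%:C^-1) ^+ 2 * ksum s l).
    apply: (@sqsum_le_ext _ (fun i => (Num.sqrt (ksum s l))%:C^-1 * conjc (monom s i l))).
      by move=> i; rewrite /nkernel mulrC.
    by apply: sqsum_leZ => M; under eq_bigr do rewrite modulus_conj; exact: ksum_ub.
  eexists; apply: sqsum_le_ext (sqsum_leD (sqsum_leZ (a l) nk) hB) => i.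
  by rewrite big_cons.
apply: (no_riesz_sequence s_gt0 s_ratio c10 c20 V0 T0 (L := L)) region.
- move=> A a B AL hB; have [h1 _] := hc A a AL.
  exact: le_trans h1 (represents_norm_le (lin A a AL) hB).
- move=> A a AL; have [_ h2] := hc A a AL; have [B hB] := bounded A a.
  exact: sqsum_leW h2 (represents_sqsum_norm (lin A a AL) hB).
- move=> n e e0; have se : 0 < Num.sqrt e by rewrite sqrtr_gt0.
  have [A [a [AL hA]]] := comp _ (fock_space_monom n) _ se.
  exists A, a; split=> //.
  have [B hB] := bounded A a.
  have r1 : represents (fun z => monom s n z - lincomb (normalized_kernel h) A a z)
      (fun i => (i == n)%:R - kcomb s A a i).
    move=> z; have := representsD (represents_monom n 1) (representsZ (-1) (lin A a AL)) z.
    rewrite mul1r mulN1r; apply: cconv_ext; apply: nearW => N; apply: eq_bigr => i _.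
    by rewrite /unit_seq mulN1r; case: eqP.
  have b1 : sqsum_le (fun i => (i == n)%:R - kcomb s A a i) (2 * modulus (1 : C) ^+ 2 + 2 * B).
    apply: sqsum_leB hB; apply: sqsum_le_ext (@sqsum_unit_seq n 1) => i.
    by rewrite /unit_seq; case: eqP.
  apply: sqsum_leW (represents_sqsum_norm r1 b1).
  by rewrite -[leRHS](sqr_sqrtr (ltW e0)) ler_sqr ?nnegrE ?sqrtr_ge0 // ltW.
Qed.

End Representation.

Theorem theorem1p1 (R : realType) (h psi psi' psi'' : R -> R)
  (h_cont : {within `[0, +oo[, continuous h})
  (psiE : forall t, psi t = h (expR t))
  (psi_derive : has_derivative_on `[0, +oo[ psi psi')
  (psi'_derive : has_derivative_on `[0, +oo[ psi' psi'')
  (psi''_incr : {in `[0, +oo[ &, {homo psi'' : s t / s <= t}})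
  (psi''_lim : psi'' t @[t --> +oo] --> +oo) :
  ~ exists Lambda : set R[i], riesz_basis h Lambda (normalized_kernel h).
Proof.
(* 140 and 2000 are the variance and localization constants obtained in [region_point]. *)
apply: (no_riesz_basis h_cont (coef_scale_gt0 h_cont psiE psi_derive psi'_derive psi''_incr psi''_lim)
  (coef_scale_growth h_cont psiE psi_derive psi'_derive psi''_incr psi''_lim)
  (fock_sqnorm_coef_scale h_cont psiE psi_derive psi'_derive psi''_incr psi''_lim)
  (ltr0n R 140) (ltr0n R 2000)) => W e W0 e0.
exact: (fock_region h_cont psiE psi_derive psi'_derive psi''_incr psi''_lim W0 e0).
Qed.
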